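(* Let $c\in\{-1,0,1\}$, let $n\ge 2$, let $X$ be the simply connected $n$-dimensional model space of constant curvature $c$, and let $1\le k\le n-1$. Let $f:X\to\mathbb{C}$ be a radial function with radial profile $\tilde f$, and let $\xi\in\Xi_k(X)$ be such that $R_kf(\xi)$ is defined (the integral defining it converges absolutely). Then $$s_c'\left(d(o,\xi)\right)R_kf(\xi)=K\int_{d(o,\xi)}^{\frac{\delta(X)}{2}}\tilde f\left(s_c\left(\tfrac t2\right)\right)\left[1-\left(\frac{(\ln s_c)'(t)}{(\ln s_c)'(d(o,\xi))}\right)^2\right]^{\frac k2-1}s_c^{k-1}(t)\,\mathrm{d}t,$$ where $K=|\mathbb{S}^{k-1}|$ if $c\ne 1$, and $K=2|\mathbb{S}^{k-1}|$ if $c=1$.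
   Context: The model spaces are $X=\mathbb{R}^n$ ($c=0$), $X=\mathbb{H}^n$, real hyperbolic space ($c=-1$), and $X=\mathbb{S}^n$, the unit sphere ($c=1$), each with its standard Riemannian metric of sectional curvature $c$ and Riemannian distance $d$. A point $o\in X$ is fixed as origin (realizing the spaces in $\mathbb{R}^{n+1}$ as $\{x_{n+1}=1\}$, the upper sheet of the hyperboloid, and the unit sphere, $o=e_{n+1}$). $\delta(X)$ is the diameter of $X$: $\delta(X)=\infty$ for $c=0,-1$ and $\delta(\mathbb{S}^n)=\pi$ (so $\delta(X)/2=\infty$ or $\pi/2$). The function $s_c$ is $s_0(t)=t$, $s_{-1}(t)=\sinh t$, $s_1(t)=\sin t$; thus $s_c'$ is $1$, $\cosh t$, $\cos t$ respectively, and $(\ln s_c)'=s_c'/s_c$. $\Xi_k(X)$ is the collection of all $k$-dimensional totally-geodesic submanifolds of $X$ that are (nonempty) intersections of $X$ with $(k+1)$-dimensional linear subspaces of $\mathbb{R}^{n+1}$ (i.e. the complete ones: $k$-planes, $k$-dimensional hyperbolic subspaces, great $k$-spheres). For $\xi\in\Xi_k(X)$, $d(o,\xi)=\inf_{x\in\xi}d(o,x)$. The $k$-plane transform of $f$ is $R_kf(\xi)=\int_\xi f(x)\,\mathrm{d}_\xi x$, where $\mathrm{d}_\xi x$ is the Riemannian measure of the metric induced on $\xi$. A (measurable) function $f:X\to\mathbb{C}$ is radial if there is a function $\tilde f:s_c\left([0,\delta(X)/4)\right)\to\mathbb{C}$ (its radial profile) such that $f(x)=\tilde f\left(s_c\left(d(o,x)/2\right)\right)$.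 On the sphere only even functions ($f(-x)=f(x)$) are considered, and this identity is required for $d(o,x)<\pi/2$. $|\mathbb{S}^{k-1}|$ is the $(k-1)$-dimensional surface measure of the unit sphere in $\mathbb{R}^k$, with $|\mathbb{S}^0|=2$. Conventions for degenerate cases: if $d(o,\xi)=0$ then the ratio $(\ln s_c)'(t)/(\ln s_c)'(d(o,\xi))$ is interpreted as $0$; if $c=1$ and $d(o,\xi)=\pi/2$ then both sides are interpreted as $0$. *)

(* Defs.v *)
From HB Require Import structures.
From mathcomp Require Import all_boot all_order all_algebra.
From mathcomp Require Import complex.
From mathcomp Require Import all_classical all_reals all_analysis.
Set Implicit Arguments.
Unset Strict Implicit.
Unset Printing Implicit Defensive.
Import Order.TTheory GRing.Theory Num.Theory numFieldNormedType.Exports.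
Local Open Scope classical_set_scope.
Local Open Scope ring_scope.
Local Open Scope complex_scope.

Definition measure_rV_display : measure_display -> measure_display.
Proof. exact. Qed.

(* The sigma-algebra generated by the coordinates, as the library does for
   n.-tuple T; for T = R it is the Borel sigma-algebra of 'rV[R]_n. *)
Section measurable_rV.
Context {d} {T : measurableType d}.
Variable n : nat.

Let coors : 'I_n -> 'rV[T]_n -> T := fun i x => x ord0 i.

Let rV_set0 : g_sigma_preimage coors set0.
Proof. exact: sigma_algebra0. Qed.

Let rV_setC A : g_sigma_preimage coors A -> g_sigma_preimage coors (~` A).
Proof. exact: sigma_algebraC. Qed.

Let rV_bigcup (F : (set 'rV[T]_n)^nat) :
  (forall i, g_sigma_preimage coors (F i)) ->
  g_sigma_preimage coors (\bigcup_i (F i)).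
Proof. exact: sigma_algebra_bigcup. Qed.

HB.instance Definition _ := @isMeasurable.Build (measure_rV_display d)
  'rV[T]_n (g_sigma_preimage coors) rV_set0 rV_setC rV_bigcup.

End measurable_rV.

Section measurable_rV_lemmas.
Context {R : realType}.

Lemma measurable_coord n (i : 'I_n) :
  measurable_fun [set: 'rV[R]_n] (fun x : 'rV[R]_n => x ord0 i).
Proof.
move=> _ Y mY; rewrite setTI; apply: sub_sigma_algebra => /=.
rewrite -bigcup_seq/=; exists i => /=; first by rewrite mem_index_enum.
by exists Y => //; rewrite setTI.
Qed.

Lemma measurable_fun_rVP d (T : measurableType d) n (f : T -> 'rV[R]_n) :
  (forall i, measurable_fun [set: T] (fun x => f x ord0 i)) ->
  measurable_fun [set: T] f.
Proof.
move=> mf.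
have H : g_sigma_preimage (fun i => (fun x : 'rV[R]_n => x ord0 i) \o f)
    `<=` measurable.
  apply: smallest_sub; first exact: sigma_algebra_measurable.
  case: n => [|n] in f mf *; first by rewrite big_ord0.
  rewrite -bigcup_mkord_ord; apply: bigcup_sub => i Ii.
  by move=> A [B mB <-]; exact: mf.
rewrite g_sigma_preimage_comp in H.
by move=> _ A mA; apply: H; exists A.
Qed.

End measurable_rV_lemmas.

(* Lebesgue measure on R^n, as the iterated product of the one-dimensional
   Lebesgue measure, transported along R * R^n -> R^(n+1). *)
Section lebesgue_rV.
Context {R : realType}.

Definition rV_cons n (p : (measurableTypeR R * 'rV[R]_n)%type) : 'rV[R]_n.+1 :=
  row_mx (const_mx (p.1 : R) : 'rV[R]_1) p.2.

Definition rV_uncons n (v : 'rV[R]_n.+1) : (measurableTypeR R * 'rV[R]_n)%type :=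
  (v ord0 ord0, rsubmx (v : 'rV[R]_(1 + n))).

Lemma rV_consK n : cancel (@rV_cons n) (@rV_uncons n).
Proof.
case=> x v; congr pair; last by rewrite row_mxKr.
by rewrite /rV_cons mxE; case: splitP => j //= _; rewrite mxE.
Qed.

Lemma measurable_rV_cons n : measurable_fun setT (@rV_cons n).
Proof.
apply: measurable_fun_rVP => i.
have [j ij|j ij] := @splitP 1 n i.
  rewrite (_ : (fun _ => _) = fst); first exact: measurable_fst.
  apply/funext => -[x v]; rewrite /rV_cons mxE.
  case: splitP => l il; first by rewrite mxE.
  by move: (ltn_ord j); rewrite -ij il.
rewrite (_ : (fun _ => _) = (fun v : 'rV[R]_n => v ord0 j) \o snd).
  by apply: measurableT_comp; [exact: measurable_coord|exact: measurable_snd].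
apply/funext => -[x v]; rewrite /rV_cons mxE.
case: splitP => l il; first by move: (ltn_ord l); rewrite -il ij.
by congr (v _ _); apply/val_inj/eqP; rewrite -(eqn_add2l 1) -il ij.
Qed.

Lemma measurable_rV_uncons n : measurable_fun setT (@rV_uncons n).
Proof.
apply: measurable_fun_pair => /=; first exact: measurable_coord.
apply: measurable_fun_rVP => i; rewrite (_ : (fun _ => _) =
    (fun v : 'rV[R]_n.+1 => v ord0 (rshift 1 i : 'I_n.+1))).
  exact: measurable_coord.
by apply/funext => v; rewrite mxE.
Qed.

Section cons_measure.
Variables (n : nat) (m : {sigma_finite_measure set 'rV[R]_n -> \bar R}).

Definition cons_measure : set 'rV[R]_n.+1 -> \bar R :=
  pushforward (@lebesgue_measure R \x m)%E (@rV_cons n).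

Let cons_measure0 : cons_measure set0 = 0%E.
Proof. by rewrite /cons_measure /pushforward preimage_set0 measure0. Qed.

Let cons_measure_ge0 A : (0 <= cons_measure A)%E.
Proof. by rewrite /cons_measure /pushforward; exact: measure_ge0. Qed.

Let cons_measure_sigma_additive : semi_sigma_additive cons_measure.
Proof.
have mc := @measurable_rV_cons n.
move=> F mF tF mUF; rewrite /cons_measure /pushforward preimage_bigcup.
apply: measure_semi_sigma_additive.
- by move=> k; rewrite -[X in measurable X]setTI; exact: mc.
- apply/trivIsetP => /= i j _ _ ij; rewrite -preimage_setI.
  by move/trivIsetP : tF => /(_ _ _ _ _ ij) ->//; rewrite preimage_set0.
- by rewrite -preimage_bigcup -[X in measurable X]setTI; exact: mc.
Qed.

HB.instance Definition _ := isMeasure.Build _ _ _ cons_measure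
  cons_measure0 cons_measure_ge0 cons_measure_sigma_additive.

Let cons_measure_sigma_finite : sigma_finite setT cons_measure.
Proof.
have /sigma_finiteP[F [TF ndF Foo]] := sigma_finiteT (@lebesgue_measure R).
have /sigma_finiteP[G [TG ndG Goo]] := sigma_finiteT m.
exists (fun k => @rV_uncons n @^-1` (F k `*` G k)).
  rewrite -preimage_bigcup (_ : \bigcup_k _ = setT) ?preimage_setT//.
  apply/seteqP; split=> // -[x y] _.
  have [k _ Fkx] : (\bigcup_k F k) x by rewrite -TF.
  have [l _ Gly] : (\bigcup_k G k) y by rewrite -TG.
  exists (maxn k l) => //; split=> /=.
  - by move: x Fkx; exact/subsetPset/ndF/leq_maxl.
  - by move: y Gly; exact/subsetPset/ndG/leq_maxr.
move=> k; have [mF Fk] := Foo k; have [mG Gk] := Goo k; split.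
  rewrite -[X in measurable X]setTI.
  by apply: measurable_rV_uncons => //; exact: measurableX.
rewrite /cons_measure /pushforward -comp_preimage.
rewrite (_ : _ \o _ = id); last by apply/funext => p; exact: rV_consK.
by rewrite preimage_id product_measure1E// lte_mul_pinfty// ge0_fin_numE.
Qed.

HB.instance Definition _ := Measure_isSigmaFinite.Build _ _ _ cons_measure
  cons_measure_sigma_finite.

End cons_measure.

Fixpoint lebesgue_rV n : {sigma_finite_measure set 'rV[R]_n -> \bar R} :=
  match n with
  | 0 => \d_(0 : 'rV[R]_0)
  | m.+1 => cons_measure (lebesgue_rV m)
  end.

End lebesgue_rV.

Section complex_integral.
Context d {T : measurableType d} {R : realType}.
Variables (mu : {measure set T -> \bar R}) (D : set T) (f : T -> R[i]).

Definition cmeasurable : Prop :=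
  measurable_fun D (fun x => complex.Re (f x)) /\ measurable_fun D (fun x => complex.Im (f x)).

Definition cintegrable : Prop :=
  mu.-integrable D (fun x => (complex.Re (f x))%:E) /\
  mu.-integrable D (fun x => (complex.Im (f x))%:E).

Definition cintegral : R[i] :=
  (\int[mu]_(x in D) complex.Re (f x))%R +i* (\int[mu]_(x in D) complex.Im (f x))%R.

End complex_integral.

(* Submanifolds of 'rV[R]_N, with the metric induced by the bilinear form of
   matrix g (assumed positive definite on their tangent spaces).  All
   parametrizations and curves below are of class C^1. *)
Section riemannian.
Context {R : realType} {N : nat}.
Variables (g : 'M[R]_N) (M : set 'rV[R]_N).

Definition form (u v : 'rV[R]_N) : R := (u *m g *m v^T) ord0 ord0.

Definition curve_in (gamma : R -> 'rV[R]_N) : Prop :=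
  [/\ forall t, derivable gamma t 1, continuous (derive1 gamma)
    & forall t, 0 <= t <= 1 -> M (gamma t)].

Definition curve_length (gamma : R -> 'rV[R]_N) : R :=
  (\int[lebesgue_measure]_(t in `[0, 1])
     Num.sqrt (form (derive1 gamma t) (derive1 gamma t)))%R.

Definition riemannian_dist (x y : 'rV[R]_N) : R :=
  inf [set l | exists gamma, [/\ curve_in gamma, gamma 0 = x, gamma 1 = y
                               & l = curve_length gamma]].

Definition parametrization k (U : set 'rV[R]_k) (phi : 'rV[R]_k -> 'rV[R]_N)
    : Prop :=
  [/\ open U, set_inj U phi, phi @` U `<=` M
    & forall p, U p -> [/\ differentiable phi p,
        {for p, continuous (jacobian phi)} & row_free (jacobian phi p)]].

(* The rows of jacobian phi p are the partial derivatives of phi at p, so the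
   determinant is that of the matrix of the metric in the coordinates phi. *)
Definition volume_density k (phi : 'rV[R]_k -> 'rV[R]_N) (p : 'rV[R]_k) : R :=
  Num.sqrt (\det (jacobian phi p *m g *m (jacobian phi p)^T)).

(* mu is the Riemannian measure of the k-dimensional submanifold M, seen as a
   Borel measure on the ambient space: it is carried by M and is given by
   sqrt(det g_ij) dp in all local coordinates. *)
Definition is_riemannian_measure k (mu : {measure set 'rV[R]_N -> \bar R})
    : Prop :=
  mu (~` M) = 0%E /\
  forall U (phi : 'rV[R]_k -> 'rV[R]_N), parametrization U phi ->
  forall B, measurable B ->
    mu (B `&` phi @` U) =
    (\int[lebesgue_rV k]_(p in U `&` phi @^-1` B) (volume_density phi p)%:E)%E.

End riemannian.

(* The model spaces of curvature c = -1, 0, 1. *)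
Inductive model : Type := hyperbolic | euclidean | spherical.

Unset Implicit Arguments.

Section model_spaces.
Context {R : realType}.

Definition ambient_metric (c : model) n : 'M[R]_n.+1 :=
  if c is hyperbolic
  then diag_mx (\row_i (if i == ord_max then -1 else 1)) else 1%:M.

Definition space (c : model) n : set 'rV[R]_n.+1 :=
  match c with
  | hyperbolic => [set x | form (ambient_metric hyperbolic n) x x = -1 /\
                           0 < x ord0 ord_max]
  | euclidean => [set x | x ord0 ord_max = 1]
  | spherical => [set x | form (ambient_metric spherical n) x x = 1]
  end.

Definition origin n : 'rV[R]_n.+1 := delta_mx ord0 ord_max.

Definition dist (c : model) {n} : 'rV[R]_n.+1 -> 'rV[R]_n.+1 -> R :=
  riemannian_dist (ambient_metric c n) (space c n).

Definition dist_set (c : model) {n} (x : 'rV[R]_n.+1) (A : set 'rV[R]_n.+1) : R :=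
  inf [set dist c x y | y in A].

Definition diameter (c : model) : \bar R :=
  if c is spherical then (pi%:E)%E else +oo%E.

Definition s_ (c : model) (t : R) : R :=
  match c with
  | hyperbolic => (expR t - expR (- t)) / 2
  | euclidean => t
  | spherical => sin t
  end.

(* (ln s_c)'(t) *)
Definition dln_s (c : model) (t : R) : R := derive1 (s_ c) t / s_ c t.

(* The ratio is read as 0 at d = 0. *)
Definition dln_s_ratio (c : model) (t d : R) : R :=
  if d == 0 then 0 else dln_s c t / dln_s c d.

Definition Xi (c : model) n k : set (set 'rV[R]_n.+1) :=
  [set xi | xi !=set0 /\ exists V : {vspace 'rV[R]_n.+1},
     \dim V = k.+1 /\ xi = [set x | space c n x /\ x \in V]].

(* Only the values of the profile ft on s_c([0, diameter / 4)) matter. *)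
Definition radial (c : model) {n} (f : 'rV[R]_n.+1 -> R[i]) (ft : R -> R[i])
    : Prop :=
  [/\ cmeasurable (space c n) f,
      (c = spherical -> forall x, space c n x -> f (- x) = f x)
    & forall x, space c n x ->
        ((dist c (origin n) x)%:E < diameter c * (2^-1)%:E)%E ->
        f x = ft (s_ c (dist c (origin n) x / 2))].

(* mu stands for the Riemannian measure of xi. *)
Definition kplane_transform {n} (mu : {measure set 'rV[R]_n.+1 -> \bar R})
    (f : 'rV[R]_n.+1 -> R[i]) (xi : set 'rV[R]_n.+1) : R[i] :=
  cintegral mu xi f.

Definition unit_sphere k : set 'rV[R]_k :=
  [set x | \sum_(i < k) x ord0 i ^+ 2 = 1].

End model_spaces.

(* Main.v *)
(* Write [S = s_c] and [C = S'], so that [C^2 + c S^2 = 1].  Let [p] be the point of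
   [xi] nearest to the origin [o], at distance [d].  A point of [xi] is
   [C(t)/C(d) p + W(t)/C(d) u] with [u] a unit vector orthogonal to [o] and [p],
   [W^2 = S(t)^2 - S(d)^2], and [t] its distance to [o].  In the coordinates [(t, u)]
   the metric of [xi] is [(S/W)^2 dt^2 + (W/C(d))^2 du^2], so its Riemannian measure
   is [(S/W) (W/C(d))^(k-1) dt du].  The formula follows since
   [1 - ((ln S)'(t) / (ln S)'(d))^2 = (W / (S(t) C(d)))^2].  On the sphere [- p]
   contributes a second, congruent sheet, and the planes inside the equator
   ([d = pi/2]) have [C(d) = 0] and an empty range of integration.

   To compute the measure, [u] is charted by two stereographic half-spheres, whose
   total area is the same integral as for the round unit sphere.  The distance to [o]
   is bounded below by comparing a function of the coordinates with arc length along
   an arbitrary curve, and attained by a geodesic. *)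

From HB Require Import structures.
Require Import Defs.
From mathcomp Require Import all_boot all_order all_algebra.
From mathcomp Require Import complex.
From mathcomp Require Import all_classical all_reals all_analysis.
From mathcomp Require Import measurable_realfun.
From mathcomp Require Import ring lra.
Import Order.TTheory GRing.Theory Num.Theory numFieldNormedType.Exports.
Local Open Scope classical_set_scope.
Local Open Scope ring_scope.
Local Open Scope complex_scope.

Set Implicit Arguments.
Unset Strict Implicit.
Unset Printing Implicit Defensive.

(** * Differentials of vector-valued maps *)

(** The Riemannian measure is given only through integrals over charts, so everything rests on
    charts whose volume density is a product [rho(t) * Y(t)^m * conf(q)^m], with [k = m + 1].
    Tonelli then splits the measure of a set described by the radius into an integral in [t] and a
    constant, and the same constant comes out for the measure [sigma] of the unit sphere. Thus
    [|S^(k-1)|] never has to be evaluated; it is enough that it is finite and positive. What results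
    is the law of the radius under [mu], which transfers every integral over [xi] to the half-line
    or interval of radii. For [k = 1] the sphere is two points, each carrying the Dirac mass of
    ['rV_0].

    The distance to [o] is not differentiable at [o], where every competing curve starts. The
    comparison function is therefore regularized by a parameter [a > 0], at a cost of at most [a] in
    the lower bound on the length.

    The profile is multiplied by real factors only, so real and imaginary parts are treated
    separately. *)

Lemma is_diff_rV (R : realType) (V : normedModType R) n
    (f df : V -> 'rV[R]_n) (x : V) :
  (forall j, is_diff x (fun y => f y ord0 j) (fun v => df v ord0 j)) ->
  is_diff x f df.
Proof.
move=> h.
have fE (g : V -> 'rV[R]_n) :
    g = \sum_(j < n) (fun y => g y ord0 j *: (delta_mx ord0 j : 'rV[R]_n)).
  by apply/funext => y; rewrite fct_sumE [LHS]row_sum_delta.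
have d j : differentiable (fun y => f y ord0 j *: (delta_mx ord0 j : 'rV[R]_n)) x.
  by apply: differentiableZl; have [] := h j.
rewrite (fE f) (fE df); elim/big_ind2 : _ => [|a b a' b' ha hb|j _].
- exact: is_diff_cst.
- exact: is_diffD.
- apply: DiffDef => //; have [dj djE] := h j.
  by rewrite diffZl// djE.
Qed.

Lemma is_diff_coord (R : realType) m n (M : 'M[R]_(m, n)) i j :
  is_diff M (fun N : 'M[R]_(m, n) => N i j) (fun N => N i j).
Proof.
have @f : {linear 'M[R]_(m, n) -> R}.
  by exists (fun N : 'M[R]_(_, _) => N i j); do 2![eexists]; do ?[constructor];
     rewrite ?mxE// => ? *; rewrite ?mxE//; move=> ?; rewrite !mxE.
rewrite (_ : (fun _ => _) = f) //; apply: DiffDef.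
  exact/linear_differentiable/coord_continuous.
by rewrite diff_lin//; exact/coord_continuous.
Qed.

Lemma is_diff_derive (R : realType) (f : R -> R) (a df : R) :
  is_derive a 1 f df -> is_diff a f (fun h => h * df).
Proof.
move=> [dfa dfE]; apply: DiffDef; first exact/derivable1_diffP.
by rewrite deriv1E// derive1E dfE.
Qed.

Lemma jacobianE (R : realType) m n (f : 'rV[R]_m -> 'rV[R]_n) x J :
  is_diff x f (mulmx^~ J) -> differentiable f x /\ jacobian f x = J.
Proof.
move=> [df dfE]; split => //; rewrite /jacobian dfE.
by apply/matrixP => i j; rewrite mxE -rowE mxE.
Qed.

Lemma is_diff_rowcoord (R : realType) (V : normedModType R) m
    (f df : V -> 'rV[R]_m) (x : V) k :
  is_diff x f df -> is_diff x (fun y => f y ord0 k) (fun v => df v ord0 k).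
Proof. by move=> h; exact: (is_diff_comp h (is_diff_coord (f x) ord0 k)). Qed.

Lemma is_diff_mulmxr (R : realType) (V : normedModType R) m n
    (f df : V -> 'rV[R]_m) (x : V) (E : 'M[R]_(m, n)) :
  is_diff x f df -> is_diff x (fun y => f y *m E) (fun v => df v *m E).
Proof.
move=> h; apply: is_diff_rV => j.
rewrite (_ : (fun y => _) = \sum_(k < m) (fun y => f y ord0 k * E k j)).
rewrite (_ : (fun v => _) = \sum_(k < m) (fun y => df y ord0 k * E k j)).
elim/big_ind2 : _ => [|a b a' b' ha hb|k _].
- exact: is_diff_cst.
- exact: is_diffD.
- have hk := is_diff_rowcoord k h.
  rewrite [X in is_diff x X](_ : _ = E k j *: (fun y => f y ord0 k)); last first.
    by apply/funext => y; rewrite mulrC.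
  apply: is_diff_eq; apply/funext => y; by rewrite mulrC.
by apply/funext => y; rewrite fct_sumE mxE.
by apply/funext => y; rewrite fct_sumE mxE.
Qed.

Lemma is_diff_scale (R : realType) (V : normedModType R) n
    (k dk : V -> R) (f df : V -> 'rV[R]_n) (x : V) :
  is_diff x k dk -> is_diff x f df ->
  is_diff x (fun y => k y *: f y) (fun v => k x *: df v + dk v *: f x).
Proof.
move=> hk hf; apply: is_diff_rV => j.
have hj := is_diff_rowcoord j hf.
rewrite (_ : (fun y => _) = k * (fun y => f y ord0 j)); last first.
  by apply/funext => y; rewrite mxE.
apply: is_diff_eq (is_diffM hk hj) _.
by apply/funext => y; rewrite !mxE [dk y * _]mulrC.
Qed.

Lemma mx_continuousP (R : realType) (V : topologicalType) m n
    (A : V -> 'M[R]_(m, n)) (x : V) :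
  (forall i j, {for x, continuous (fun y => A y i j)}) ->
  {for x, continuous A}.
Proof.
move=> h; apply/cvgrPdist_le => /= e e0; near=> y.
rewrite /Num.Def.normr/= mx_normrE (bigmax_le _ (ltW e0))//= => i _.
rewrite !mxE/=; move: i; near: y; apply: filter_forall => /= i.
exact: ((cvgrPdist_le _ _).1 (h i.1 i.2)).
Unshelve. all: by end_near. Qed.

Definition dot (R : realType) n (u v : 'rV[R]_n) : R := (u *m v^T) ord0 ord0.

Lemma dotE (R : realType) n (u v : 'rV[R]_n) :
  dot u v = \sum_(i < n) u ord0 i * v ord0 i.
Proof. by rewrite /dot mxE; apply: eq_bigr => i _; rewrite mxE. Qed.

Lemma dot_ge0 (R : realType) n (u : 'rV[R]_n) : 0 <= dot u u.
Proof. by rewrite dotE; apply: sumr_ge0 => i _; rewrite -expr2 sqr_ge0. Qed.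

Lemma dotC (R : realType) n (u v : 'rV[R]_n) : dot u v = dot v u.
Proof. by rewrite !dotE; apply: eq_bigr => i _; rewrite mulrC. Qed.

Lemma dotZ (R : realType) n (a : R) (u : 'rV[R]_n) :
  dot (a *: u) (a *: u) = a ^+ 2 * dot u u.
Proof.
by rewrite !dotE mulr_sumr; apply: eq_bigr => i _; rewrite !mxE; ring.
Qed.

Lemma mulmx_dot (R : realType) n (u v : 'rV[R]_n) : u *m v^T = (dot u v)%:M.
Proof. by rewrite [LHS]mx11_scalar. Qed.

Lemma is_diff_dot (R : realType) n (x : 'rV[R]_n) :
  is_diff x (fun y => dot y y) (fun v => 2 * dot v x).
Proof.
rewrite [X in is_diff _ X](_ : _ = \sum_(k < n) (fun y : 'rV[R]_n => y ord0 k * y ord0 k)); last first.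
  by apply/funext => y; rewrite fct_sumE dotE.
rewrite [X in is_diff _ _ X](_ : _ = \sum_(k < n) (fun v : 'rV[R]_n => 2 * (v ord0 k * x ord0 k))); last first.
  by apply/funext => y; rewrite fct_sumE dotE mulr_sumr.
elim/big_ind2 : _ => [|a b a' b' ha hb|k _].
- exact: is_diff_cst.
- exact: is_diffD.
- have hk := is_diff_coord x ord0 k.
  apply: is_diff_eq (is_diffM hk hk) _; apply/funext => y /=.
  by rewrite /GRing.scale /= mulr_natl mulr2n mulrC.
Qed.

Lemma row_mx_uncons (R : realType) m (s : 'rV[R]_m.+1) :
  s = row_mx (s ord0 ord0)%:M (rsubmx (s : 'rV[R]_(1 + m))).
Proof.
rewrite (_ : (s ord0 ord0)%:M = lsubmx (s : 'rV[R]_(1 + m))) ?[RHS]hsubmxK//.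
by rewrite [RHS]mx11_scalar mxE; congr ((s _ _)%:M); exact: val_inj.
Qed.

Lemma row_mx_first (R : realType) m (t : R) (q : 'rV[R]_m) :
  (row_mx (t%:M : 'M[R]_1) q : 'rV[R]_m.+1) ord0 ord0 = t.
Proof.
rewrite (_ : ord0 = lshift m (ord0 : 'I_1)); last exact: val_inj.
by rewrite [LHS]row_mxEl mxE eqxx mulr1n.
Qed.

(** * Stereographic charts of the unit sphere *)

Section stereographic.
Context {R : realType} {m : nat}.
Implicit Types q : 'rV[R]_m.

(** The conformal factor of inverse stereographic projection. *)
Definition conf q : R := 2 / (1 + dot q q).

Lemma conf_gt0 q : 0 < conf q.
Proof. by rewrite divr_gt0// ltr_wpDr// dot_ge0. Qed.

Lemma conf_dot q : conf q * (1 + dot q q) = 2.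
Proof. by rewrite /conf divfK// gt_eqF// ltr_wpDr// dot_ge0. Qed.

Lemma is_diff_conf q :
  is_diff q conf (fun v => - (conf q ^+ 2) * dot v q).
Proof.
have h0 : 1 + dot q q != 0 by rewrite gt_eqF// ltr_wpDr// dot_ge0.
have hd : is_diff q (fun y => 1 + dot y y) (fun v => 2 * dot v q).
  have hdot := is_diff_dot q.
  have H := is_diffD (is_diff_cst (1 : R) q) hdot.
  apply: (is_diff_eq H).
  by apply/funext => v; exact: add0r.
rewrite (_ : conf = 2 *: (fun y : 'rV[R]_m => (1 + dot y y)^-1)); last exact/funext.
apply: DiffDef.
  by apply/differentiableZ/differentiableV => //; have [] := hd.
rewrite diffZ; last by apply: differentiableV => //; have [] := hd.
rewrite diffV//.
have [_ ->] := hd; apply/funext => v.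
transitivity (2 * (- (1 + dot q q) ^- 2 * (2 * dot v q))); first by [].
transitivity (- (2 * (1 + dot q q)^-1) ^+ 2 * dot v q); last by [].
by field.
Qed.

Variable e : R.
Hypothesis e2 : e ^+ 2 = 1.

(** Inverse stereographic projection from the pole [- e] of the first axis: [conf q - 1] is
    [(1 - |q|^2) / (1 + |q|^2)], so [q = 0] goes to the pole [e]. *)
Definition stereo q : 'rV[R]_m.+1 :=
  row_mx ((e * (conf q - 1))%:M : 'M[R]_1) (conf q *: q).

Definition stereoJ q : 'M[R]_(m, m.+1) :=
  row_mx (- (e * conf q ^+ 2) *: q^T)
         ((conf q)%:M - conf q ^+ 2 *: (q^T *m q)).

Let mul_row_rowT k l (A : 'M[R]_(k, 1)) (B : 'M[R]_(k, m))
    (A' : 'M[R]_(l, 1)) (B' : 'M[R]_(l, m)) :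
  (row_mx A B : 'M[R]_(k, m.+1)) *m (row_mx A' B' : 'M[R]_(l, m.+1))^T =
  A *m A'^T + B *m B'^T.
Proof.
(* Re-types [m.+1] as the convertible [1 + m] that block matrices use; the same cast recurs
   below. *)
transitivity ((row_mx A B : 'M[R]_(k, 1 + m)) *m (row_mx A' B')^T) => //.
by rewrite tr_row_mx mul_row_col.
Qed.

Let mul_stereoJ (v : 'rV[R]_m) q : v *m stereoJ q =
  row_mx (v *m (- (e * conf q ^+ 2) *: q^T))
         (v *m ((conf q)%:M - conf q ^+ 2 *: (q^T *m q))).
Proof. exact: (@mul_mx_row _ _ _ 1 m v). Qed.

Lemma is_diff_stereo q : is_diff q stereo (mulmx^~ (stereoJ q)).
Proof.
have hc := is_diff_conf q.
apply: is_diff_rV => j.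
case: (@splitP 1 m j) => i ji.
  have {ji} -> : j = lshift m i by apply: val_inj.
  rewrite [X in is_diff _ X](_ : _ = e *: (fun y => conf y + (-1))); last first.
    by apply/funext => y; rewrite [LHS]row_mxEl mxE (ord1 i) eqxx.
  have H := is_diffZ e (is_diffD hc (is_diff_cst (- 1 : R) q)).
  apply: (is_diff_eq H).
  apply/funext => v; rewrite mul_stereoJ [RHS]row_mxEl -scalemxAr mxE ord1 -/(dot v q).
  transitivity (e * (- (conf q ^+ 2) * dot v q + 0)); first by [].
  by rewrite (ord1 i) -/(dot v q); ring.
have {ji} -> : j = rshift 1 i by apply: val_inj.
rewrite [X in is_diff _ X](_ : _ = (fun y => (conf y *: y) ord0 i)); last first.
  by apply/funext => y; rewrite [LHS]row_mxEr.
have H := is_diff_rowcoord i (is_diff_scale hc (is_diff_id q)).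
apply: (is_diff_eq H); apply/funext => v.
rewrite mul_stereoJ [RHS]row_mxEr mulmxBr mul_mx_scalar -scalemxAr mulmxA mulmx_dot.
by rewrite mul_scalar_mx scalerA mulNr scaleNr.
Qed.

(** Conformality of the projection; its volume density is therefore [conf ^ m]. *)
Lemma stereoJ_gram q : stereoJ q *m (stereoJ q)^T = (conf q ^+ 2)%:M.
Proof.
rewrite /stereoJ; move: (conf q) (conf_dot q) => c hc.
rewrite [LHS]mul_row_rowT.
have -> : (c%:M - c ^+ 2 *: (q^T *m q))^T = c%:M - c ^+ 2 *: (q^T *m q).
  by rewrite raddfB /= linearZ /= tr_scalar_mx trmx_mul trmxK.
rewrite [(_ *: q^T)^T]linearZ /= trmxK mulmxBl !mulmxBr.
rewrite -scalar_mxM mul_scalar_mx mul_mx_scalar -!scalemxAl -!scalemxAr.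
have -> : (q^T *m q) *m (q^T *m q) = dot q q *: (q^T *m q).
  by rewrite mulmxA -(mulmxA _ q) mulmx_dot mul_mx_scalar -scalemxAl.
move: (q^T *m q) (dot q q) hc => Q d hc.
rewrite !scalerA -[c * c]expr2 opprB addrC -!addrA -[RHS]addr0; congr (_ + _).
rewrite -!(scaleNr _ Q) -!scalerDl.
apply/eqP; rewrite scaler_eq0; apply/orP; left; apply/eqP.
(* The coefficient of [q^T q], written as a combination of the two relations [c (1 + d) = 2] and
   [e^2 = 1]. *)
transitivity (c ^+ 3 * (c * (1 + d) - 2) + (e ^+ 2 - 1) * c ^+ 4); first by ring.
by rewrite hc e2 !subrr mulr0 mul0r addr0.
Qed.

Lemma stereo_norm q : dot (stereo q) (stereo q) = 1.
Proof.
rewrite /dot [stereo q *m _]mul_row_rowT linearZ /= tr_scalar_mx -scalar_mxM.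
rewrite -scalemxAl -scalemxAr mulmx_dot scalerA !mxE eqxx !mulr1n.
have -> : e * (conf q - 1) * (e * (conf q - 1)) = (conf q - 1) ^+ 2.
  by rewrite -expr2 exprMn e2 mul1r.
have := conf_dot q; move: (conf q) (dot q q) => c d hcd.
transitivity (1 + c * (c * (1 + d) - 2)); first by ring.
by rewrite hcd subrr mulr0 addr0.
Qed.

(** Tangent vectors of the sphere are orthogonal to the position vector. This is what makes the
    metric block diagonal in polar coordinates. *)
Lemma stereoJ_orth q : stereoJ q *m (stereo q)^T = 0.
Proof.
rewrite /stereoJ /stereo; move: (conf q) (conf_dot q) => c hc.
rewrite [LHS]mul_row_rowT [(c *: q)^T]linearZ /= tr_scalar_mx mul_mx_scalar.
rewrite mulmxBl mul_scalar_mx -scalemxAr -scalemxAl -mulmxA mulmx_dot.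
rewrite mul_mx_scalar !scalerA -scalerBl -scalerDl.
apply/eqP; rewrite scaler_eq0; apply/orP; left; apply/eqP.
move: (dot q q) hc => d hc.
transitivity (- c ^+ 2 * (c * (1 + d) - 2) - (e ^+ 2 - 1) * c ^+ 2 * (c - 1)).
  by ring.
by rewrite hc e2 !subrr mulr0 !mul0r subr0.
Qed.

Lemma stereo_inj : injective stereo.
Proof.
move=> q q' /(@eq_row_mx _ 1 1 m _ _ _ _) [/(congr1 (fun M : 'M[R]_1 => M ord0 ord0))].
rewrite !mxE eqxx !mulr1n => h.
have e0 : e != 0 by apply/eqP => e0; move: e2; rewrite e0 expr0n /= => /esym/eqP; rewrite oner_eq0.
move/(mulfI e0) : h => /addIr ->; apply: scalerI.
by rewrite gt_eqF// conf_gt0.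
Qed.

Lemma stereo_first q : stereo q ord0 ord0 = e * (conf q - 1).
Proof.
rewrite /stereo (_ : ord0 = lshift m (ord0 : 'I_1)); last exact: val_inj.
by rewrite [LHS]row_mxEl mxE eqxx.
Qed.

Lemma stereo_surj (s : 'rV[R]_m.+1) : dot s s = 1 -> 0 <= e * s ord0 ord0 ->
  exists q, s = stereo q.
Proof.
move=> s1 s0.
have [s' [a sE]] : exists s' : 'rV[R]_m, exists a : R,
    s = row_mx (a%:M : 'M[R]_1) s' /\ a = s ord0 ord0.
  by exists (rsubmx (s : 'rV[R]_(1 + m))), (s ord0 ord0); rewrite -row_mx_uncons.
move: sE => [sE aE]; rewrite -aE in s0.
have d1 : a ^+ 2 + dot s' s' = 1.
  rewrite -s1 sE /dot (mul_row_rowT (a%:M : 'M[R]_1) s' a%:M s') tr_scalar_mx -scalar_mxM.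
  by rewrite !mxE eqxx mulr1n -expr2; congr (_ + _); rewrite mxE.
have h1 : 0 < 1 + e * a by rewrite ltr_wpDr.
(* Projection from the pole [- e]; on the half-sphere [0 <= e * a] the point stays away from that
   pole. *)
exists ((1 + e * a)^-1 *: s').
have hc : conf ((1 + e * a)^-1 *: s') = 1 + e * a.
  rewrite /conf dotZ.
  have -> : dot s' s' = (1 - e * a) * (1 + e * a).
    rewrite -subr_sqr expr1n exprMn e2 mul1r; apply/eqP.
    by rewrite eq_sym subr_eq addrC d1.
  by field; rewrite gt_eqF//= (_ : _ + _ = 2) ?pnatr_eq0//; ring.
rewrite /stereo hc scalerA divff ?gt_eqF// scale1r sE.
by rewrite (_ : e * _ = a)// addrAC subrr add0r mulrA -expr2 e2 mul1r.
Qed.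

End stereographic.

(** * Polar parametrizations *)

(** An invertible Gram matrix yields an explicit right inverse of [J]. Computing a volume density
    thus also proves that the chart is an immersion. *)
Lemma row_free_gram (R : realType) k N (g : 'M[R]_N) (J : 'M[R]_(k, N)) :
  \det (J *m g *m J^T) != 0 -> row_free J.
Proof.
move=> h; apply/row_freeP; exists (g *m J^T *m invmx (J *m g *m J^T)).
by rewrite !mulmxA mulmxV// unitmxE unitfE.
Qed.

Lemma col_mx_gram (R : realType) k l N (g : 'M[R]_N) (A : 'M[R]_(k, N))
    (B : 'M[R]_(l, N)) :
  col_mx A B *m g *m (col_mx A B)^T =
  block_mx (A *m g *m A^T) (A *m g *m B^T) (B *m g *m A^T) (B *m g *m B^T).
Proof. by rewrite mul_col_mx tr_col_mx mul_col_row. Qed.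

Section polar_chart.
Context {R : realType} {m N : nat}.
Variables (p : 'rV[R]_N) (E : 'M[R]_(m.+1, N)) (X Y X' Y' : R -> R) (e : R).
Hypothesis e2 : e ^+ 2 = 1.

Definition polar_chart (v : 'rV[R]_m.+1) : 'rV[R]_N :=
  X (v ord0 ord0) *: p +
  Y (v ord0 ord0) *: (stereo e (rsubmx (v : 'rV[R]_(1 + m))) *m E).

Definition polarJ (v : 'rV[R]_m.+1) : 'M[R]_(m.+1, N) :=
  let t := v ord0 ord0 in let q := rsubmx (v : 'rV[R]_(1 + m)) in
  col_mx (X' t *: p + Y' t *: (stereo e q *m E)) (Y t *: (stereoJ e q *m E)).

Lemma is_diff_polar_chart (v : 'rV[R]_m.+1) :
  is_derive (v ord0 ord0) 1 X (X' (v ord0 ord0)) ->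
  is_derive (v ord0 ord0) 1 Y (Y' (v ord0 ord0)) ->
  is_diff v polar_chart (mulmx^~ (polarJ v)).
Proof.
move=> dX dY.
have dc := is_diff_coord v ord0 ord0.
have dXc := is_diff_comp dc (is_diff_derive dX).
have dYc := is_diff_comp dc (is_diff_derive dY).
have dr : is_diff v (fun v : 'rV[R]_m.+1 => rsubmx (v : 'rV[R]_(1 + m)))
    (fun v : 'rV[R]_m.+1 => rsubmx (v : 'rV[R]_(1 + m))).
  apply: DiffDef; first exact: (@differentiable_rsubmx _ 1 1 m v).
  by rewrite (@diff_lin _ _ _ (@rsubmx R 1 1 m))//; exact: continuous_rsubmx.
have ds := is_diff_comp dr (is_diff_stereo e _).
have dsE := is_diff_mulmxr E ds.
have H := is_diffD (is_diff_scale dXc (is_diff_cst p v)) (is_diff_scale dYc dsE).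
apply: (is_diff_eq H); apply/funext => w.
transitivity (w ord0 ord0 *: (X' (v ord0 ord0) *: p + Y' (v ord0 ord0) *:
  (stereo e (rsubmx (v : 'rV[R]_(1 + m))) *m E)) +
  (rsubmx (w : 'rV[R]_(1 + m))) *m
    (Y (v ord0 ord0) *: (stereoJ e (rsubmx (v : 'rV[R]_(1 + m))) *m E))).
  rewrite scalerDr !scalerA -scalemxAr mulmxA /=.
  rewrite [LHS]/GRing.add /=  scaler0 add0r -addrA; congr (_ + _).
  by rewrite addrC.
transitivity ((row_mx (w ord0 ord0)%:M (rsubmx (w : 'rV[R]_(1 + m))) :
    'rV[R]_(1 + m)) *m (polarJ v : 'M[R]_(1 + m, N))).
  by rewrite mul_row_col mul_scalar_mx.
by rewrite -row_mx_uncons.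
Qed.

(** The metric is [rho^2 dt^2 + Y^2] times the round metric. The mixed blocks vanish because the
    stereographic tangent vectors are orthogonal to the radial direction. *)
Lemma polar_chart_gram (g : 'M[R]_N) rho (v : 'rV[R]_m.+1) :
  let t := v ord0 ord0 in let q := rsubmx (v : 'rV[R]_(1 + m)) in
  E *m g *m E^T = 1%:M -> X' t *: (p *m g *m E^T) = 0 ->
  X' t *: (E *m g *m p^T) = 0 ->
  X' t ^+ 2 * Defs.form g p p + Y' t ^+ 2 = rho ^+ 2 ->
  \det (polarJ v *m g *m (polarJ v)^T) = (rho * (Y t * conf q) ^+ m) ^+ 2.
Proof.
move=> t q EE pE Ep hr.
rewrite /polarJ -/t -/q.
set a := X' t *: p + _; set B := _ *: (stereoJ e q *m E).
rewrite [X in \det X](col_mx_gram g a B).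
have aE : a *m g *m E^T = Y' t *: stereo e q.
  rewrite /a !mulmxDl -!scalemxAl pE add0r; congr (_ *: _).
  by rewrite -!mulmxA (mulmxA E) EE mulmx1.
have Ea : E *m g *m a^T = Y' t *: (stereo e q)^T.
  rewrite /a linearD /= !linearZ /= mulmxDr -!scalemxAr Ep add0r; congr (_ *: _).
  by rewrite trmx_mul mulmxA EE mul1mx.
have -> : a *m g *m B^T = 0.
  rewrite /B linearZ /= trmx_mul -scalemxAr mulmxA aE -scalemxAl.
  have := stereoJ_orth e2 q; move/(congr1 trmx); rewrite trmx_mul trmxK trmx0 => ->.
  by rewrite !scaler0.
have -> : B *m g *m a^T = 0.
  rewrite /B -!scalemxAl -mulmxA -mulmxA (mulmxA E) Ea -scalemxAr.
  by rewrite stereoJ_orth// !scaler0.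
have -> : B *m g *m B^T = ((Y t * conf q) ^+ 2)%:M.
  rewrite /B linearZ /= trmx_mul -!scalemxAl -scalemxAr scalerA.
  have -> : stereoJ e q *m E *m g *m (E^T *m (stereoJ e q)^T) =
      stereoJ e q *m (E *m g *m E^T) *m (stereoJ e q)^T by rewrite !mulmxA.
  by rewrite EE mulmx1 stereoJ_gram// scale_scalar_mx -expr2 -exprMn.
have -> : a *m g *m a^T = (rho ^+ 2)%:M.
  have -> : a^T = X' t *: p^T + Y' t *: (E^T *m (stereo e q)^T).
    by rewrite /a linearD /= !linearZ /= trmx_mul.
  rewrite mulmxDr -!scalemxAr [_ *m (E^T *m _)]mulmxA aE -scalemxAl mulmx_dot.
  rewrite stereo_norm//.
  rewrite /a !mulmxDl -!scalemxAl scalerDr.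
  have -> : X' t *: (Y' t *: (stereo e q *m E *m g *m p^T)) = 0.
    by rewrite scalerA mulrC -scalerA -!mulmxA scalemxAr (mulmxA E) Ep mulmx0 scaler0.
  rewrite addr0 [p *m g *m p^T]mx11_scalar -/(Defs.form g p p) !scale_scalar_mx.
  by rewrite -raddfD /= -hr; congr (_%:M); ring.
transitivity (\det ((rho ^+ 2)%:M : 'M[R]_1) *
    \det (((Y t * conf q) ^+ 2)%:M : 'M[R]_m)); first exact: (@det_ublock _ 1).
by rewrite !det_scalar expr1 -exprM mulnC exprM -exprMn.
Qed.

End polar_chart.

Lemma eq_continuous_at (T U : topologicalType) (f g : T -> U) x :
  f = g -> {for x, continuous f} -> {for x, continuous g}.
Proof. by move=> ->. Qed.

Lemma stereoJ_continuous (R : realType) m (e : R) (q : 'rV[R]_m) i j :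
  {for q, continuous (fun q => stereoJ e q i j)}.
Proof.
have cc : {for q, continuous (@conf R m)}.
  by apply: differentiable_continuous; have [] := is_diff_conf q.
have cq k : {for q, continuous (fun q : 'rV[R]_m => q ord0 k)}.
  exact: coord_continuous.
have c2 := continuousM cc cc.
case: (@splitP 1 m j) => l jl.
  have {jl} -> : j = lshift m l by apply: val_inj.
  have := continuousM (continuousM (@cst_continuous _ _ (- e) q) c2) (cq i).
  apply: eq_continuous_at; apply/funext => w /=.
  by rewrite [RHS]row_mxEl [RHS]mxE [_^T _ _]mxE (ord1 l) expr2 mulNr -mulrA -mulNr mulrA.
have {jl} -> : j = rshift 1 l by apply: val_inj.
have := continuousB (continuousM cc (@cst_continuous _ _ ((i == l)%:R : R) q))
  (continuousM c2 (continuousM (cq i) (cq l))).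
apply: eq_continuous_at; apply/funext => r /=.
transitivity (conf r * (i == l)%:R - conf r * conf r * (r ord0 i * r ord0 l)) => //.
by rewrite [RHS]row_mxEr !mxE big_ord1 !mxE mulr_natr expr2.
Qed.

Section sphere_parametrization.
Context {R : realType} {m : nat}.
Variable e : R.
Hypothesis e2 : e ^+ 2 = 1.

Let J (q : 'rV[R]_m) := jacobianE (is_diff_stereo e q).

Let gram (q : 'rV[R]_m) :
  \det (stereoJ e q *m 1%:M *m (stereoJ e q)^T) = (conf q ^+ m) ^+ 2.
Proof. by rewrite mulmx1 stereoJ_gram// det_scalar -exprM mulnC exprM. Qed.

Lemma stereo_volume_density (q : 'rV[R]_m) :
  volume_density 1%:M (stereo e) q = conf q ^+ m.
Proof.
rewrite /volume_density (J q).2 gram sqrtr_sqr ger0_norm//.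
by rewrite exprn_ge0// ltW// conf_gt0.
Qed.

Lemma stereo_parametrization :
  parametrization (unit_sphere m.+1) setT (stereo e : 'rV[R]_m -> _).
Proof.
split; first exact: openT.
- by move=> q q' _ _; exact: stereo_inj.
- move=> _ [q _ <-]; rewrite /unit_sphere /= -(stereo_norm e2 q) dotE.
  by apply: eq_bigr => i _; rewrite expr2.
- move=> q _; split; first exact: (J q).1.
  + rewrite (_ : jacobian _ = stereoJ e); last first.
      by apply/funext => w; rewrite (J w).2.
    by apply: mx_continuousP => i j; exact: stereoJ_continuous.
  + rewrite (J q).2; apply: (@row_free_gram _ _ _ 1%:M).
    by rewrite gram gt_eqF// !exprn_gt0// conf_gt0.
Qed.

End sphere_parametrization.

(* [X], [Y] describe the point at polar coordinate [t] in the plane of [p] and a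
   unit direction of the row space of [E]; [rho] is the speed of [t |-> X p + Y s]. *)
Record polar_frame (R : realType) (m N : nat) (g : 'M[R]_N) (M : set 'rV[R]_N)
    (p : 'rV[R]_N) (E : 'M[R]_(m.+1, N)) (X Y X' Y' rho : R -> R) (I : set R)
    : Prop := PolarFrame {
  polar_openI : open I ;
  polar_derX : forall t, I t -> is_derive t 1 X (X' t) ;
  polar_derY : forall t, I t -> is_derive t 1 Y (Y' t) ;
  polar_ctsX' : forall t, I t -> {for t, continuous X'} ;
  polar_ctsY' : forall t, I t -> {for t, continuous Y'} ;
  polar_Y_gt0 : forall t, I t -> 0 < Y t ;
  polar_rho_gt0 : forall t, I t -> 0 < rho t ;
  polar_speed : forall t, I t ->
    X' t ^+ 2 * Defs.form g p p + Y' t ^+ 2 = rho t ^+ 2 ;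
  polar_EE : E *m g *m E^T = 1%:M ;
  polar_pE : forall t, I t -> X' t *: (p *m g *m E^T) = 0 ;
  polar_Ep : forall t, I t -> X' t *: (E *m g *m p^T) = 0 ;
  polar_inj : forall t t', I t -> I t' -> X t = X t' -> Y t = Y t' -> t = t' ;
  polar_free : forall a s, a *: p + s *m E = 0 -> a = 0 /\ s = 0 ;
  polar_in : forall t s, I t -> dot s s = 1 -> M (X t *: p + Y t *: (s *m E)) }.

Section polar_parametrization.
Context {R : realType} {m N : nat}.
Variables (g : 'M[R]_N) (M : set 'rV[R]_N).
Variables (p : 'rV[R]_N) (E : 'M[R]_(m.+1, N)) (X Y X' Y' rho : R -> R).
Variable I : set R.
Hypothesis fr : polar_frame g M p E X Y X' Y' rho I.
Variable e : R.
Hypothesis e2 : e ^+ 2 = 1.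

Local Notation U := [set v : 'rV[R]_m.+1 | I (v ord0 ord0)].
Local Notation phi := (polar_chart p E X Y e).

Let J v (Iv : U v) := jacobianE (is_diff_polar_chart p E e (polar_derX fr Iv) (polar_derY fr Iv)).

Let gram v (Iv : U v) :=
  polar_chart_gram Y e2 (polar_EE fr) (polar_pE fr Iv) (polar_Ep fr Iv) (polar_speed fr Iv).

Lemma polar_openU : open U.
Proof.
have /continuousP := @coord_continuous R 1 m.+1 ord0 ord0.
by apply; exact: polar_openI fr.
Qed.

Let rho_dens_gt0 v : U v ->
  0 < rho (v ord0 ord0) *
    (Y (v ord0 ord0) * conf (rsubmx (v : 'rV[R]_(1 + m)))) ^+ m.
Proof.
by move=> Uv; rewrite mulr_gt0 ?(polar_rho_gt0 fr)// exprn_gt0// mulr_gt0 ?(polar_Y_gt0 fr) ?conf_gt0.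
Qed.

Lemma polar_volume_density v : U v -> volume_density g phi v =
  rho (v ord0 ord0) *
    (Y (v ord0 ord0) * conf (rsubmx (v : 'rV[R]_(1 + m)))) ^+ m.
Proof.
move=> Uv; rewrite /volume_density (J Uv).2 (gram Uv) /= sqrtr_sqr.
by rewrite ger0_norm// ltW// rho_dens_gt0.
Qed.

Let ctsJ v : U v -> {for v, continuous (polarJ p E Y X' Y' e)}.
Proof.
move=> Uv.
have c0 : {for v, continuous (fun v : 'rV[R]_m.+1 => v ord0 ord0)}.
  exact: coord_continuous.
have cX' := continuous_comp c0 (polar_ctsX' fr Uv).
have cY' := continuous_comp c0 (polar_ctsY' fr Uv).
have cY : {for v, continuous (Y \o (fun v : 'rV[R]_m.+1 => v ord0 ord0))}.
  apply: continuous_comp c0 _; apply: differentiable_continuous.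
  by have [/derivable1_diffP] := polar_derY fr Uv.
have cr : {for v, continuous (fun v : 'rV[R]_m.+1 => rsubmx (v : 'rV[R]_(1 + m)))}.
  exact: (@continuous_rsubmx R 1 1 m).
have cs k : {for v, continuous (fun v : 'rV[R]_m.+1 =>
    (stereo e (rsubmx (v : 'rV[R]_(1 + m))) *m E) ord0 k)}.
  have := is_diff_mulmxr E (is_diff_stereo e (rsubmx (v : 'rV[R]_(1 + m)))).
  move=> /(is_diff_rowcoord k)[/differentiable_continuous cs _].
  exact: (continuous_comp cr cs).
have cJ i j := continuous_comp cr (@stereoJ_continuous R m e
  (rsubmx (v : 'rV[R]_(1 + m))) i j).
have cJE i j : continuous_at v (fun v : 'rV[R]_m.+1 =>
    (stereoJ e (rsubmx (v : 'rV[R]_(1 + m))) *m E) i j).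
  have : continuous_at v (fun v : 'rV[R]_m.+1 => \sum_k
      stereoJ e (rsubmx (v : 'rV[R]_(1 + m))) i k * E k j).
    rewrite /continuous_at; apply: cvg_big; [exact: add_continuous|exact: nbhs_filter|].
    by move=> k _; exact: (continuousM (cJ i k) (@cst_continuous _ _ (E k j) v)).
  by apply: eq_continuous_at; apply/funext => w; rewrite mxE.
apply: (@mx_continuousP _ _ _ _ (polarJ p E Y X' Y' e) v) => i j.
case: (@splitP 1 m i) => l jl.
  have {jl} -> : i = lshift m l by apply: val_inj.
  have := continuousD (continuousM cX' (@cst_continuous _ _ (p ord0 j) v))
    (continuousM cY' (cs j)).
  apply: eq_continuous_at; apply/funext => w /=.
  by rewrite [RHS]col_mxEu (ord1 l) [RHS]mxE; congr (_ + _); rewrite [RHS]mxE.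
have {jl} -> : i = rshift 1 l by apply: val_inj.
have := continuousM cY (cJE l j); apply: eq_continuous_at; apply/funext => w /=.
by rewrite [RHS]col_mxEd [RHS]mxE.
Qed.

Lemma polar_parametrization : parametrization M U phi.
Proof.
split; first exact: polar_openU.
- move=> v v' /set_mem Uv /set_mem Uv'; rewrite /polar_chart => h.
  move: h; set t := v ord0 ord0; set t' := v' ord0 ord0.
  set s := stereo e _; set s' := stereo e _ => h.
  have [hX hs] : X t - X t' = 0 /\ Y t *: s - Y t' *: s' = 0.
    apply: (polar_free fr); rewrite scalerBl mulmxBl -!scalemxAl.
    by rewrite addrACA -opprD h subrr.
  move/eqP : hX; rewrite subr_eq0 => /eqP hX.
  move/eqP : hs; rewrite subr_eq0 => /eqP hs.
  (* [s] and [s'] are unit vectors, so the norms of the two sides of [hs] compare [Y t] with [Y t'],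
     which are positive. *)
  have hY : Y t = Y t'.
    have := congr1 (fun s => dot s s) hs.
    rewrite !dotZ !stereo_norm// !mulr1 => /eqP.
    rewrite eqrXn2 ?ltW ?(polar_Y_gt0 fr)//; exact/eqP.
  have tt' := polar_inj fr Uv Uv' hX hY.
  have vE : rsubmx (v : 'rV[R]_(1 + m)) = rsubmx (v' : 'rV[R]_(1 + m)); last first.
    by rewrite (row_mx_uncons v) (row_mx_uncons v') vE; move: tt'; rewrite /t /t' => ->.
  apply: (stereo_inj e2); move: hs; rewrite hY; apply: scalerI.
  by rewrite gt_eqF// (polar_Y_gt0 fr).
- by move=> _ [v Uv <-]; apply: (polar_in fr) => //; rewrite stereo_norm.
- move=> v Uv; split.
  + exact: (J Uv).1.
  (* The Jacobian is identified with [polarJ] on [U] only; since [U] is open, this suffices for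
     continuity at [v]. *)
  + have nJ : {near v, polarJ p E Y X' Y' e =1 jacobian phi}.
      have : nbhs v U by apply: open_nbhs_nbhs; split=> //; exact: polar_openU.
      by apply: filterS => w Uw; rewrite (J Uw).2.
    have h : polarJ p E Y X' Y' e w @[w --> v] --> jacobian phi v.
      by rewrite (J Uv).2; exact: ctsJ.
    exact: (cvg_trans (near_eq_cvg nJ) h).
  + rewrite (J Uv).2; apply: (@row_free_gram _ _ _ g).
    by rewrite (gram Uv) gt_eqF// exprn_gt0// rho_dens_gt0.
Qed.

End polar_parametrization.

(** * Lebesgue measure on row vectors *)

Section lebesgue_rV_product.
Context {R : realType} {m : nat}.
Local Open Scope ereal_scope.

(** Tonelli in the form required by the charts: a product density over a product of a set of radii
    and a set of stereographic coordinates. *)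
Lemma ge0_integral_lebesgue_rVS (A : set R) (Q : set 'rV[R]_m) (a : R -> R)
    (b : 'rV[R]_m -> R) :
  measurable A -> measurable Q ->
  measurable_fun A a -> measurable_fun Q b ->
  (forall t, A t -> 0 <= a t)%R -> (forall q, Q q -> 0 <= b q)%R ->
  \int[lebesgue_rV m.+1]_(v in [set v : 'rV[R]_m.+1 | A (v ord0 ord0) /\
      Q (rsubmx (v : 'rV[R]_(1 + m)))])
    (a (v ord0 ord0) * b (rsubmx (v : 'rV[R]_(1 + m))))%:E =
  (\int[lebesgue_measure]_(t in A) (a t)%:E) *
  (\int[lebesgue_rV m]_(q in Q) (b q)%:E).
Proof.
move=> mA mQ ma mb a0 b0.
set B := [set v | _].
have mB : measurable (B : set 'rV[R]_m.+1).
  rewrite (_ : B = @rV_uncons R m @^-1` (A `*` Q))//.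
  rewrite -[X in measurable X]setTI.
  by apply: measurable_rV_uncons => //; exact: measurableX.
(* Extension by zero makes the integrand a product on the whole space, so the domain disappears
   before the product measure is used. *)
pose f (t : (measurableTypeR R * 'rV[R]_m)%type) := ((a \_ A) t.1 * (b \_ Q) t.2)%R.
pose F := EFin \o f.
have mF : measurable_fun setT F.
  have mra : measurable_fun setT (a \_ A) by exact/(measurable_restrictT _ mA).
  have mrb : measurable_fun setT (b \_ Q) by exact/(measurable_restrictT _ mQ).
  apply/measurable_EFinP; exact: (measurable_funM
    (measurableT_comp mra measurable_fst) (measurableT_comp mrb measurable_snd)).
have F0 t : 0 <= F t.
  by rewrite lee_fin mulr_ge0//= patchE; case: ifPn => // /set_mem; [exact: a0|exact: b0].
transitivity (\int[pushforward (@lebesgue_measure R \x lebesgue_rV m) (@rV_cons R m)]_v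
   (F \o @rV_uncons R m) v).
  rewrite integral_mkcond; apply: eq_integral => v _.
  rewrite /F /f /= patchE; case: ifPn => [/set_mem[Av Qv]|/negP nB].
    by rewrite !patchE !mem_set.
  rewrite !patchE; case: ifPn => [/set_mem Av|]; last by rewrite mul0r.
  case: ifPn => [/set_mem Qv|]; last by rewrite mulr0.
  by exfalso; apply: nB; rewrite inE.
rewrite ge0_integral_pushforward//; last 3 first.
- exact: (@measurable_rV_cons R m).
- exact: (measurableT_comp mF (@measurable_rV_uncons R m)).
- by move=> v _; exact: F0.
under eq_integral do rewrite /= rV_consK.
rewrite preimage_setT fubini_tonelli1//.
under eq_integral.
  move=> t _; rewrite /fubini_F /F /f /=.
  under eq_integral do rewrite EFinM.
  rewrite ge0_integralZl//; last 3 first.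
  - by apply/measurable_EFinP; exact/(measurable_restrictT _ mQ).
  - by move=> q _; rewrite lee_fin patchE; case: ifPn => // /set_mem; exact: b0.
  - by rewrite lee_fin patchE; case: ifPn => // /set_mem; exact: a0.
  over.
rewrite /= ge0_integralZr//; last 3 first.
- by apply/measurable_EFinP; exact/(measurable_restrictT _ mA).
- by move=> q _; rewrite lee_fin patchE; case: ifPn => // /set_mem; exact: a0.
- by apply: integral_ge0 => q _; rewrite lee_fin patchE; case: ifPn => // /set_mem; exact: b0.
by congr (_ * _); rewrite [RHS]integral_mkcond; apply: eq_integral => x _;
  rewrite !patchE; case: ifPn.
Qed.

Lemma lebesgue_rVS_prod (A : set R) (Q : set 'rV[R]_m) :
  measurable A -> measurable Q ->
  lebesgue_rV m.+1 [set v : 'rV[R]_m.+1 | A (v ord0 ord0) /\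
      Q (rsubmx (v : 'rV[R]_(1 + m)))] =
  lebesgue_measure A * lebesgue_rV m Q.
Proof.
move=> mA mQ.
transitivity ((@lebesgue_measure R \x lebesgue_rV m) (A `*` Q)); last first.
  exact: product_measure1E.
rewrite /= /cons_measure /pushforward; congr (_ _).
apply/funext => -[t q]; have [tE qE] := rV_consK (t, q).
by apply/propext; split => /=; rewrite tE qE.
Qed.

End lebesgue_rV_product.

Lemma lebesgue_rVS_slice (R : realType) m (a : R) :
  lebesgue_rV m.+1 [set v : 'rV[R]_m.+1 | v ord0 ord0 = a] = 0%E.
Proof.
have := @lebesgue_rVS_prod R m [set a] setT (measurable_set1 a) measurableT.
(* In the extended reals [0 * +oo = 0], so the possibly infinite second factor is harmless. *)
rewrite lebesgue_measure_set1 mul0e => <-; congr (_ _).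
by apply/seteqP; split=> v /=; [|case].
Qed.

(** Cubes enclose the caps and are enclosed in them, which gives finiteness and positivity of the
    area. For [m = 0] the cube is the single point, of mass [1]. *)
Lemma lebesgue_rV_box (R : realType) m (a b : R) : a <= b ->
  measurable [set q : 'rV[R]_m | forall i, a <= q ord0 i <= b] /\
  lebesgue_rV m [set q : 'rV[R]_m | forall i, a <= q ord0 i <= b] =
  ((b - a) ^+ m)%:E.
Proof.
move=> ab; elim: m => [|m [mB IH]].
  have -> : [set q : 'rV[R]_0 | forall i, a <= q ord0 i <= b] = setT.
    by apply/seteqP; split=> // q _ [].
  by split; [exact: measurableT|rewrite expr0 /= diracT].
have E : [set q : 'rV[R]_m.+1 | forall i, a <= q ord0 i <= b] =
    [set v : 'rV[R]_m.+1 | `[a, b]%classic (v ord0 ord0) /\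
     [set q : 'rV[R]_m | forall i, a <= q ord0 i <= b]
       (rsubmx (v : 'rV[R]_(1 + m)))].
  apply/seteqP; split=> v /=.
    move=> h; split; first by rewrite in_itv /=; exact: h.
    by move=> i; rewrite mxE; exact: h.
  rewrite in_itv /= => -[h0 h] i; case: (@splitP 1 m i) => j ij.
    by have -> : i = ord0 by apply: val_inj => /=; rewrite [LHS]ij (ord1 j).
  have -> : i = rshift 1 j by exact: val_inj.
  by have := h j; rewrite mxE.
split; last first.
  rewrite E lebesgue_rVS_prod//.
  rewrite lebesgue_measure_itv/= lte_fin IH.
  case: ltP => [_|ba]; first by rewrite -EFinB -EFinM exprS.
  have -> : b = a by apply/eqP; rewrite eq_le ab ba.
  by rewrite subrr mul0e expr0n.
rewrite E (_ : [set v | _] = @rV_uncons R m @^-1` (`[a, b]%classic `*`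
   [set q : 'rV[R]_m | forall i, a <= q ord0 i <= b]))//.
rewrite -[X in measurable X]setTI.
by apply: measurable_rV_uncons => //; exact: measurableX.
Qed.

Lemma measurable_dot (R : realType) d (T : measurableType d) n
    (f g : T -> 'rV[R]_n) :
  measurable_fun setT f -> measurable_fun setT g ->
  measurable_fun setT (fun x => dot (f x) (g x)).
Proof.
move=> mf mg; under eq_fun do rewrite dotE.
apply: measurable_sum => i.
by apply: measurable_funM; apply: measurableT_comp (measurable_coord i) _.
Qed.

Lemma measurable_set1_rV (R : realType) n (q : 'rV[R]_n) : measurable [set q].
Proof.
have -> : [set q] = (fun x => dot (x - q) (x - q)) @^-1` [set 0].
  apply/seteqP; split => x /=; first by move=> ->; rewrite subrr dotE big1// => i _; rewrite mxE mul0r.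
  rewrite dotE => /psumr_eq0P h; apply/rowP => i; apply/eqP; rewrite -subr_eq0.
  have := h _ i isT; rewrite !mxE => h'.
  by rewrite -sqrf_eq0 expr2 h'// => j _; rewrite -expr2 sqr_ge0.
rewrite -[X in measurable X]setTI.
have mB : measurable_fun setT (fun x : 'rV[R]_n => x - q).
  apply: measurable_fun_rVP => i; under eq_fun do rewrite mxE.
  by apply: measurable_funD => //; exact: measurable_coord.
exact: (measurable_dot mB mB).
Qed.

Lemma measurable_conf (R : realType) m : measurable_fun setT (@conf R m).
Proof.
have mdot := measurable_dot (@measurable_id _ 'rV[R]_m setT) (@measurable_id _ _ setT).
rewrite (_ : conf = fun q : 'rV[R]_m => 2 * (1 + dot q q) `^ (- 1)); last first.
  apply/funext => q; rewrite /conf powR_inv1//.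
  by rewrite addr_ge0// dot_ge0.
apply: measurable_funM => //.
exact: (measurableT_comp (measurable_powR (- 1)) (measurable_funD _ mdot)).
Qed.

(** * Area of the sphere and measure in polar coordinates *)

Section caps.
Context {R : realType} {m : nat}.

(* Half of the sphere, split so that it lies in the range of the chart
   [stereo ((-1) ^+ b)]; also correct for the two points of [m = 0]. *)
Definition hemi (b : bool) : set 'rV[R]_m.+1 :=
  [set s | (s ord0 ord0 < 0) = b].

Definition cap (b : bool) : set 'rV[R]_m :=
  [set q | hemi b (stereo ((-1) ^+ b) q)].

(** [1 <= conf q] means [|q| <= 1]: the caps are the closed and the open unit ball. *)
Lemma capE b : cap b = [set q | if b then 1 < conf q else 1 <= conf q].
Proof.
apply/seteqP; split => q; rewrite /cap /hemi /= stereo_first.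
all: case: b; rewrite ?expr1 ?expr0 ?mul1r ?mulN1r ?oppr_lt0 ?subr_gt0 ?subr_lt0 //.
- by move/negbT; rewrite -leNgt.
- by move=> h; apply/negbTE; rewrite -leNgt.
Qed.

Lemma measurable_hemi b : measurable (hemi b).
Proof.
have mh : measurable_fun setT (fun s : 'rV[R]_m.+1 => s ord0 ord0 < 0).
  by apply: measurable_fun_ltr => //; exact: measurable_coord.
by rewrite -[X in measurable X]setTI; exact: (mh measurableT [set b]).
Qed.

Lemma measurable_cap b : measurable (cap b).
Proof.
have mT (f : 'rV[R]_m -> bool) : measurable_fun setT f -> measurable [set q | f q].
  by move=> mf; rewrite -[X in measurable X]setTI; exact: (mf measurableT [set true]).
have mc := @measurable_conf R m.
rewrite capE; case: b; apply: mT; [exact: measurable_fun_ltr|exact: measurable_fun_ler].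
Qed.

Definition cap_area (b : bool) : \bar R :=
  (\int[lebesgue_rV m]_(q in cap b) (conf q ^+ m)%:E)%E.

Let mconf D : measurable_fun D (fun q : 'rV[R]_m => (conf q ^+ m)%:E).
Proof.
apply/measurable_EFinP; apply: measurable_funTS.
exact: (measurable_funX _ (@measurable_conf R m)).
Qed.

Lemma cap_area_ge0 b : (0 <= cap_area b)%E.
Proof.
by apply: integral_ge0 => q _; rewrite lee_fin exprn_ge0// ltW// conf_gt0.
Qed.

(** The cap lies in the cube [[-1, 1]^m] and [conf <= 2]. *)
Lemma cap_area_fin b : (cap_area b < +oo)%E.
Proof.
pose B := [set q : 'rV[R]_m | forall i, -1 <= q ord0 i <= 1].
have [mB BE] : measurable B /\ lebesgue_rV m B = ((1 - -1) ^+ m)%:E.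
  by apply: lebesgue_rV_box; lra.
apply: (@le_lt_trans _ _ (\int[lebesgue_rV m]_(q in B) (2 ^+ m)%:E)%E).
  apply: (@le_trans _ _ (\int[lebesgue_rV m]_(q in cap b) (2 ^+ m)%:E)%E).
    apply: ge0_le_integral => //.
    - exact: measurable_cap.
    - by move=> q _; rewrite lee_fin exprn_ge0// ltW// conf_gt0.
    - move=> q _; rewrite lee_fin; apply: lerXn2r; rewrite ?nnegrE//.
        by rewrite ltW// conf_gt0.
      have := conf_dot q; have := dot_ge0 q; have := conf_gt0 q.
      by move: (dot q q) (conf q) => d c; nra.
  apply: ge0_subset_integral => //; first exact: measurable_cap.
  rewrite capE => q /= qb i; rewrite -ler_norml -(@ler_pXn2r _ 2%N)// ?nnegrE//.
  have d1 : dot q q <= 1.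
    have := conf_dot q; have := dot_ge0 q; move: (dot q q) (conf q) qb => d c.
    by case: b => [h|h] d0 cd; nra.
  rewrite expr1n real_normK ?num_real//; apply: le_trans d1.
  rewrite dotE (bigD1 i)//= -expr2 lerDl; apply: sumr_ge0 => j _.
  by rewrite -expr2 sqr_ge0.
by rewrite integral_cst// [X in (_ * X)%E]BE -EFinM ltry.
Qed.

(** The cube [[0, 1/(m+1)]^m] lies in the unit ball, since its points satisfy [|q|^2 <= m/(m+1)];
    there [conf >= 1]. *)
Lemma cap_area_gt0 : (0 < cap_area false)%E.
Proof.
pose B := [set q : 'rV[R]_m | forall i, 0 <= q ord0 i <= m.+1%:R^-1].
have [mB BE] : measurable B /\ lebesgue_rV m B = ((m.+1%:R^-1 - 0) ^+ m)%:E.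
  by apply: lebesgue_rV_box; rewrite invr_ge0.
apply: (@lt_le_trans _ _ (\int[lebesgue_rV m]_(q in B) 1%:E)%E).
  by rewrite integral_cst// [X in (_ * X)%E]BE mul1e lte_fin subr0 exprn_gt0// invr_gt0.
have sub : B `<=` cap false.
  rewrite capE => q /= h.
  have d1 : dot q q <= 1.
    rewrite dotE; apply: (@le_trans _ _ (\sum_(i < m) m.+1%:R^-1)).
      apply: ler_sum => i _; have /andP[h0 h1] := h i.
      rewrite -[leRHS]mulr1 ler_pM//; apply: le_trans h1 _.
      by rewrite invf_le1// ler1n.
    rewrite sumr_const card_ord -[leLHS]mulr_natl ler_pdivrMr ?ltr0n// mul1r.
    by rewrite ler_nat.
  have := conf_dot q; have := dot_ge0 q; move: (dot q q) (conf q) d1 => d c d1 d0 cd.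
  by nra.
apply: (@le_trans _ _ (\int[lebesgue_rV m]_(q in B) (conf q ^+ m)%:E)%E).
  apply: ge0_le_integral => //.
  move=> q /sub; rewrite capE /= => c1.
  by rewrite lee_fin exprn_ege1.
apply: ge0_subset_integral => //; first exact: measurable_cap.
by move=> q _; rewrite lee_fin exprn_ge0// ltW// conf_gt0.
Qed.

(** The two half-spheres partition the sphere and each lies in the range of its chart. The same sum
    of cap areas is the constant in [polar_measure]. *)
Lemma sphere_area (sigma : {measure set 'rV[R]_m.+1 -> \bar R}) :
  is_riemannian_measure 1%:M (unit_sphere m.+1) m sigma ->
  sigma (unit_sphere m.+1) = (cap_area false + cap_area true)%E.
Proof.
move=> [_ hs].
have S1 (s : 'rV[R]_m.+1) : unit_sphere m.+1 s = (dot s s = 1).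
  by rewrite /unit_sphere /= dotE; congr (_ = _); apply: eq_bigr => i _; rewrite expr2.
have mS : measurable (unit_sphere m.+1 : set 'rV[R]_m.+1).
  have -> : unit_sphere m.+1 = (fun s : 'rV[R]_m.+1 => dot s s) @^-1` [set 1].
    by apply/seteqP; split=> s; rewrite S1.
  rewrite -[X in measurable X]setTI.
  exact: (measurable_dot (@measurable_id _ _ setT) (@measurable_id _ _ setT)).
have signb (b : bool) : ((-1) ^+ b) ^+ 2 = 1 :> R by rewrite sqrr_sign.
have piece b : sigma (unit_sphere m.+1 `&` hemi b) = cap_area b.
  have -> : unit_sphere m.+1 `&` hemi b = hemi b `&` stereo ((-1) ^+ b) @` setT.
    apply/seteqP; split=> s [].
      rewrite S1 => s1 sb; split=> //.
      have [q ->] := stereo_surj (signb b) s1 (ltac:(move: sb; rewrite /hemi /=;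
        case: (b) => /=; rewrite ?expr1 ?expr0 ?mul1r ?mulN1r ?oppr_ge0;
          [exact: ltW|by move/negbT; rewrite -leNgt])).
      by exists q.
    by move=> sb [q _ qs]; split=> //; rewrite S1 -qs stereo_norm.
  rewrite (hs _ _ (stereo_parametrization (signb b)) _ (measurable_hemi b)).
  rewrite setTI; apply: eq_integral => q _; rewrite stereo_volume_density//.
rewrite -!piece -measureU//; last first.
- apply/seteqP; split=> // s [[_ h0] [_ h1]].
  by move: h0 h1; rewrite /hemi /= => ->.
- by apply: measurableI => //; exact: measurable_hemi.
- by apply: measurableI => //; exact: measurable_hemi.
congr (sigma _); apply/seteqP; split => s; last by case => -[].
by move=> h; case E : (s ord0 ord0 < 0); [right|left].
Qed.

End caps.

Section polar_measure.
Context {R : realType} {m N : nat}.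
Variables (g : 'M[R]_N) (M : set 'rV[R]_N).
Variables (p : 'rV[R]_N) (E : 'M[R]_(m.+1, N)) (X Y X' Y' rho : R -> R).
Variable I : set R.
Hypothesis fr : polar_frame g M p E X Y X' Y' rho I.
Variable mu : {measure set 'rV[R]_N -> \bar R}.
Hypothesis hmu : is_riemannian_measure g M m.+1 mu.

Local Notation U := [set v : 'rV[R]_m.+1 | I (v ord0 ord0)].
Local Notation pt t s := (X t *: p + Y t *: (s *m E)).
Local Notation tail v := (rsubmx (v : 'rV[R]_(1 + m))).

Let sign2 (b : bool) : ((-1) ^+ b) ^+ 2 = 1 :> R. Proof. by rewrite sqrr_sign. Qed.

Lemma hemi_stereo b (s : 'rV[R]_m.+1) : dot s s = 1 -> hemi b s ->
  exists q, s = stereo ((-1) ^+ b) q.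
Proof.
move=> s1 sb; apply: stereo_surj => //; move: sb; rewrite /hemi /=.
by case: b => /=; rewrite ?expr1 ?expr0 ?mul1r ?mulN1r ?oppr_ge0;
  [exact: ltW|move/negbT; rewrite -leNgt].
Qed.

(** [B] is a union of full spheres of directions with radii in [A]. The function [l] reads the sign
    of the first coordinate of the direction from the ambient point, and so cuts [B] into two
    measurable halves, each inside the range of one chart. *)
Lemma polar_measure (A : set R) (B : set 'rV[R]_N) (l : 'rV[R]_N -> R) :
  measurable A -> A `<=` I -> measurable B -> measurable_fun setT l ->
  measurable_fun A (fun t => rho t * Y t ^+ m) ->
  (forall t s, I t -> dot s s = 1 -> B (pt t s) <-> A t) ->
  (forall t s, I t -> dot s s = 1 -> (l (pt t s) < 0) = (s ord0 ord0 < 0)) ->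
  (forall x, B x -> exists t s, [/\ I t, dot s s = 1 & x = pt t s]) ->
  mu B = ((\int[lebesgue_measure]_(t in A) (rho t * Y t ^+ m)%:E) *
          (@cap_area R m false + @cap_area R m true))%E.
Proof.
move=> mA AI mB ml mw BA lE Bpt.
pose L b := [set x | (l x < 0) = b].
have mL b : measurable (L b).
  have mh : measurable_fun setT (fun x => l x < 0) by exact: measurable_fun_ltr.
  by rewrite -[X in measurable X]setTI; exact: (mh measurableT [set b]).
have w0 t : A t -> 0 <= rho t * Y t ^+ m.
  move=> /AI It; rewrite mulr_ge0 ?exprn_ge0// ltW//.
    exact: polar_rho_gt0 fr _ It.
  exact: polar_Y_gt0 fr _ It.
have piece b : mu (B `&` L b) =
    ((\int[lebesgue_measure]_(t in A) (rho t * Y t ^+ m)%:E) * @cap_area R m b)%E.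
  have -> : B `&` L b = (B `&` L b) `&` polar_chart p E X Y ((-1) ^+ b) @` U.
    apply/seteqP; split => [x [Bx Lx]|x []//]; split=> //.
    have [t [s [It s1 xE]]] := Bpt _ Bx.
    have sb : hemi b s by rewrite /hemi /= -(lE t)// -xE.
    have [q sE] := hemi_stereo s1 sb.
    exists (row_mx t%:M q : 'rV[R]_(1 + m)).
      by rewrite /= [X in I X]row_mx_first.
    by rewrite /polar_chart row_mx_first [rsubmx _]row_mxKr -sE.
  rewrite (hmu.2 _ _ (polar_parametrization fr (sign2 b)) _ (measurableI _ _ mB (mL b))).
  rewrite /cap_area -ge0_integral_lebesgue_rVS//; last 3 first.
  - exact: measurable_cap.
  - apply: measurable_funTS; exact: (measurable_funX _ (@measurable_conf R m)).
  - by move=> q _; rewrite exprn_ge0// ltW// conf_gt0.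
  have -> : U `&` polar_chart p E X Y ((-1) ^+ b) @^-1` (B `&` L b) =
      [set v : 'rV[R]_m.+1 | A (v ord0 ord0) /\ cap b (tail v)].
    apply/seteqP; split => v /=.
      move=> [Iv []]; rewrite /polar_chart BA ?stereo_norm// => Av.
      by rewrite /L /= lE// stereo_norm.
    move=> [Av cv]; split; first exact: AI.
    rewrite /polar_chart; split; first by rewrite BA ?stereo_norm//; exact: AI.
    by rewrite /L /= lE ?stereo_norm//; exact: AI.
  apply: eq_integral => v /set_mem [/AI Iv _].
  rewrite (polar_volume_density fr (sign2 b) Iv) exprMn mulrA//.
rewrite ge0_muleDr ?cap_area_ge0// -!piece -measureU.
- congr (mu _); apply/seteqP; split=> [x Bx|x [[]|[]]//].
  by rewrite /L /=; case E0 : (l x < 0); [right|left].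
- exact: measurableI.
- exact: measurableI.
- by apply/seteqP; split=> // x [[_]] /=; rewrite /L /= => -> [_].
Qed.

End polar_measure.

(** * Transfer of integrals along an image measure *)

Section integral_law.
Context d d' (S : measurableType d) (Y : measurableType d') (R : realType).
Variables (mu : {measure set S -> \bar R}) (lam : {measure set Y -> \bar R}).
Variables (Z : set S) (T : S -> Y) (D : set Y) (w : Y -> R).
Hypotheses (mZ : measurable Z) (mT : measurable_fun setT T) (mD : measurable D).
Hypothesis (mw : measurable_fun D w).
Hypothesis w0 : forall t, D t -> 0 <= w t.
Hypothesis ZD : forall x, Z x -> D (T x).
Local Open Scope ereal_scope.
Hypothesis law : forall A, measurable A -> A `<=` D ->
  mu (Z `&` T @^-1` A) = \int[lam]_(t in A) (w t)%:E.

Import HBNNSimple.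

Let mpre (B : set Y) : measurable B -> measurable (T @^-1` B).
Proof. by move=> mB; rewrite -[X in measurable X]setTI; exact: mT. Qed.

(** By [law], the image under [T] of [mu] restricted to [Z] has density [w] with respect to [lam].
    Monotone approximation by simple functions extends this from sets to functions. *)
Lemma ge0_integral_law (f : Y -> \bar R) :
  measurable_fun D f -> (forall t, D t -> 0 <= f t) ->
  \int[mu]_(x in Z) f (T x) = \int[lam]_(t in D) (f t * (w t)%:E).
Proof.
move=> mf f0.
pose f_ := nnsfun_approx mD mf.
have mfn n k : measurable (f_ n @^-1` [set k]) by exact: measurable_sfunP.
have mEw : measurable_fun D (EFin \o w) by exact/measurable_EFinP.
transitivity (limn (fun n => \int[mu]_(x in Z) (f_ n (T x))%:E)).
  rewrite -monotone_convergence//.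
  - apply: eq_integral => x /[!inE] Zx; apply/esym/cvg_lim => //.
    by apply: cvg_nnsfun_approx => //; exact: ZD.
  - move=> n; apply/measurable_EFinP; apply: measurable_funTS.
    by apply: measurableT_comp => //; exact: measurable_funP.
  - by move=> n x _; rewrite lee_fin.
  - by move=> x _ a b ab; rewrite lee_fin; exact/lefP/nd_nnsfun_approx.
transitivity (limn (fun n => \int[lam]_(t in D) ((f_ n t)%:E * (w t)%:E))); last first.
  rewrite -monotone_convergence//.
  - apply: eq_integral => t /[!inE] Dt; apply/cvg_lim => //.
    by apply: cvgeZr => //; exact: cvg_nnsfun_approx.
  - by move=> n; apply: emeasurable_funM => //; exact/measurable_EFinP/measurable_funP.
  - by move=> n t Dt; rewrite mule_ge0// lee_fin// w0.
  - move=> t Dt a b ab; apply: lee_wpmul2r; first by rewrite lee_fin w0.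
    by rewrite lee_fin; exact/lefP/nd_nnsfun_approx.
congr (limn _); apply/funext => n.
transitivity (\sum_(k \in range (f_ n))
    \int[mu]_(x in Z) (k * \1_(T @^-1` (f_ n @^-1` [set k])) x)%:E).
  rewrite -ge0_integral_fsum//.
  - apply: eq_integral => x _; rewrite fsumEFin// fimfunE; congr EFin.
  - move=> k; apply/measurable_EFinP/measurable_funM => //.
    exact/measurable_indic/mpre.
  - move=> k x _; rewrite (_ : \1__ _ = \1_(f_ n @^-1` [set k]) (T x))//.
    exact: nnfun_muleindic_ge0.
transitivity (\sum_(k \in range (f_ n))
    \int[lam]_(t in D) ((k * \1_(f_ n @^-1` [set k]) t)%:E * (w t)%:E)); last first.
  rewrite -ge0_integral_fsum//.
  - apply: eq_integral => t _; rewrite -ge0_mule_fsuml; last first.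
      by move=> k; exact: nnfun_muleindic_ge0.
    by rewrite fsumEFin// -fimfunE.
  - move=> k; apply: emeasurable_funM => //.
    by apply/measurable_EFinP/measurable_funM.
  - by move=> k t Dt; rewrite mule_ge0 ?nnfun_muleindic_ge0// lee_fin w0.
apply: eq_fsbigr => k /set_mem [t0 _ tk].
have k0 : (0 <= k)%R by rewrite -tk.
(* [law] only speaks of subsets of [D]. Since [T] maps [Z] into [D], intersecting the level set with
   [D] changes nothing. *)
have -> : \int[mu]_(x in Z) (k * \1_(T @^-1` (f_ n @^-1` [set k])) x)%:E =
    k%:E * mu (Z `&` T @^-1` (D `&` f_ n @^-1` [set k])).
  under eq_integral do rewrite EFinM.
  rewrite ge0_integralZl//; last first.
  - by apply/measurable_EFinP/measurable_indic/mpre.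
  rewrite integral_indic//; last exact: mpre.
  congr (_ * mu _); apply/seteqP; split=> x /=; last by move=> [? [? ?]].
  by move=> [h Zx]; split=> //; split=> //; exact: ZD.
rewrite (law (measurableI _ _ mD (mfn n k)) (@subIsetl _ _ _)).
under [RHS]eq_integral do rewrite EFinM -muleA.
rewrite ge0_integralZl//.
- congr (_ * _); rewrite integral_mkcondr; apply: eq_integral => t _.
  by rewrite epatch_indic muleC.
- apply: emeasurable_funM => //; apply/measurable_EFinP/measurable_funTS.
  exact/measurable_indic.
- by move=> t Dt; rewrite mule_ge0// lee_fin// w0.
Qed.

Lemma integrable_law (f : Y -> R) : measurable_fun D f ->
  mu.-integrable Z (fun x => (f (T x))%:E) ->
  lam.-integrable D (fun t => (f t * w t)%:E).
Proof.
move=> mf /integrableP[_ foo]; apply/integrableP; split.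
  by apply/measurable_EFinP; exact: measurable_funM.
have := @ge0_integral_law (fun t => `|(f t)%:E|).
move=> /(_ _ _)/wrap[]; first by apply: measurableT_comp => //; exact/measurable_EFinP.
- by [].
move=> h; move: foo; rewrite h; congr (_ < _).
apply: eq_integral => t /set_mem Dt; rewrite EFinM abseM.
by rewrite [X in _ = _ * X](@gee0_abs _ (w t)%:E)// lee_fin w0.
Qed.

Lemma Rintegral_law (f : Y -> R) : measurable_fun D f ->
  mu.-integrable Z (fun x => (f (T x))%:E) ->
  (\int[mu]_(x in Z) f (T x) = \int[lam]_(t in D) (f t * w t))%R.
Proof.
move=> mf fi; rewrite /Rintegral; congr fine; rewrite [LHS]integralE [RHS]integralE.
have mEf : measurable_fun D (EFin \o f) by exact/measurable_EFinP.
(* A nonnegative weight commutes with positive and negative parts, so the nonnegative case applies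
   to each. *)
have e1 t : D t -> (fun t => (f t * w t)%:E)^\+ t = (EFin \o f)^\+ t * (w t)%:E.
  move=> Dt; rewrite !funeposE /= -!EFin_max -EFinM; congr _%:E.
  by rewrite maxr_pMl ?w0// mul0r.
have e2 t : D t -> (fun t => (f t * w t)%:E)^\- t = (EFin \o f)^\- t * (w t)%:E.
  move=> Dt; rewrite !funenegE /= -!EFin_max -EFinM; congr _%:E.
  by rewrite maxr_pMl ?w0// mul0r mulNr.
congr (_ - _).
- transitivity (\int[mu]_(x in Z) (EFin \o f)^\+ (T x)).
    by apply: eq_integral => x _; rewrite !funeposE.
  rewrite ge0_integral_law//; last exact: measurable_funepos.
  by apply: eq_integral => t /set_mem Dt; rewrite e1.
- transitivity (\int[mu]_(x in Z) (EFin \o f)^\- (T x)).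
    by apply: eq_integral => x _; rewrite !funenegE.
  rewrite ge0_integral_law//; last exact: measurable_funeneg.
  by apply: eq_integral => t /set_mem Dt; rewrite e2.
Qed.

End integral_law.

(** * The functions s_c and their derivatives *)

Section model_functions.
Context {R : realType}.
Implicit Types (c : model) (t : R).

Definition curvature c : R :=
  match c with hyperbolic => -1 | euclidean => 0 | spherical => 1 end.

Definition c_ c t : R :=
  match c with
  | hyperbolic => (expR t + expR (- t)) / 2
  | euclidean => 1
  | spherical => cos t
  end.

Lemma is_derive_s c t : is_derive t 1 (s_ c) (c_ c t).
Proof.
case: c => /=; last exact: is_derive_sin.
  have h : is_derive t 1 (fun t : R => expR (- t)) (- expR (- t)).
    have := @is_derive1_comp R expR -%R t (expR (- t)) (-1).
    by rewrite mulrN1; apply.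
  have := is_deriveM (is_deriveB (is_derive_expR t) h) (is_derive_cst (2^-1 : R) t 1).
  move=> H; apply: (is_derive_eq H).
  by rewrite scaler0 add0r opprK [RHS]mulrC.
exact: is_derive_id.
Qed.

Lemma is_derive_c c t : is_derive t 1 (c_ c) (- (curvature c * s_ c t)).
Proof.
case: c => /=; last by rewrite mul1r; exact: is_derive_cos.
  have h : is_derive t 1 (fun t : R => expR (- t)) (- expR (- t)).
    have := @is_derive1_comp R expR -%R t (expR (- t)) (-1).
    by rewrite mulrN1; apply.
  have := is_deriveM (is_deriveD (is_derive_expR t) h) (is_derive_cst (2^-1 : R) t 1).
  move=> H; apply: (is_derive_eq H).
  by rewrite scaler0 add0r mulN1r opprK [RHS]mulrC.
by rewrite mul0r oppr0; exact: is_derive_cst.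
Qed.

Lemma derive1_s c : derive1 (s_ c) = c_ c :> (R -> R).
Proof. by apply/funext => t; rewrite derive1E; have [_ ->] := is_derive_s c t. Qed.

Lemma c2s2 c t : c_ c t ^+ 2 + curvature c * s_ c t ^+ 2 = 1.
Proof.
case: c => /=; last by rewrite mul1r cos2Dsin2.
  have : expR t * expR (- t) = 1 by rewrite -expRD subrr expR0.
  by move: (expR t) (expR (- t)) => a b ab; field: ab.
by rewrite mul0r addr0 expr1n.
Qed.

Lemma s_at0 c : s_ c 0 = 0 :> R.
Proof. by case: c => //=; rewrite ?sin0// oppr0 subrr mul0r. Qed.

Lemma c_at0 c : c_ c 0 = 1 :> R.
Proof. by case: c => //=; rewrite ?cos0// oppr0 expR0 divff. Qed.

Lemma continuous_s c : continuous (@s_ R c).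
Proof.
move=> t; apply: differentiable_continuous; apply/derivable1_diffP.
by have [] := is_derive_s c t.
Qed.

Lemma continuous_c c : continuous (@c_ c).
Proof.
move=> t; apply: differentiable_continuous; apply/derivable1_diffP.
by have [] := is_derive_c c t.
Qed.

(** These are [t < delta(X)] and [t < delta(X) / 2], void when the diameter is infinite. *)
Definition in_range c t : Prop := c = spherical -> t < pi.
Definition in_half c t : Prop := c = spherical -> t < pi / 2.

Lemma in_halfW c t : in_half c t -> in_range c t.
Proof. by move=> h /h ht; apply: lt_trans ht _; have := pi_gt0 R; lra. Qed.

Lemma s_gt0 c t : 0 < t -> in_range c t -> 0 < s_ c t.
Proof.
case: c => /= t0 h; last by apply: sin_gt0_pi; rewrite t0 h.
  by rewrite divr_gt0// subr_gt0 ltr_expR; lra.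
by [].
Qed.

Lemma c_gt0 c t : 0 <= t -> in_half c t -> 0 < c_ c t.
Proof.
case: c => /= t0 h; last first.
  by apply: cos_gt0_pihalf; rewrite h// andbT; have := pi_gt0 R; lra.
  by [].
by rewrite divr_gt0// addr_gt0// expR_gt0.
Qed.

Lemma s_ge0 c t : 0 <= t -> in_range c t -> 0 <= s_ c t.
Proof.
rewrite le_eqVlt => /predU1P[<- _|t0 h]; first by rewrite s_at0.
by rewrite ltW// s_gt0.
Qed.

Lemma s_lt c t t' : 0 <= t -> t < t' -> in_half c t' -> s_ c t < s_ c t'.
Proof.
case: c => /= t0 tt' h; last first.
  have := h erefl; have := pi_gt0 R => p0 th.
  by rewrite ltr_sin// in_itv /=; apply/andP; split; lra.
  by [].
by rewrite ltr_pM2r// ltrD ?ltr_expR// ltrN2 ltr_expR; lra.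
Qed.

Lemma s_inj c t t' : 0 <= t -> 0 <= t' -> in_half c t -> in_half c t' ->
  s_ c t = s_ c t' -> t = t'.
Proof.
move=> t0 t'0 h h' e; apply/eqP; rewrite eq_le !leNgt; apply/andP; split.
  by apply/negP => /(s_lt t'0)/(_ h); rewrite e ltxx.
by apply/negP => /(s_lt t0)/(_ h'); rewrite e ltxx.
Qed.

End model_functions.

(** * Algebra of the Euclidean inner product *)

Lemma dotDl (R : realType) n (u v w : 'rV[R]_n) : dot (u + v) w = dot u w + dot v w.
Proof. by rewrite /dot mulmxDl mxE. Qed.

Lemma dotZl (R : realType) n a (u w : 'rV[R]_n) : dot (a *: u) w = a * dot u w.
Proof. by rewrite /dot -scalemxAl mxE. Qed.

Lemma dotDr (R : realType) n (u v w : 'rV[R]_n) : dot w (u + v) = dot w u + dot w v.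
Proof. by rewrite dotC dotDl !(dotC w). Qed.

Lemma dotZr (R : realType) n a (u w : 'rV[R]_n) : dot w (a *: u) = a * dot w u.
Proof. by rewrite dotC dotZl (dotC w). Qed.

Lemma dot_eq0 (R : realType) n (u : 'rV[R]_n) : dot u u = 0 -> u = 0.
Proof.
rewrite dotE => /psumr_eq0P h; apply/rowP => i; rewrite mxE.
by apply/eqP; rewrite -sqrf_eq0 expr2 h// => j _; rewrite -expr2 sqr_ge0.
Qed.

Lemma dot_cauchy_schwarz (R : realType) n (u v : 'rV[R]_n) :
  dot u v ^+ 2 <= dot u u * dot v v.
Proof.
have [v0|vN0] := eqVneq (dot v v) 0.
  have d0 w : dot w (0 : 'rV[R]_n) = 0 by rewrite dotE big1// => i _; rewrite mxE mulr0.
  by rewrite (dot_eq0 v0) !d0 expr0n mulr0.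
have vp : 0 < dot v v by rewrite lt_neqAle eq_sym vN0 dot_ge0.
(* The vector is [dot v v] times the component of [u] orthogonal to [v]. *)
have := dot_ge0 (dot v v *: u + (- dot u v) *: v).
rewrite !(dotDl, dotDr, dotZl, dotZr) (dotC v u).
move: (dot v v) (dot u v) (dot u u) vp => a b d a0 h.
by rewrite -(ler_pM2l a0); nra.
Qed.

(** * Distance to the origin in the model spaces *)

Section model_geometry.
Context {R : realType} {n : nat}.
Implicit Types (c : model) (x u v : 'rV[R]_n.+1).

Definition height x : R := x ord0 ord_max.

(* For [x = (y, h)] this is [y . y']. *)
Definition hdot x v : R := dot x v - height x * height v.

Lemma form_ambient c u v : Defs.form (ambient_metric c n) u v =
  hdot u v + (if c is hyperbolic then -1 else 1) * (height u * height v).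
Proof.
rewrite /hdot; case: c; rewrite /Defs.form /ambient_metric; last 2 first.
- by rewrite mulmx1 mul1r subrK.
- by rewrite mulmx1 mul1r subrK.
rewrite mul_mx_diag mxE dotE (bigD1 ord_max)//= [in RHS](bigD1 ord_max)//= !mxE eqxx.
rewrite (eq_bigr (fun i => u ord0 i * v ord0 i)) => [|i /negbTE iN].
  by rewrite /height; ring.
by rewrite !mxE iN mulr1.
Qed.

(** Being the inner product of horizontal parts, [hdot] is positive and satisfies Cauchy-Schwarz
    whatever the curvature. *)
Lemma hdot_horizontal x v :
  hdot x v = dot (x - height x *: origin n) (v - height v *: origin n).
Proof.
have oE w : dot w (origin n) = height w.
  rewrite dotE (bigD1 ord_max)//= big1 ?addr0 /origin ?mxE ?eqxx ?mulr1// => i /negbTE iN.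
  by rewrite mxE iN andbF mulr0.
have oo : dot (origin n : 'rV[R]_n.+1) (origin n) = 1.
  by rewrite oE /height mxE !eqxx.
rewrite -!scaleNr !(dotDl, dotDr, dotZl, dotZr) oo oE (dotC (origin n)) oE /hdot.
by ring.
Qed.

Lemma hdot_ge0 x : 0 <= hdot x x.
Proof. by rewrite hdot_horizontal dot_ge0. Qed.

Lemma hdot_cauchy_schwarz x v : hdot x v ^+ 2 <= hdot x x * hdot v v.
Proof. by rewrite !hdot_horizontal dot_cauchy_schwarz. Qed.

(** In all three cases membership is read on [height] and [hdot] alone, the same two quantities that
    determine the distance to the origin. *)
Lemma spaceE c x : Defs.space c n x <->
  match c with
  | hyperbolic => hdot x x = height x ^+ 2 - 1 /\ 0 < height x
  | euclidean => height x = 1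
  | spherical => hdot x x = 1 - height x ^+ 2
  end.
Proof.
case: c => //=.
  have /= -> := form_ambient hyperbolic x x; rewrite mulN1r -expr2.
  by split => -[h ?]; split => //; lra.
have /= -> := form_ambient spherical x x; rewrite mul1r -expr2.
by split => h; lra.
Qed.

End model_geometry.

(** * Length of curves *)

Section curves.
Context {R : realType} {N : nat}.
Variables (M : set 'rV[R]_N) (gamma : R -> 'rV[R]_N).
Hypothesis hg : curve_in M gamma.

Let dg (t : R) : derivable gamma t 1. Proof. by have [] := hg. Qed.

Let cg : continuous (derive1 gamma). Proof. by have [] := hg. Qed.

Lemma is_derive_coord (t : R) j :
  is_derive t 1 (fun s => gamma s ord0 j) (derive1 gamma t ord0 j).
Proof.
have h := (derivable_mxP gamma t 1).1 (@dg t) ord0 j.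
by split=> //; rewrite derive1E derive_mx// mxE.
Qed.

Lemma is_derive_dot (t : R) :
  is_derive t 1 (fun s => dot (gamma s) (gamma s)) (2 * dot (gamma t) (derive1 gamma t)).
Proof.
rewrite (_ : (fun s => _) = \sum_(j < N) (fun s => gamma s ord0 j * gamma s ord0 j)); last first.
  by apply/funext => s; rewrite fct_sumE dotE.
have := is_derive_sum (fun j => is_deriveM (is_derive_coord t j) (is_derive_coord t j)).
move=> H; apply: (is_derive_eq H).
rewrite dotE mulr_sumr; apply: eq_bigr => j _.
by rewrite /GRing.scale /=; ring.
Qed.

Lemma continuous_form (g : 'M[R]_N) :
  continuous (fun t => Defs.form g (derive1 gamma t) (derive1 gamma t)).
Proof.
have cj j : continuous (fun t => derive1 gamma t ord0 j).
  by move=> t; exact: (continuous_comp (@cg t) (@coord_continuous R 1 N ord0 j _)).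
rewrite (_ : (fun t => _) = (fun t => \sum_j \sum_i
    derive1 gamma t ord0 i * g i j * derive1 gamma t ord0 j)); last first.
  apply/funext => t; rewrite /Defs.form mxE; apply: eq_bigr => j _.
  by rewrite mxE big_distrl /= mxE.
apply: continuous_big => [|j _]; first exact: add_continuous.
apply: continuous_big => [|i _]; first exact: add_continuous.
by move=> t; apply: (continuousM _ (cj j t)); apply: (continuousM (cj i t) (@cst_continuous _ _ _ _)).
Qed.

(** The length up to time [t] minus [F t] is nondecreasing. The bound on [dF] is asked for
    [0 < t < 1] only: there the curve lies in the space on a whole neighbourhood of [t], so that the
    equation of the space can be differentiated. *)
Lemma le_curve_length (g : 'M[R]_N) (F dF : R -> R) :
  (forall t : R, 0 <= t <= 1 -> is_derive t 1 F (dF t)) ->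
  (forall t : R, 0 < t < 1 -> dF t <= Num.sqrt (Defs.form g (derive1 gamma t) (derive1 gamma t))) ->
  F 1 - F 0 <= curve_length g gamma.
Proof.
move=> dF1 dFle.
set v := fun t => Num.sqrt (Defs.form g (derive1 gamma t) (derive1 gamma t)).
have cv : continuous v.
  by move=> t; exact: (continuous_comp (@continuous_form g t) (@sqrt_continuous R _)).
pose G t := (\int[lebesgue_measure]_(s in `[0, t]) v s)%R - F t.
have iv : lebesgue_measure.-integrable `[0, 1] (EFin \o v).
  by apply: continuous_compact_integrable; [exact: segment_compact|exact: continuous_subspaceT].
have L01 : {within `[0, 1], continuous (fun t => \int[lebesgue_measure]_(s in `[0, t]) v s)%R}.
  by apply: parameterized_integral_continuous.
have dG (t : R) : 0 < t < 1 -> is_derive t 1 G (v t - dF t).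
  move=> /andP[t0 t1].
  have [dL LE] := @continuous_FTC1_closed R v 0 t 1 t1 iv t0 (cv t).
  have hF := dF1 t (ltac:(by rewrite !ltW)).
  have hL : is_derive t 1 (fun x => \int[lebesgue_measure]_(s in `[0, x]) v s)%R (v t).
    by apply: DeriveDef; [exact: dL|rewrite -derive1E].
  exact: is_deriveB.
have GE : G 0 <= G 1.
  apply: (@ger0_derive1_le_cc _ G 0 1); rewrite ?lexx ?ler01 ?in_itv/= ?lexx ?ler01//.
  - by move=> t; rewrite in_itv /= => /dG[].
  - move=> t; rewrite in_itv /= => t01; rewrite derive1E.
    by have [_ ->] := dG _ t01; rewrite subr_ge0 dFle.
  - apply: within_continuousB => //.
    apply: continuous_in_subspaceT => t /set_mem; rewrite /= in_itv /= => /dF1[+ _].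
    by move/derivable1_diffP/differentiable_continuous.
move: GE; rewrite /G set_itv1 Rintegral_set1 sub0r /curve_length -/v.
by move=> h; lra.
Qed.

End curves.

(** Serves to differentiate the equation of the model space along a curve that satisfies it on
    [[0, 1]] only. *)
Lemma is_derive_oo_cst (R : realType) (f : R -> R) (a b x k df : R) :
  a < x < b -> (forall y, a < y < b -> f y = k) -> is_derive x 1 f df -> df = 0.
Proof.
move=> xab fk [_ <-].
have /near_eq_derive -> : {near x, f =1 cst k}.
  have : nbhs x `]a, b[%classic.
    by apply: open_nbhs_nbhs; split; [exact: interval_open|rewrite /= in_itv].
  by apply: filterS => y; rewrite /= in_itv /= => /fk.
  exact: derive_cst.
Qed.

Section distance_lower_bound.
Context {R : realType} {n : nat}.
Variable gamma : R -> 'rV[R]_n.+1.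
Implicit Types (c : model) (t : R).

Local Notation h s := (height (gamma s)).
Local Notation h' s := (height (derive1 gamma s)).
Local Notation v2 c s := (Defs.form (ambient_metric c n) (derive1 gamma s) (derive1 gamma s)).

(* The distance to the origin is at least [t], read on the coordinates of [x]. *)
Definition far c (x : 'rV[R]_n.+1) t : Prop :=
  match c with
  | hyperbolic => c_ hyperbolic t <= height x
  | euclidean => t ^+ 2 <= hdot x x
  | spherical => height x <= cos t
  end.

Variable M : set 'rV[R]_n.+1.
Hypothesis hg : curve_in M gamma.

Let is_derive_h (s : R) : is_derive s 1 (fun s => h s) (h' s).
Proof. exact: (is_derive_coord hg). Qed.

Let is_derive_hdot (s : R) : is_derive s 1 (fun s => hdot (gamma s) (gamma s))
  (2 * hdot (gamma s) (derive1 gamma s)).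
Proof.
have := is_deriveB (is_derive_dot hg s) (is_deriveM (is_derive_h s) (is_derive_h s)).
move=> H; apply: (is_derive_eq H).
by rewrite /hdot /GRing.scale /=; ring.
Qed.

Hypothesis g0 : gamma 0 = origin n.

Let h0 : h 0 = 1.
Proof. by rewrite g0 /height /origin mxE !eqxx. Qed.

Lemma far_le_length_euclidean t :
  (forall s, 0 <= s <= 1 -> Defs.space euclidean n (gamma s)) ->
  0 <= t -> t ^+ 2 <= hdot (gamma 1) (gamma 1) ->
  t <= curve_length (ambient_metric euclidean n) gamma.
Proof.
move=> gs t0 ft; apply/ler_addgt0Pr => a a0.
have pos s : 0 < hdot (gamma s) (gamma s) + a ^+ 2.
  by rewrite ltr_wpDl ?hdot_ge0// exprn_gt0.
(* The norm smoothed at the origin: [F 0 = a], and [F] is at least the norm. *)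
pose F s := Num.sqrt (hdot (gamma s) (gamma s) + a ^+ 2).
pose dF s := hdot (gamma s) (derive1 gamma s) / F s.
have dFE (s : R) : 0 <= s <= 1 -> is_derive s 1 F (dF s).
  move=> _; have H := is_deriveD (is_derive_hdot s) (is_derive_cst (a ^+ 2) s 1).
  have K := @is_derive1_comp R _ _ s _ _ (is_derive1_sqrt (pos s)) H.
  apply: (is_derive_eq K); rewrite /dF /F addr0.
  by field; rewrite gt_eqF// sqrtr_gt0.
have hF (s : R) : 0 < s < 1 -> dF s <= Num.sqrt (v2 euclidean s).
  move=> s01; rewrite form_ambient mul1r.
  (* The height is constantly [1] along the curve, so the velocity is horizontal. *)
  have h'0 : h' s = 0.
    apply: (@is_derive_oo_cst _ _ _ _ _ 1 _ s01 _ (is_derive_h s)) => y /andP[y0 y1].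
    by have /spaceE := gs y (ltac:(by rewrite !ltW)).
  rewrite h'0 mul0r addr0.
  have v0 := hdot_ge0 (derive1 gamma s).
  rewrite /dF ler_pdivrMr ?sqrtr_gt0// -sqrtrM//.
  apply: le_trans (ler_norm _) _; rewrite -sqrtr_sqr ler_wsqrtr//.
  apply: le_trans (hdot_cauchy_schwarz _ _) _; rewrite mulrC ler_wpM2l//.
  by rewrite lerDl sqr_ge0.
have := @le_curve_length R _ _ gamma hg (ambient_metric euclidean n) F dF dFE hF.
rewrite /F.
have -> : hdot (gamma 0) (gamma 0) = 0.
  by rewrite hdot_horizontal h0 g0 scale1r subrr dotE big1// => i _; rewrite mxE mul0r.
rewrite add0r sqrtr_sqr gtr0_norm// => L.
suff : t <= Num.sqrt (hdot (gamma 1) (gamma 1) + a ^+ 2) by lra.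
rewrite -(ger0_norm t0) -sqrtr_sqr ler_wsqrtr//; apply: le_trans ft _.
by rewrite lerDl sqr_ge0.
Qed.

Lemma far_le_length_spherical t :
  (forall s, 0 <= s <= 1 -> Defs.space spherical n (gamma s)) ->
  0 <= t -> t <= pi / 2 -> h 1 <= cos t ->
  t <= curve_length (ambient_metric spherical n) gamma.
Proof.
move=> gs t0 tpi ft; have pi0 := pi_gt0 R.
suff H a : 0 < a -> a < pi / 2 -> t <= curve_length (ambient_metric spherical n) gamma + a.
  apply/ler_addgt0Pr => a a0; have [api|api] := ltP a (pi / 2); first exact: H.
  (* When [a >= pi / 2 >= 1], the bound with [1/2] in place of [a] is stronger. *)
  have := H (2^-1) (ltac:(by rewrite invr_gt0)) (ltac:(have := pihalf_ge1 R; lra)).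
  by have := pihalf_ge1 R; lra.
move=> a0 api.
have ca0 : 0 < cos a by apply: cos_gt0_pihalf; rewrite api andbT; lra.
have ca1 : cos a < 1 by rewrite -cos0 ltr_cos// in_itv /= ?lexx; apply/andP; split; lra.
have sph s : 0 <= s <= 1 -> hdot (gamma s) (gamma s) = 1 - h s ^+ 2.
  by move=> /gs/spaceE.
have lam s : 0 <= s <= 1 -> 0 < 1 - (cos a * h s) ^+ 2.
  move=> /sph; have := hdot_ge0 (gamma s); move: (hdot _ _) (h s) (cos a) ca0 ca1 => q x l.
  move=> l0 l1 q0 qE; have x1 : x ^+ 2 <= 1 by lra.
  have l2 : l ^+ 2 < 1 by nra.
  rewrite exprMn subr_gt0; apply: le_lt_trans l2.
  by rewrite -[leRHS]mulr1 ler_wpM2l// sqr_ge0.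
have lam' s : 0 <= s <= 1 -> -1 < cos a * h s < 1.
  move=> /lam; move: (cos a * h s) => x hx; apply/andP; split; nra.
(* The distance to [o] is [acos (h s)], singular at [h = 1]. The factor [cos a] keeps the argument
   inside [(-1, 1)] and gives [F 0 = a]. *)
pose F s := acos (cos a * h s).
pose dF s := - (cos a * h' s) / Num.sqrt (1 - (cos a * h s) ^+ 2).
have dFE (s : R) : 0 <= s <= 1 -> is_derive s 1 F (dF s).
  move=> s01; have H := is_deriveM (is_derive_cst (cos a) s 1) (is_derive_h s).
  have K := @is_derive1_comp R _ _ s _ _ (is_derive1_acos (lam' _ s01)) H.
  apply: (is_derive_eq K); rewrite /dF /= scaler0 addr0 /GRing.scale /=.
  by rewrite mulrC mulrN mulNr.
have hF (s : R) : 0 < s < 1 -> dF s <= Num.sqrt (v2 spherical s).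
  move=> s01; have s01' : 0 <= s <= 1 by move: s01 => /andP[? ?]; rewrite !ltW.
  rewrite form_ambient mul1r.
  (* The derivative of the equation [hdot + h^2 = 1] of the sphere. *)
  have hb : hdot (gamma s) (derive1 gamma s) = - (h s * h' s).
    have H := is_deriveD (is_derive_hdot s) (is_deriveM (is_derive_h s) (is_derive_h s)).
    have := is_derive_oo_cst s01 _ H => /(_ 1) K.
    have : 2 * hdot (gamma s) (derive1 gamma s) + (h s *: h' s + h s *: h' s) = 0.
      apply: K => y /andP[y0 y1]; rewrite /= -[LHS]/(_ + h y * h y).
      by rewrite sph ?ltW// -expr2 subrK.
    by rewrite /GRing.scale /=; lra.
  have := hdot_cauchy_schwarz (gamma s) (derive1 gamma s); rewrite hb (sph _ s01').
  have := lam _ s01'; have := hdot_ge0 (derive1 gamma s).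
  rewrite /dF; move: (hdot _ (derive1 gamma s)) (h s) (h' s) (cos a) ca0 ca1 => q x y l.
  move=> l0 l1 q0 hl cs.
  rewrite ler_pdivrMr ?sqrtr_gt0// -sqrtrM ?addr_ge0//; last by nra.
  apply: le_trans (ler_norm _) _; rewrite -sqrtr_sqr ler_wsqrtr//.
  (* This is the bound for [a = 0]. It survives the factor [l^2 <= 1] because
     [l^2 (1 - x^2) <= 1 - l^2 x^2]. *)
  have h1 : y ^+ 2 <= (1 - x ^+ 2) * (q + y ^+ 2) by nra.
  rewrite sqrrN exprMn -(expr2 y).
  have l2 : l ^+ 2 <= 1 by nra.
  have := sqr_ge0 l; have := sqr_ge0 y; nra.
have := @le_curve_length R _ _ gamma hg (ambient_metric spherical n) F dF dFE hF.
rewrite /F h0 mulr1 cosK; last first.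
  by rewrite in_itv /=; apply/andP; split; lra.
suff : t <= acos (cos a * h 1) by lra.
have := lam' 1 (ltac:(by rewrite ler01 lexx)) => /andP[l1 l2].
rewrite leNgt; apply/negP => lt; move: ft; apply/negP; rewrite -ltNge.
(* Here [t <= pi / 2] enters: with [cos t >= 0], the bound [h 1 <= cos t] is preserved by
   multiplying [h 1] by [cos a]. *)
have ct0 : 0 <= cos t by apply: cos_ge0_pihalf; apply/andP; split; lra.
have : cos t < cos a * h 1.
  rewrite -[ltRHS]acosK ?in_itv/= ?ltW//.
  have i1 : t \in `[0, pi] by rewrite in_itv /=; apply/andP; split; lra.
  have i2 : acos (cos a * h 1) \in `[0, pi].
    by rewrite in_itv /= acos_ge0 ?acos_lepi// !ltW.
  by rewrite ltr_cos.
by nra.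
Qed.

Lemma far_le_length_hyperbolic t :
  (forall s, 0 <= s <= 1 -> Defs.space hyperbolic n (gamma s)) ->
  0 <= t -> c_ hyperbolic t <= h 1 ->
  t <= curve_length (ambient_metric hyperbolic n) gamma.
Proof.
move=> gs t0 ft; apply/ler_addgt0Pr => a a0.
pose l : R := c_ hyperbolic a.
have l1 : 1 < l.
  have := c2s2 hyperbolic a; have := s_gt0 (c := hyperbolic) a0 (ltac:(by [])).
  have := c_gt0 (c := hyperbolic) (ltW a0) (ltac:(by [])).
  by rewrite -/l; move: l (s_ _ _) => l s /=; nra.
have hyp s : 0 <= s <= 1 -> hdot (gamma s) (gamma s) = h s ^+ 2 - 1 /\ 0 < h s.
  by move=> /gs/spaceE.
have h1 s : 0 <= s <= 1 -> 1 <= h s.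
  by move=> /hyp[]; have := hdot_ge0 (gamma s); move: (hdot _ _) (h s) => q x; nra.
have lam s : 0 <= s <= 1 -> 0 < (l * h s) ^+ 2 - 1.
  move=> /h1 hs; have : 1 < l * h s by nra.
  by move: (l * h s) => y y1; nra.
have lamp s : 0 <= s <= 1 -> 0 < l * h s + Num.sqrt ((l * h s) ^+ 2 - 1).
  move=> s01; have := h1 s s01; have := sqrtr_ge0 ((l * h s) ^+ 2 - 1); nra.
(* This is [arcosh (l * h s)]; the factor [l = cosh a > 1] keeps the argument away from the
   singularity at [1] and gives [F 0 = a]. *)
pose F s := ln (l * h s + Num.sqrt ((l * h s) ^+ 2 - 1)).
pose dF s := (l * h' s) / Num.sqrt ((l * h s) ^+ 2 - 1).
have dFE (s : R) : 0 <= s <= 1 -> is_derive s 1 F (dF s).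
  move=> s01; have H := is_deriveM (is_derive_cst l s 1) (is_derive_h s).
  have H2 := is_deriveB (is_deriveM H H) (is_derive_cst (1 : R) s 1).
  have K := @is_derive1_comp R Num.sqrt _ s _ _ (is_derive1_sqrt (lam _ s01)) H2.
  have K2 := is_deriveD H K.
  have K3 := @is_derive1_comp R (@ln R) _ s _ _ (is_derive1_ln (lamp _ s01)) K2.
  apply: (is_derive_eq K3); rewrite /dF.
  set r := Num.sqrt ((l * h s) ^+ 2 - 1).
  have r0 : 0 < r by rewrite sqrtr_gt0 lam.
  have lr0 : 0 < l * h s + r := lamp _ s01.
  transitivity ((l * h s + r)^-1 * ((l * h' s + h s * 0) + (2 * r)^-1 *
    ((l * h s * (l * h' s + h s * 0) + l * h s * (l * h' s + h s * 0)) - 0))).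
    by [].
  by field; rewrite ?gt_eqF.
have hF (s : R) : 0 < s < 1 -> dF s <= Num.sqrt (v2 hyperbolic s).
  move=> s01; have s01' : 0 <= s <= 1 by move: s01 => /andP[? ?]; rewrite !ltW.
  rewrite form_ambient mulN1r.
  have hb : hdot (gamma s) (derive1 gamma s) = h s * h' s.
    have H := is_deriveB (is_derive_hdot s) (is_deriveM (is_derive_h s) (is_derive_h s)).
    have := is_derive_oo_cst s01 _ H => /(_ (-1)) K.
    have : 2 * hdot (gamma s) (derive1 gamma s) - (h s *: h' s + h s *: h' s) = 0.
      apply: K => y /andP[y0 y1]; rewrite /= -[LHS]/(_ - h y * h y).
      by have [-> _] := hyp y (ltac:(by rewrite !ltW)); rewrite -expr2; ring.
    by rewrite /GRing.scale /=; lra.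
  have := hdot_cauchy_schwarz (gamma s) (derive1 gamma s); rewrite hb (hyp _ s01').1.
  have := lam _ s01'; have := hdot_ge0 (derive1 gamma s); have := h1 _ s01'.
  rewrite /dF; move: (hdot _ (derive1 gamma s)) (h s) (h' s) => q x y.
  move=> x1 q0 hl cs.
  have yq : y ^+ 2 <= (x ^+ 2 - 1) * (q - y ^+ 2) by nra.
  have sp0 : 0 <= q - y * y by nra.
  rewrite ler_pdivrMr ?sqrtr_gt0// -sqrtrM//.
  apply: le_trans (ler_norm _) _; rewrite -sqrtr_sqr ler_wsqrtr//.
  rewrite exprMn; have l2 : 1 <= l ^+ 2 by nra.
  by nra.
have := @le_curve_length R _ _ gamma hg (ambient_metric hyperbolic n) F dF dFE hF.
rewrite /F h0 mulr1.
have hs0 : 0 <= s_ hyperbolic a :> R by rewrite ltW// s_gt0.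
have arc (b : R) : 0 <= b -> c_ hyperbolic b + Num.sqrt (c_ hyperbolic b ^+ 2 - 1) = expR b.
  move=> b0.
  have cE : c_ hyperbolic b ^+ 2 - 1 = s_ hyperbolic b ^+ 2.
    have : c_ hyperbolic b ^+ 2 + -1 * s_ hyperbolic b ^+ 2 = 1 := c2s2 hyperbolic b.
    by move: (c_ _ _) (s_ _ _) => x y; lra.
  rewrite cE sqrtr_sqr ger0_norm; last by rewrite s_ge0.
  by rewrite /=; field.
rewrite /l arc ?(ltW a0)// expRK => L.
suff : t <= ln (l * h 1 + Num.sqrt ((l * h 1) ^+ 2 - 1)) by rewrite /l; lra.
have h11 := h1 1 (ltac:(by rewrite ler01 lexx)).
have ct1 : 1 <= c_ hyperbolic t.
  have := c2s2 hyperbolic t; have := c_gt0 (c := hyperbolic) t0 (ltac:(by [])).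
  by move: (c_ _ _) (s_ _ _) => x y /=; nra.
rewrite -{1}(expRK t) ler_ln ?posrE ?expR_gt0 ?lamp ?ler01 ?lexx//.
rewrite -(arc _ t0).
have le1 : c_ hyperbolic t <= l * h 1 by nra.
rewrite lerD// ler_wsqrtr// lerB// lerXn2r ?nnegrE//; nra.
Qed.

End distance_lower_bound.

Lemma curve_in_lincomb (R : realType) N (M : set 'rV[R]_N) (o u : 'rV[R]_N)
    (a b a' b' : R -> R) :
  (forall s : R, is_derive s 1 a (a' s)) -> (forall s : R, is_derive s 1 b (b' s)) ->
  continuous a' -> continuous b' ->
  (forall s, 0 <= s <= 1 -> M (a s *: o + b s *: u)) ->
  curve_in M (fun s => a s *: o + b s *: u) /\
  derive1 (fun s => a s *: o + b s *: u) = (fun s => a' s *: o + b' s *: u).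
Proof.
move=> da db ca cb hM; set gamma := fun s => _.
have dj (s : R) j : is_derive s 1 (fun s => gamma s ord0 j)
    ((a' s *: o + b' s *: u) ord0 j).
  rewrite (_ : (fun s => _) = (a * cst (o ord0 j)) + (b * cst (u ord0 j))); last first.
    by apply/funext => z; rewrite !mxE.
  have H := is_deriveD (is_deriveM (da s) (is_derive_cst (o ord0 j) s 1))
    (is_deriveM (db s) (is_derive_cst (u ord0 j) s 1)).
  apply: (is_derive_eq H).
  by rewrite !scaler0 !add0r !mxE [RHS]addrC [X in X + _]mulrC [X in _ + X]mulrC addrC.
have dg (s : R) : derivable gamma s 1.
  by apply/derivable_mxP => i j; rewrite (ord1 i); have [] := dj s j.
have dE : derive1 gamma = (fun s => a' s *: o + b' s *: u).
  apply/funext => s; rewrite derive1E derive_mx//; apply/rowP => j; rewrite mxE.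
  by have [_ ->] := dj s j.
split; last exact: dE.
split; [exact: dg| |exact: hM].
rewrite dE => s.
apply: mx_continuousP => i j.
have := continuousD (continuousM (ca s) (@cst_continuous _ _ (o i j) s))
  (continuousM (cb s) (@cst_continuous _ _ (u i j) s)).
by apply: eq_continuous_at; apply/funext => z; rewrite !mxE.
Qed.

(** * Geodesics and the exact distance to the origin *)

Section distance.
Context {R : realType} {n : nat}.
Implicit Types (c : model) (x u : 'rV[R]_n.+1) (t : R).

Lemma height_lincomb a b x u : height (a *: x + b *: u) = a * height x + b * height u.
Proof. by rewrite /height !mxE. Qed.

Lemma height_origin : height (origin n : 'rV[R]_n.+1) = 1.
Proof. by rewrite /height /origin mxE !eqxx. Qed.

Lemma dot_origin x : dot x (origin n) = height x.
Proof.
rewrite dotE (bigD1 ord_max)//= big1 ?addr0 /origin ?mxE ?eqxx ?mulr1// => i /negbTE iN.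
by rewrite mxE iN andbF mulr0.
Qed.

Lemma hdot_polar a b u : height u = 0 ->
  hdot (a *: origin n + b *: u) (a *: origin n + b *: u) = b ^+ 2 * dot u u.
Proof.
move=> u0; rewrite /hdot height_lincomb height_origin u0 mulr1 mulr0 addr0.
rewrite !(dotDl, dotDr, dotZl, dotZr) dot_origin (dotC (origin n) u) !dot_origin.
by rewrite height_origin u0; ring.
Qed.

Lemma space_of_hdot c x t : c_ c t = height x -> hdot x x = s_ c t ^+ 2 ->
  Defs.space c n x.
Proof.
move=> cE sE; apply/spaceE; have := c2s2 c t; rewrite sE -cE.
case: c cE sE => /=.
- move=> _ _ h; split; first by lra.
  by rewrite divr_gt0// addr_gt0// expR_gt0.
- by [].
- by move=> _ _ h; lra.
Qed.

Lemma polar_unit c x t : (1 <= n)%N -> c_ c t = height x -> hdot x x = s_ c t ^+ 2 ->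
  exists u, [/\ height u = 0, dot u u = 1 & x = c_ c t *: origin n + s_ c t *: u].
Proof.
move=> n1 cE sE; have [s0|sN0] := eqVneq (s_ c t) 0.
  (* When [S(t) = 0] the direction is arbitrary; this basis vector is horizontal because
     [n >= 1]. *)
  exists (delta_mx ord0 ord0); split.
  - rewrite /height mxE eqxx /= (_ : (ord_max == ord0) = false)//.
    by apply/negbTE; rewrite -val_eqE /= -lt0n.
  - rewrite dotE (bigD1 ord0)//= mxE !eqxx mulr1 big1 ?addr0// => i /negbTE iN.
    by rewrite mxE iN andbF mulr0.
  - rewrite s0 scale0r addr0 cE; apply/eqP; rewrite -subr_eq0; apply/eqP/dot_eq0.
    by rewrite -hdot_horizontal sE s0 expr0n.
exists ((s_ c t)^-1 *: (x - height x *: origin n)); split.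
- rewrite -scaleNr -[x in x + _]scale1r [height _]mxE -/(height _).
  by rewrite height_lincomb height_origin; ring.
- by rewrite dotZ -hdot_horizontal sE exprVn mulVf// sqrf_eq0.
- by rewrite scalerA divff// scale1r cE addrC subrK.
Qed.

(** The curve [s |-> C(ts) o + S(ts) u] has constant speed [t], by [C^2 + kappa S^2 = 1] with
    [kappa] the curvature. *)
Lemma geodesic c t u : 0 <= t -> height u = 0 -> dot u u = 1 ->
  exists gamma, [/\ curve_in (Defs.space c n) gamma, gamma 0 = origin n,
    gamma 1 = c_ c t *: origin n + s_ c t *: u &
    t = curve_length (ambient_metric c n) gamma].
Proof.
move=> t0 u0 u1.
have dt (s : R) : is_derive s 1 (fun s => t * s) t.
  have := is_deriveM (is_derive_cst t s 1) (is_derive_id s 1) => H.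
  by apply: (is_derive_eq H); rewrite scaler0 addr0 [LHS]mulr1.
pose a' s := - (curvature c * s_ c (t * s)) * t.
pose b' s := c_ c (t * s) * t.
have da (s : R) : is_derive s 1 (c_ c \o (fun s => t * s)) (a' s).
  exact: (is_derive1_comp (is_derive_c c _) (dt s)).
have db (s : R) : is_derive s 1 (s_ c \o (fun s => t * s)) (b' s).
  exact: (is_derive1_comp (is_derive_s c _) (dt s)).
have ct : continuous (fun s : R => t * s) by move=> s; apply: cvgM; [exact: cvg_cst|exact: cvg_id].
have ca : continuous a'.
  move=> s; apply: cvgM; last exact: cvg_cst.
  apply: cvgN; apply: cvgM; first exact: cvg_cst.
  exact: (continuous_comp (ct s) (@continuous_s R c _)).
have cb : continuous b'.
  move=> s; apply: cvgM; last exact: cvg_cst.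
  exact: (continuous_comp (ct s) (@continuous_c R c _)).
have hM s : 0 <= s <= 1 ->
    Defs.space c n (c_ c (t * s) *: origin n + s_ c (t * s) *: u).
  move=> _; apply: (@space_of_hdot c _ (t * s)).
    by rewrite height_lincomb height_origin u0 mulr1 mulr0 addr0.
  by rewrite hdot_polar// u1 mulr1.
have [cu dE] := curve_in_lincomb da db ca cb hM.
exists (fun s => (c_ c \o (fun s => t * s)) s *: origin n + (s_ c \o (fun s => t * s)) s *: u).
split => //.
- by rewrite /= mulr0 c_at0 s_at0 scale1r scale0r addr0.
- by rewrite /= mulr1.
rewrite /curve_length dE.
rewrite (@eq_Rintegral _ _ _ _ _ (cst t)) => [|s _].
  rewrite Rintegral_cst// [X in fine X](_ : _ = 1%:E) ?mulr1//.
  by rewrite [LHS]lebesgue_measure_itv /= lte_fin ltr01 oppr0 adde0.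
rewrite form_ambient hdot_polar// height_lincomb height_origin u0 u1.
have -> : b' s ^+ 2 * 1 + (if c is hyperbolic then -1 else 1) *
    ((a' s * 1 + b' s * 0) * (a' s * 1 + b' s * 0)) = t ^+ 2; last first.
  by rewrite sqrtr_sqr ger0_norm.
rewrite /a' /b'; have := c2s2 c (t * s); move: (c_ _ _) (s_ _ _) => y z.
case: (c) => /= yz; rewrite ?mul0r ?oppr0 ?mul1r.
- transitivity (t ^+ 2 * (y ^+ 2 + -1 * z ^+ 2)); last by rewrite yz mulr1.
  by ring.
- transitivity (t ^+ 2 * (y ^+ 2 + 0 * z ^+ 2)); last by rewrite yz mulr1.
  by ring.
- transitivity (t ^+ 2 * (y ^+ 2 + 1 * z ^+ 2)); last by rewrite yz mulr1.
  by ring.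
Qed.

Lemma space_polar_coordinate c x : Defs.space c n x ->
  exists t, [/\ 0 <= t, c = spherical -> t <= pi, c_ c t = height x &
    hdot x x = s_ c t ^+ 2].
Proof.
move=> /spaceE; case: c => [[hE h0]|hE|hE].
- have h1 : 1 <= height x by have := hdot_ge0 x; nra.
  pose r := Num.sqrt (height x ^+ 2 - 1).
  have r0 : 0 <= r by rewrite sqrtr_ge0.
  have r2 : r ^+ 2 = height x ^+ 2 - 1 by rewrite sqr_sqrtr//; nra.
  have e1 : expR (ln (height x + r)) = height x + r by rewrite lnK// posrE; lra.
  have e2 : expR (- ln (height x + r)) = height x - r.
    rewrite expRN e1; apply: (@mulfI _ (height x + r)); first by rewrite gt_eqF//; lra.
    by rewrite divff; [lra|rewrite gt_eqF//; lra].
  exists (ln (height x + r)); split => //.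
  + by rewrite ln_ge0//; lra.
  + by rewrite /= e1 e2; field.
  + by rewrite /= e1 e2 hE -r2; field.
- exists (Num.sqrt (hdot x x)); split => //=.
  by rewrite sqr_sqrtr// hdot_ge0.
- have h1 : -1 <= height x <= 1.
    by rewrite -ler_norml -(@ler_pXn2r _ 2%N)// ?nnegrE// expr1n real_normK ?num_real//;
      have := hdot_ge0 x; lra.
  have cE : cos (acos (height x)) = height x by rewrite acosK.
  exists (acos (height x)); split=> //=.
  + exact: acos_ge0.
  + by move=> _; exact: acos_lepi.
  + by rewrite sin2cos2 cE.
Qed.

Hypothesis n_gt0 : (1 <= n)%N.

Let lengths c x : set R := [set l | exists gamma,
  [/\ curve_in (Defs.space c n) gamma, gamma 0 = origin n, gamma 1 = x
    & l = curve_length (ambient_metric c n) gamma]].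

Lemma dist_ge c x t : Defs.space c n x -> 0 <= t ->
  (c = spherical -> t <= pi / 2) -> far c x t -> t <= dist c (origin n) x.
Proof.
move=> sx t0 th fx.
(* The infimum is bounded below only once the set of lengths is known to be nonempty; a geodesic to
   [x] supplies an element. *)
have [t' [t'0 _ cE sE]] := space_polar_coordinate sx.
have [u [u0 u1 xE]] := polar_unit n_gt0 cE sE.
have [gamma [g1 g2 g3 g4]] := geodesic c t'0 u0 u1.
apply: (@lb_le_inf _ (lengths c x)).
  by exists t', gamma; split=> //; rewrite g3 xE.
move=> _ [{g1 g2 g3 g4}gamma [g1 g2 g3 ->]].
have gs s : 0 <= s <= 1 -> Defs.space c n (gamma s) by have [_ _] := g1; exact.
rewrite -g3 in fx; case: c fx th g1 gs {sx cE sE xE} => fx th g1 gs.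
- exact: far_le_length_hyperbolic g1 g2 _ gs t0 fx.
- exact: far_le_length_euclidean g1 g2 _ gs t0 fx.
- exact: far_le_length_spherical g1 g2 _ gs t0 (th erefl) fx.
Qed.

Lemma dist_polar c x t : 0 <= t -> (c = spherical -> t <= pi / 2) ->
  c_ c t = height x -> hdot x x = s_ c t ^+ 2 -> dist c (origin n) x = t.
Proof.
move=> t0 th cE sE; apply/eqP; rewrite eq_le; apply/andP; split; last first.
  apply: dist_ge => //; first exact: space_of_hdot cE sE.
  by case: c {th} cE sE => /= cE sE; rewrite ?cE ?sE.
have [u [u0 u1 xE]] := polar_unit n_gt0 cE sE.
have [gamma [g1 g2 g3 g4]] := geodesic c t0 u0 u1.
apply: (@ge_inf _ (lengths c x)).
  exists 0 => _ [g [_ _ _ ->]]; apply: Rintegral_ge0 => s _; exact: sqrtr_ge0.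
by exists gamma; split=> //; rewrite g3 xE.
Qed.

End distance.

Lemma col_mx_gram1 (R : realType) k l N (A : 'M[R]_(k, N)) (B : 'M[R]_(l, N)) :
  col_mx A B *m (col_mx A B)^T =
  block_mx (A *m A^T) (A *m B^T) (B *m A^T) (B *m B^T).
Proof. by rewrite tr_col_mx mul_col_row. Qed.

Lemma mul_row_col_scalar (R : realType) m N (a : R) (s : 'rV[R]_m) (e : 'rV[R]_N)
    (E : 'M[R]_(m, N)) :
  (row_mx (a%:M : 'M[R]_1) s : 'rV[R]_m.+1) *m (col_mx e E : 'M[R]_(m.+1, N)) =
  a *: e + s *m E.
Proof.
transitivity ((row_mx (a%:M : 'M[R]_1) s : 'rV[R]_(1 + m)) *m col_mx e E) => //.
by rewrite mul_row_col mul_scalar_mx.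
Qed.

(** * Frames of totally geodesic planes *)

Section orthonormal_basis.
Context {R : realType} {N : nat}.
Implicit Types (U : {vspace 'rV[R]_N}) (v w x : 'rV[R]_N).

(** Rank-nullity for the functional [dot _ w], whose image on [U] is a line. *)
Lemma hyperplane_section w U m : \dim U = m.+1 ->
  (exists2 v, v \in U & dot v w != 0) ->
  exists U', \dim U' = m /\ (forall x, x \in U' <-> x \in U /\ dot x w = 0).
Proof.
move=> dU [v vU vw].
have lin : linear (fun x => dot x w : R^o).
  by move=> a x y; rewrite dotDl dotZl.
pose lM := GRing.isLinear.Build _ _ _ _ _ lin.
pose L : {linear 'rV[R]_N -> R^o} := HB.pack (fun x => dot x w : R^o) lM.
have LE x : linfun L x = dot x w by rewrite lfunE.
exists (U :&: lker (linfun L))%VS; split; last first.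
  move=> x; rewrite memv_cap memv_ker LE; split; last by move=> [-> /eqP].
  by move/andP => [-> /eqP].
have := limg_ker_dim (linfun L) U; rewrite dU.
suff -> : \dim (linfun L @: U) = 1%N by rewrite addn1 => -[].
apply/eqP; rewrite eqn_leq; apply/andP; split.
  by apply: leq_trans (dimvS (subvf _)) _; rewrite dimvf /dim /= .
rewrite lt0n dimv_eq0; apply: contra vw => /eqP i0.
have := memv_img (linfun L) vU; rewrite i0 memv0 LE; exact.
Qed.

(** Gram-Schmidt by induction: a normalized vector of [U] is put on top of a basis of its orthogonal
    complement in [U]. *)
Lemma orthonormal_basis m U : \dim U = m ->
  exists E : 'M[R]_(m, N), E *m E^T = 1%:M /\
    (forall x, x \in U <-> exists s, x = s *m E).
Proof.
elim: m U => [|m IH] U dU.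
  exists 0; split; first by apply/matrixP => -[].
  move=> x; have /eqP := dU; rewrite dimv_eq0 => /eqP ->; rewrite memv0; split.
    by move/eqP ->; exists 0; rewrite mulmx0.
  by move=> [s ->]; rewrite mulmx0.
have [v vU v0] : exists2 v, v \in U & v != 0.
  exists (vpick U); first exact: memv_pick.
  by rewrite vpick0 -dimv_eq0 dU.
have vv : 0 < dot v v.
  by rewrite lt_neqAle dot_ge0 andbT eq_sym; apply: contra v0 => /eqP/dot_eq0 ->.
have [U' [dU' U'E]] := hyperplane_section dU (ex_intro2 _ _ v vU (lt0r_neq0 vv)).
have [E [EE EU]] := IH U' dU'.
pose e := (Num.sqrt (dot v v))^-1 *: v.
have ee : dot e e = 1 by rewrite dotZ exprVn sqr_sqrtr ?dot_ge0// mulVf// gt_eqF.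
have Ev s : dot (s *m E) v = 0 by have [_] := (U'E (s *m E)).1 ((EU _).2 (ex_intro _ s erefl)).
have Ee : E *m e^T = 0.
  apply/matrixP => i j; rewrite (ord1 j) [RHS]mxE /e linearZ -scalemxAr mxE.
  have := Ev (delta_mx ord0 i); rewrite -rowE /dot -row_mul mxE => ->.
  by rewrite mulr0.
exists (col_mx e E : 'M[R]_(1 + m, N)); split.
  rewrite [LHS](col_mx_gram1 e E).
  have -> : e *m E^T = 0 by rewrite -[LHS]trmxK trmx_mul trmxK Ee trmx0.
  by rewrite Ee EE mulmx_dot ee -scalar_mx_block.
move=> x; split.
  move=> xU; pose a := dot x v / dot v v.
  have /EU [s sE] : x - a *: v \in U'.
    apply/U'E; split; first by rewrite memvB// memvZ.
    by rewrite dotDl -scaleNr dotZl mulNr divfK ?subrr// gt_eqF.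
  exists (row_mx ((a * Num.sqrt (dot v v))%:M : 'M[R]_1) s : 'rV[R]_(1 + m)).
  rewrite mul_row_col_scalar -sE scalerA mulfK ?gt_eqF ?sqrtr_gt0//.
  by rewrite addrC subrK.
move=> [s ->]; rewrite (row_mx_uncons s) mul_row_col_scalar.
rewrite memvD//; first by rewrite !memvZ.
have /U'E[]// : rsubmx (s : 'rV[R]_(1 + m)) *m E \in U'.
by apply/EU; exists (rsubmx (s : 'rV[R]_(1 + m))).
Qed.

End orthonormal_basis.

(** [p] is the point of the plane nearest to the origin; the rows of [E] are an orthonormal basis of
    the horizontal vectors of [V], all orthogonal to [p]. On horizontal vectors the three ambient
    metrics agree, so the frame does not depend on which one is in force. *)
Record model_frame (R : realType) (c : model) (n m : nat)
    (V : {vspace 'rV[R]_n.+1}) (p : 'rV[R]_n.+1) (E : 'M[R]_(m, n.+1)) : Prop :=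
  ModelFrame {
    frame_space : Defs.space c n p ;
    frame_height : 0 < height p ;
    frame_EE : E *m E^T = 1%:M ;
    frame_Eh : forall s, height (s *m E) = 0 ;
    frame_pE : p *m E^T = 0 ;
    frame_mem : forall x, x \in V <-> exists a s, x = a *: p + s *m E }.

Section model_frames.
Context {R : realType} {n m : nat}.
Implicit Types (c : model) (V : {vspace 'rV[R]_n.+1}).

(** A point of positive height makes the horizontal part of [V] a hyperplane of [V]. Removing from
    that point its component along [E] leaves the direction of [p], which is rescaled into the
    space. *)
Lemma model_frame_exists c V : \dim V = m.+1 ->
  (exists x, [/\ Defs.space c n x, x \in V & 0 < height x]) ->
  exists p (E : 'M[R]_(m, n.+1)), model_frame c V p E.
Proof.
move=> dV [x0 [sx0 x0V h0]].
have [|U [dU UE]] := hyperplane_section (w := origin n) dV.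
  by exists x0 => //; rewrite dot_origin gt_eqF.
have [E [EE EU]] := orthonormal_basis dU.
have EV s : s *m E \in V /\ height (s *m E) = 0.
  have /UE[? h] : s *m E \in U by apply/EU; exists s.
  by split=> //; rewrite -dot_origin.
pose s0 := x0 *m E^T; pose p0 := x0 - s0 *m E.
have p0V : p0 \in V by rewrite memvB//; have [] := EV s0.
have p0E : p0 *m E^T = 0 by rewrite mulmxBl -mulmxA EE mulmx1 subrr.
have p0h : height p0 = height x0.
  by rewrite [LHS]mxE [X in _ + X]mxE -[X in _ - X]/(height _) (EV s0).2 subr0.
have x0E : x0 = p0 + s0 *m E by rewrite subrK.
clearbody p0.
have VE x : x \in V <-> exists a s, x = a *: p0 + s *m E.
  split; last by move=> [a [s ->]]; rewrite memvD ?memvZ//; have [] := EV s.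
  move=> xV; pose a := height x / height p0.
  have /EU[s sE] : x - a *: p0 \in U.
    apply/UE; split; first by rewrite memvB ?memvZ.
    by rewrite dotDl -scaleNr dotZl !dot_origin mulNr divfK ?subrr// p0h gt_eqF.
  by exists a, s; rewrite -sE addrC subrK.
have dx0 : hdot x0 x0 = hdot p0 p0 + dot s0 s0.
  move: s0 x0E => s ->.
  have hx : height (p0 + s *m E) = height p0.
    by rewrite [LHS]mxE -!/(height _) (EV s).2 addr0.
  rewrite /hdot hx dotDl !dotDr.
  have -> : dot p0 (s *m E) = 0 by rewrite /dot trmx_mul mulmxA p0E mul0mx mxE.
  have -> : dot (s *m E) p0 = 0 by rewrite dotC /dot trmx_mul mulmxA p0E mul0mx mxE.
  have -> : dot (s *m E) (s *m E) = dot s s.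
    by rewrite /dot trmx_mul mulmxA -(mulmxA s) EE mulmx1.
  by ring.
(* In the hyperbolic case [p0] is still timelike, because removing the component [s0] lowers [hdot]
   and keeps the height. *)
have [l l0 lp] : exists2 l, 0 < l & Defs.space c n (l *: p0).
  have hh l : height (l *: p0) = l * height p0 by rewrite [LHS]mxE.
  have hl l : hdot (l *: p0) (l *: p0) = l ^+ 2 * hdot p0 p0.
    by rewrite /hdot hh dotZ; ring.
  have d0 := dot_ge0 s0; have q0 := hdot_ge0 p0.
  case: c sx0 => /spaceE; rewrite ?dx0 -p0h.
  - move=> [hE hp]; have q : 0 < height p0 ^+ 2 - hdot p0 p0 by lra.
    exists (Num.sqrt (height p0 ^+ 2 - hdot p0 p0))^-1.
      by rewrite invr_gt0 sqrtr_gt0.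
    apply/spaceE; rewrite hl hh; split; last by rewrite mulr_gt0// invr_gt0 sqrtr_gt0.
    rewrite exprMn exprVn sqr_sqrtr ?ltW//.
    by field; rewrite gt_eqF.
  - move=> hp; exists 1; first by rewrite ltr01.
    by apply/spaceE; rewrite hh mul1r.
  - move=> hE; have hp0 : 0 < height p0 by rewrite p0h.
    have q : 0 < height p0 ^+ 2 + hdot p0 p0 by rewrite ltr_wpDr// exprn_gt0.
    exists (Num.sqrt (height p0 ^+ 2 + hdot p0 p0))^-1.
      by rewrite invr_gt0 sqrtr_gt0.
    apply/spaceE; rewrite hl hh exprMn exprVn sqr_sqrtr ?ltW//.
    by field; rewrite gt_eqF.
exists (l *: p0), E; split => //.
- by rewrite [height _]mxE -/(height _) mulr_gt0// p0h.
- by move=> s; have [] := EV s.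
- by rewrite -scalemxAl p0E scaler0.
- move=> x; split=> [/VE[a [s ->]]|[a [s ->]]].
    by exists (a / l), s; rewrite scalerA divfK// gt_eqF.
  by apply/VE; exists (a * l), s; rewrite scalerA.
Qed.

End model_frames.

Section frame_algebra.
Context {R : realType} {n m : nat}.
Variables (c : model) (V : {vspace 'rV[R]_n.+1}).
Variables (p : 'rV[R]_n.+1) (E : 'M[R]_(m, n.+1)).
Hypothesis fr : model_frame c V p E.

Local Notation g := (@ambient_metric R c n).

(** The metric differs from the identity by a multiple of the projection to [o], which the
    horizontal rows of [E] do not see. *)
Lemma ambient_metricE : g =
  1%:M - (if c is hyperbolic then 2 else 0) *: ((origin n)^T *m origin n).
Proof.
case: (c); rewrite /ambient_metric; last 2 first.
- by rewrite scale0r subr0.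
- by rewrite scale0r subr0.
apply/matrixP => i j; rewrite !mxE big_ord1 !mxE eqxx /=.
have [<-|iN] := eqVneq i j; rewrite ?mulr0n ?mulr1n.
  by case: (i == ord_max); rewrite ?mulr1 ?mulr0 ?subr0//=; ring.
have [ii|_] := eqVneq i ord_max; rewrite /= ?mul0r ?mulr0 ?subr0//.
by rewrite -ii [j == i]eq_sym (negbTE iN) !mulr0 subr0.
Qed.

Lemma frame_Eo : E *m (origin n)^T = 0.
Proof.
apply/matrixP => i j; rewrite (ord1 j) [RHS]mxE.
have := frame_Eh fr (delta_mx ord0 i); rewrite -rowE -dot_origin /dot -row_mul mxE.
exact.
Qed.

Lemma frame_Eg : E *m g = E.
Proof.
rewrite ambient_metricE mulmxBr mulmx1 -scalemxAr mulmxA frame_Eo mul0mx scaler0.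
by rewrite subr0.
Qed.

Lemma frame_EgE : E *m g *m E^T = 1%:M.
Proof. by rewrite frame_Eg (frame_EE fr). Qed.

Lemma frame_Ep : E *m p^T = 0.
Proof. by rewrite -[LHS]trmxK trmx_mul trmxK (frame_pE fr) trmx0. Qed.

Lemma frame_Egp : E *m g *m p^T = 0.
Proof. by rewrite frame_Eg frame_Ep. Qed.

Lemma frame_pgE : p *m g *m E^T = 0.
Proof.
rewrite ambient_metricE mulmxBr mulmx1 -scalemxAr mulmxBl (frame_pE fr) sub0r.
have oE : origin n *m E^T = 0.
  by rewrite -[LHS]trmxK trmx_mul trmxK frame_Eo trmx0.
by rewrite -scalemxAl -!mulmxA oE !mulmx0 scaler0 oppr0.
Qed.

Lemma frame_free a s : a *: p + s *m E = 0 -> a = 0 /\ s = 0.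
Proof.
move=> h; have a0 : a = 0.
  have : height (a *: p + s *m E) = 0 by rewrite h /height mxE.
  rewrite [LHS]mxE -[X in _ + X]/(height _) (frame_Eh fr) addr0 mxE => /eqP.
  by rewrite mulf_eq0 => /orP[/eqP//|]; rewrite gt_eqF// (frame_height fr).
split=> //; move: h; rewrite a0 scale0r add0r => /(congr1 (mulmx^~ E^T)).
by rewrite mul0mx -mulmxA (frame_EE fr) mulmx1.
Qed.

Lemma height_frame a s : height (a *: p + s *m E) = a * height p.
Proof. by rewrite [LHS]mxE -[X in _ + X]/(height _) (frame_Eh fr) addr0 mxE. Qed.

Lemma hdot_frame a s :
  hdot (a *: p + s *m E) (a *: p + s *m E) = a ^+ 2 * hdot p p + dot s s.
Proof.
rewrite /hdot height_frame !(dotDl, dotDr, dotZl, dotZr).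
have pE0 : dot p (s *m E) = 0.
  by rewrite /dot trmx_mul mulmxA (frame_pE fr) mul0mx mxE.
have -> : dot (s *m E) (s *m E) = dot s s.
  by rewrite /dot trmx_mul mulmxA -(mulmxA s) (frame_EE fr) mulmx1.
by rewrite (dotC (s *m E)) pE0; ring.
Qed.

End frame_algebra.

(** * Polar coordinates on a plane *)

Section plane_polar_frame.
Context {R : realType} {n m : nat}.
Variables (c : model) (V : {vspace 'rV[R]_n.+1}).
Variables (p : 'rV[R]_n.+1) (E : 'M[R]_(m.+1, n.+1)).
Hypothesis fr : model_frame c V p E.
Variable d : R.
Hypotheses (d0 : 0 <= d) (dh : in_half c d).
Hypotheses (cd : c_ c d = height p) (sd : hdot p p = s_ c d ^+ 2).
Variable e : R.
Hypothesis he : e = 1 \/ c = spherical /\ e = -1.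

(* [C(t)/C(d) p + W(t)/C(d) u], for a unit vector [u] of the plane orthogonal to
   its nearest point [p], is the point at distance [t] from the origin in direction
   [u]; here [S = s_ c], [C = c_ c] and [W^2 = S(t)^2 - S(d)^2]. *)
Definition planeW t : R := Num.sqrt (s_ c t ^+ 2 - s_ c d ^+ 2).
Definition planeX t : R := e * (c_ c t / c_ c d).
Definition planeY t : R := planeW t / c_ c d.
Definition planeX' t : R := e * (- (curvature c * s_ c t) / c_ c d).
Definition planeY' t : R := s_ c t * c_ c t / (planeW t * c_ c d).
Definition plane_rho t : R := s_ c t / planeW t.
Definition plane_radii : set R := [set t | d < t /\ in_half c t].

Let e2 : e ^+ 2 = 1.
Proof. by case: he => [->|[_ ->]]; rewrite ?sqrrN expr1n. Qed.

Let cd0 : 0 < c_ c d. Proof. exact: c_gt0. Qed.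

Lemma planeW2_gt0 t : plane_radii t -> 0 < s_ c t ^+ 2 - s_ c d ^+ 2.
Proof.
move=> [dt th]; have st := s_lt d0 dt th.
by have sd0 := s_ge0 d0 (in_halfW dh); rewrite subr_gt0 ltrXn2r.
Qed.

Lemma planeW_gt0 t : plane_radii t -> 0 < planeW t.
Proof. by move=> /planeW2_gt0; rewrite sqrtr_gt0. Qed.

Lemma planeW_sqr t : plane_radii t -> planeW t ^+ 2 = s_ c t ^+ 2 - s_ c d ^+ 2.
Proof. by move=> /planeW2_gt0/ltW h; rewrite sqr_sqrtr. Qed.

Lemma plane_s_gt0 t : plane_radii t -> 0 < s_ c t.
Proof.
by move=> [dt th]; apply: s_gt0 (in_halfW th); exact: le_lt_trans dt.
Qed.

Lemma height_plane t s : height (planeX t *: p + planeY t *: (s *m E)) = e * c_ c t.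
Proof.
rewrite scalemxAl (height_frame fr) -cd /planeX -mulrA divfK//.
by rewrite gt_eqF.
Qed.

Lemma hdot_plane t s : plane_radii t -> dot s s = 1 ->
  hdot (planeX t *: p + planeY t *: (s *m E)) (planeX t *: p + planeY t *: (s *m E)) =
  s_ c t ^+ 2.
Proof.
move=> It s1; rewrite scalemxAl (hdot_frame fr) sd dotZ s1 mulr1 /planeX /planeY.
rewrite exprMn e2 mul1r !exprMn planeW_sqr// exprVn.
have := c2s2 c t; have := c2s2 c d; have := lt0r_neq0 cd0.
move: (c_ c t) (c_ c d) (s_ c t) (s_ c d) (curvature c) => x y u v k y0 h1 h2.
(* The expression modulo the relations [C^2 + kappa S^2 = 1] at [t] and at [d]. *)
transitivity ((u ^+ 2 * y ^+ 2 + (x ^+ 2 + k * u ^+ 2 - 1) * v ^+ 2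
   - (y ^+ 2 + k * v ^+ 2 - 1) * u ^+ 2) / y ^+ 2); first by field.
by rewrite h1 h2 !subrr !mul0r addr0 subr0 mulfK// sqrf_eq0.
Qed.

Let is_derive_W t : plane_radii t -> is_derive t 1 planeW (s_ c t * c_ c t / planeW t).
Proof.
move=> It; have ds := is_derive_s c t.
have H := is_deriveB (is_deriveM ds ds) (is_derive_cst (s_ c d ^+ 2) t 1).
have K := @is_derive1_comp R Num.sqrt _ t _ _ (is_derive1_sqrt (planeW2_gt0 It)) H.
apply: (is_derive_eq K); rewrite -/(planeW t).
transitivity ((2 * planeW t)^-1 * ((s_ c t * c_ c t + s_ c t * c_ c t) - 0)); first by [].
by field; rewrite gt_eqF// planeW_gt0.
Qed.

(** [e = 1] is the sheet around [p], and [e = -1] the congruent sheet around [- p] on the sphere. *)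
Lemma plane_polar_frame :
  polar_frame (ambient_metric c n) [set x | Defs.space c n x /\ x \in V]
    p E planeX planeY planeX' planeY' plane_rho plane_radii.
Proof.
have cdN0 := lt0r_neq0 cd0.
split.
- rewrite /plane_radii; have [cs|cN] := pselect (c = spherical).
    rewrite (_ : [set t | _] = `]d, (pi / 2)[%classic); first exact: interval_open.
    apply/seteqP; split=> t /=; rewrite in_itv /=; first by move=> [-> /(_ cs)].
    by move=> /andP[dt th]; split.
  rewrite (_ : [set t | _] = `]d, +oo[%classic); first exact: interval_open.
  by apply/seteqP; split=> t /=; rewrite in_itv /= andbT; [case|split].
- move=> t _.
  have H := is_deriveM (is_derive_cst e t 1)
    (is_deriveM (is_derive_c c t) (is_derive_cst (c_ c d)^-1 t 1)).
  apply: (is_derive_eq H); rewrite /planeX' !scaler0 add0r addr0.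
  by congr (_ * _); exact: mulrC.
- move=> t It.
  have H := is_deriveM (is_derive_W It) (is_derive_cst (c_ c d)^-1 t 1).
  apply: (is_derive_eq H); rewrite /planeY' scaler0 add0r.
  transitivity ((c_ c d)^-1 * (s_ c t * c_ c t / planeW t)); first by [].
  by field; rewrite cdN0 gt_eqF// planeW_gt0.
- move=> t _; apply: cvgM; first exact: cvg_cst.
  apply: cvgM; last exact: cvg_cst.
  by apply: cvgN; apply: cvgM; [exact: cvg_cst|exact: continuous_s].
- move=> t It; have Wt := planeW_gt0 It.
  have cW : {for t, continuous planeW}.
    apply: differentiable_continuous; apply/derivable1_diffP.
    by have [] := is_derive_W It.
  apply: cvgM; first by apply: cvgM; [exact: (@continuous_s R c t)|exact: (@continuous_c R c t)].
  apply: cvgV; first by rewrite mulf_neq0// gt_eqF.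
  by apply: cvgM => //; exact: cvg_cst.
- by move=> t It; rewrite divr_gt0// planeW_gt0.
- by move=> t It; rewrite divr_gt0 ?planeW_gt0 ?plane_s_gt0.
- move=> t It; rewrite form_ambient sd -cd /planeX' /planeY' /plane_rho.
  have W0 := lt0r_neq0 (planeW_gt0 It).
  (* The bracket is the ambient form at [p]. It equals [kappa] when [kappa = 1] or [-1], and the
     factor [kappa^2] kills it in the flat case. *)
  have kk : curvature c ^+ 2 * (s_ c d ^+ 2 + (if c is hyperbolic then -1 else 1) *
      (c_ c d * c_ c d)) = curvature c :> R.
    have := c2s2 c d; move: (c_ c d) (s_ c d) => y v.
    case: (c) => /= h.
    + by transitivity (- (y ^+ 2 + -1 * v ^+ 2)); [ring|rewrite h].
    + by rewrite expr0n mul0r.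
    + by transitivity (y ^+ 2 + 1 * v ^+ 2); [ring|rewrite h].
  transitivity (e ^+ 2 * (s_ c t / c_ c d) ^+ 2 * (curvature c ^+ 2 *
    (s_ c d ^+ 2 + (if c is hyperbolic then -1 else 1) * (c_ c d * c_ c d))) +
    (s_ c t * c_ c t) ^+ 2 / (planeW t ^+ 2 * c_ c d ^+ 2)).
    by field; rewrite W0 cdN0.
  rewrite kk e2 mul1r.
  transitivity ((s_ c t) ^+ 2 / (c_ c d ^+ 2 * planeW t ^+ 2) *
    (curvature c * planeW t ^+ 2 + c_ c t ^+ 2)); first by field; rewrite W0 cdN0.
  have -> : curvature c * planeW t ^+ 2 + c_ c t ^+ 2 = c_ c d ^+ 2.
    by rewrite planeW_sqr//; have := c2s2 c d; have := c2s2 c t; lra.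
  by field; rewrite W0 cdN0.
- exact: frame_EgE fr.
- by move=> t _; rewrite (frame_pgE fr) scaler0.
- by move=> t _; rewrite (frame_Egp fr) scaler0.
(* Injectivity is read on [Y], since [X] is constant in the flat case. *)
- move=> t t' It It' _ /(mulIf (invr_neq0 cdN0)) hW.
  have : s_ c t ^+ 2 = s_ c t' ^+ 2.
    by have := planeW_sqr It; rewrite hW planeW_sqr//; lra.
  move/eqP; rewrite eqrXn2 ?ltW ?plane_s_gt0// => /eqP.
  case: It It' => [dt th] [dt' th'].
  by apply: s_inj => //; apply: le_trans d0 (ltW _).
- exact: frame_free fr.
- move=> t s It s1; split; last first.
    by apply/(frame_mem fr); exists (planeX t), (planeY t *: s); rewrite scalemxAl.
  have hd := hdot_plane It s1; have hh := height_plane t s.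
  case: (he) => [e1|[cs e1]].
    by apply: (@space_of_hdot _ _ c _ t) => //; rewrite hh e1 mul1r.
  have sc := c2s2 c t; move: hd hh sc; rewrite cs => hd hh sc.
  by apply/spaceE; rewrite hd hh e1 mulN1r sqrrN; move: sc => /=; lra.
Qed.

End plane_polar_frame.

(* The polar parametrization misses the nearest point [p]; that it carries no mass
   is seen in this chart around it. *)
Section graph_chart.
Context {R : realType} {n m : nat}.
Variables (c : model) (V : {vspace 'rV[R]_n.+1}).
Variables (p : 'rV[R]_n.+1) (E : 'M[R]_(m.+1, n.+1)).
Hypothesis fr : model_frame c V p E.
Variable e : R.
Hypothesis he : e = 1 \/ c = spherical /\ e = -1.

Local Notation xi := [set x | Defs.space c n x /\ x \in V].
Let k : R := curvature c.
Let U : set 'rV[R]_m.+1 := [set q | 0 < 1 - k * dot q q].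
(** [r^2 + k |q|^2 = 1] is the condition under which [phi q] lies in the space. *)
Let r (q : 'rV[R]_m.+1) := Num.sqrt (1 - k * dot q q).
Let phi (q : 'rV[R]_m.+1) : 'rV[R]_n.+1 := r q *: (e *: p) + q *m E.
Let J (q : 'rV[R]_m.+1) : 'M[R]_(m.+1, n.+1) :=
  E - (k / r q) *: (q^T *m (e *: p)).

Let e2 : e ^+ 2 = 1.
Proof. by case: he => [->|[_ ->]]; rewrite ?sqrrN expr1n. Qed.

Let is_diff_in (q : 'rV[R]_m.+1) : is_diff q (fun q : 'rV[R]_m.+1 => 1 - k * dot q q) (fun v => - (k * (2 * dot v q))).
Proof.
have H := is_diffB (is_diff_cst (1 : R) q) (is_diffZ k (is_diff_dot q)).
by apply: (is_diff_eq H); apply/funext => v; exact: sub0r.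
Qed.

Let r_gt0 q : U q -> 0 < r q. Proof. by rewrite /U /= /r sqrtr_gt0. Qed.

Let is_diff_r q : U q -> is_diff q r (fun v => - (k * dot v q) / r q).
Proof.
move=> Uq; have H := is_diff_comp (is_diff_in q) (is_diff_derive (is_derive1_sqrt Uq)).
apply: (is_diff_eq H); apply/funext => v /=; rewrite -/(r q).
by field; rewrite gt_eqF// r_gt0.
Qed.

Let is_diff_phi q : U q -> is_diff q phi (mulmx^~ (J q)).
Proof.
move=> Uq; have H := is_diffD
  (is_diff_scale (is_diff_r Uq) (is_diff_cst (e *: p) q))
  (is_diff_mulmxr E (is_diff_id q)).
apply: (is_diff_eq H); apply/funext => v.
rewrite /J mulmxBr -scalemxAr mulmxA mulmx_dot mul_scalar_mx scalerA.
transitivity (r q *: 0 + (- (k * dot v q) / r q) *: (e *: p) + v *m E); first by [].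
have -> : - (k * dot v q) / r q = - (k / r q * dot v q) by rewrite !mulNr mulrAC.
by rewrite scaler0 add0r addrC scaleNr.
Qed.

Let openU : open U.
Proof.
have c1 : continuous (fun q : 'rV[R]_m.+1 => 1 - k * dot q q).
  by move=> q; apply: differentiable_continuous; have [] := is_diff_in q.
have -> : U = (fun q : 'rV[R]_m.+1 => 1 - k * dot q q) @^-1` [set x | 0 < x] by [].
by move/continuousP : c1; apply; exact: open_gt.
Qed.

Let ctsJ q : U q -> {for q, continuous J}.
Proof.
move=> Uq; have rq := r_gt0 Uq.
have cr : {for q, continuous r}.
  by apply: differentiable_continuous; have [] := is_diff_r Uq.
have crV : {for q, continuous (fun q => (r q)^-1)}.
  by apply: continuousV => //; rewrite gt_eqF.
have cq i : {for q, continuous (fun q : 'rV[R]_m.+1 => q ord0 i)}.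
  exact: coord_continuous.
apply: (@mx_continuousP _ _ _ _ J q) => i j.
have := continuousB (@cst_continuous _ _ (E i j) q)
  (continuousM (continuousM (@cst_continuous _ _ k q) crV)
     (continuousM (cq i) (@cst_continuous _ _ ((e *: p) ord0 j) q))).
apply: eq_continuous_at; apply/funext => w.
rewrite [RHS]mxE; congr (_ + _).
by rewrite [RHS]mxE [X in _ = - X]mxE [X in _ = - (_ * X)]mxE big_ord1 [w^T _ _]mxE.
Qed.

Let phi_in q : U q -> xi (phi q).
Proof.
move=> Uq; have r2 : r q ^+ 2 = 1 - k * dot q q by rewrite sqr_sqrtr// ltW.
have rp := r_gt0 Uq; rewrite /phi scalerA; split; last first.
  by apply/(frame_mem fr); exists (r q * e), q.
have /spaceE := frame_space fr.
have hh := height_frame fr (r q * e) q; have hd := hdot_frame fr (r q * e) q.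
have h0 := frame_height fr.
move: r2; rewrite /k; case: he => [e1|[cs e1]].
  rewrite e1 mulr1 in hh hd *.
  move=> r2 pE; apply/spaceE; rewrite hh hd.
  case: (c) r2 pE => /=.
  - move=> r2 [pE _]; split; last by rewrite mulr_gt0.
    by rewrite pE exprMn; lra.
  - rewrite mul0r subr0 => r2 ->; rewrite mulr1; nra.
  - by move=> r2 pE; rewrite pE exprMn; lra.
rewrite cs in hh hd *; rewrite e1 mulrN1 in hh hd *.
move=> r2 pE; apply/spaceE; rewrite hh hd pE.
by rewrite mulNr !sqrrN exprMn; move: r2 => /=; lra.
Qed.

Lemma graph_parametrization : parametrization xi U phi.
Proof.
have eN0 : e != 0 by apply/eqP => e0; move: e2; rewrite e0 expr0n /= => /esym/eqP; rewrite oner_eq0.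
split; first exact: openU.
- move=> q q' _ _; rewrite /phi => h.
  suff [_ /eqP] : (r q - r q') * e = 0 /\ q - q' = 0 by rewrite subr_eq0 => /eqP.
  apply: (frame_free fr); rewrite -scalerA scalerBl mulmxBl addrACA -opprD.
  by rewrite h subrr.
- by move=> _ [q Uq <-]; exact: phi_in.
- move=> q Uq; have [dphi JE] := jacobianE (is_diff_phi Uq); split=> //.
  + have nJ : {near q, J =1 jacobian phi}.
      have : nbhs q U by apply: open_nbhs_nbhs; split=> //; exact: openU.
      by apply: filterS => w Uw; rewrite (jacobianE (is_diff_phi Uw)).2.
    have h : J w @[w --> q] --> jacobian phi q by rewrite JE; exact: ctsJ.
    exact: (cvg_trans (near_eq_cvg nJ) h).
  + rewrite JE; apply: inj_row_free => v vJ.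
    apply: (@frame_free _ _ _ c V p E fr (- (k / r q * dot v q) * e) v _).2.
    rewrite -vJ /J mulmxBr -scalemxAr mulmxA mulmx_dot mul_scalar_mx !scalerA.
    by rewrite addrC mulNr scaleNr.
Qed.

(** The point is the image of [q = 0] alone, and a point is Lebesgue-null since it lies in a
    coordinate slice; this uses that [xi] has dimension [m.+1]. *)
Lemma frame_point_null (mu : {measure set 'rV[R]_n.+1 -> \bar R}) :
  is_riemannian_measure (ambient_metric c n) xi m.+1 mu ->
  mu [set e *: p] = 0%E.
Proof.
move=> hmu.
have U0 : U 0 by rewrite /U /= dotE big1 ?mulr0 ?subr0// => i _; rewrite mxE mul0r.
have phi0 : phi 0 = e *: p.
  rewrite /phi mul0mx addr0 /r dotE big1 ?mulr0 ?subr0 ?sqrtr1 ?scale1r// => i _.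
  by rewrite mxE mul0r.
have [_ inj _ _] := graph_parametrization.
have -> : [set e *: p] = [set e *: p] `&` phi @` U.
  by apply/seteqP; split => [x ->|x []//]; split=> //; exists 0.
rewrite (hmu.2 _ _ graph_parametrization _ (measurable_set1_rV _)).
have -> : U `&` phi @^-1` [set e *: p] = [set 0].
  apply/seteqP; split => [w [Uw /= wE]|w ->//].
  by apply: inj; rewrite ?inE// wE phi0.
have m0 := measurable_set1_rV (0 : 'rV[R]_m.+1).
have null : lebesgue_rV m.+1 [set (0 : 'rV[R]_m.+1)] = 0%E.
  apply/eqP; rewrite eq_le measure_ge0 andbT -(@lebesgue_rVS_slice R m 0).
  apply: le_measure; rewrite ?inE//; last by move=> w ->; rewrite /= mxE.
  rewrite -[X in measurable X]setTI.
  exact: (@measurable_coord R m.+1 ord0 measurableT [set (0 : R)] (measurable_set1 (0 : R))).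
rewrite (eq_integral (cst (volume_density (ambient_metric c n) phi 0)%:E)); last first.
  by move=> w /set_mem ->.
by rewrite integral_cst// [X in (_ * X)%E]null mule0.
Qed.

End graph_chart.

(** * Negligible and measurable parts of a plane *)

Section equator.
Context {R : realType} {n m : nat}.
Variables (V : {vspace 'rV[R]_n.+1}).
Variables (p : 'rV[R]_n.+1) (E : 'M[R]_(m.+1, n.+1)).
Hypothesis fr : model_frame spherical V p E.
Local Notation xi := [set x | Defs.space spherical n x /\ x \in V].

Let pp : hdot p p = 1 - height p ^+ 2.
Proof. by have /spaceE := frame_space fr. Qed.

(** Here [t] is the angle from [p], not from the origin. In these coordinates the points of [xi] of
    height [0] are those of the single radius [t = pi / 2]. *)
Lemma equator_polar_frame :
  polar_frame (ambient_metric spherical n) xi p E cos sin (fun t => - sin t) cos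
    (fun=> 1) `]0, pi[%classic.
Proof.
split.
- exact: interval_open.
- by move=> t _; exact: is_derive_cos.
- by move=> t _; exact: is_derive_sin.
- by move=> t _; apply: cvgN; exact: continuous_sin.
- by move=> t _; exact: continuous_cos.
- by move=> t; rewrite /= in_itv /=; exact: sin_gt0_pi.
- by move=> t _; rewrite ltr01.
- move=> t _; rewrite form_ambient pp mul1r sqrrN -expr2 subrK mulr1 expr1n.
  by rewrite addrC cos2Dsin2.
- exact: frame_EgE fr.
- by move=> t _; rewrite (frame_pgE fr) scaler0.
- by move=> t _; rewrite (frame_Egp fr) scaler0.
- move=> t t'; rewrite /= !in_itv /= => /andP[t0 t1] /andP[t'0 t'1] tt' _.
  by apply: cos_inj tt'; rewrite in_itv /= !ltW.
- exact: frame_free fr.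
- move=> t s _ s1; split; last by apply/(frame_mem fr); exists (cos t), (sin t *: s); rewrite scalemxAl.
  apply/spaceE; rewrite scalemxAl (height_frame fr) (hdot_frame fr) dotZ s1 pp mulr1.
  by rewrite exprMn; have := cos2Dsin2 t; lra.
Qed.

Lemma measurable_height : measurable_fun setT (@height R n).
Proof. exact: measurable_coord. Qed.

Lemma measurable_hdot : measurable_fun setT (fun x : 'rV[R]_n.+1 => hdot x x).
Proof.
apply: measurable_funB.
  exact: (measurable_dot (@measurable_id _ _ setT) (@measurable_id _ _ setT)).
by apply: measurable_funM; exact: measurable_height.
Qed.

End equator.

Section measurable_model.
Context {R : realType} {n : nat}.

Lemma measurable_preimage_setT d d' (T : measurableType d) (T' : measurableType d')
    (f : T -> T') (B : set T') :
  measurable_fun setT f -> measurable B -> measurable (f @^-1` B).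
Proof. by move=> mf mB; rewrite -[X in measurable X]setTI; exact: mf. Qed.

Lemma measurable_space (c : model) : measurable (Defs.space c n : set 'rV[R]_n.+1).
Proof.
have mh := @measurable_height R n; have md := @measurable_hdot R n.
have mh2 := measurable_funM mh mh.
case: c.
- rewrite (_ : Defs.space hyperbolic n =
    (fun x : 'rV[R]_n.+1 => hdot x x - height x * height x) @^-1` [set -1] `&`
    (fun x => 0 < height x) @^-1` [set true]); last first.
    apply/seteqP; split => x.
      by move=> /spaceE[h1 h2]; split=> //=; rewrite h1; ring.
    move=> [h1 h2]; apply/spaceE; move: h1 h2 => /= h1 h2.
    by split=> //; lra.
  apply: measurableI; apply: measurable_preimage_setT => //.
    exact: measurable_funB.
  exact: measurable_fun_ltr.
- rewrite (_ : Defs.space euclidean n = @height R n @^-1` [set 1]); last first.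
    by apply/seteqP; split => x; [move=> /spaceE|move=> h; apply/spaceE].
  exact: measurable_preimage_setT.
- rewrite (_ : Defs.space spherical n =
    (fun x : 'rV[R]_n.+1 => hdot x x + height x * height x) @^-1` [set 1]); last first.
    apply/seteqP; split => x.
      by move=> /spaceE h1; rewrite /= h1; ring.
    by move=> h1; apply/spaceE; move: h1 => /=; lra.
  apply: measurable_preimage_setT => //; exact: measurable_funD.
Qed.

End measurable_model.

Section plane.
Context {R : realType} {n m : nat}.
Variables (c : model) (V : {vspace 'rV[R]_n.+1}).
Variables (p : 'rV[R]_n.+1) (E : 'M[R]_(m, n.+1)).
Hypothesis fr : model_frame c V p E.

Lemma measurable_plane_coordinate (i : 'I_m) :
  measurable_fun setT (fun x : 'rV[R]_n.+1 => (x *m E^T) ord0 i).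
Proof.
under eq_fun do rewrite mxE; apply: measurable_sum => j.
by apply: measurable_funM => //; exact: measurable_coord.
Qed.

(** Membership in [V] is the vanishing of [x - q x], where [q] is the projection to [V] computed
    from the height and the coordinates along [E]. *)
Lemma measurable_plane : measurable [set x : 'rV[R]_n.+1 | Defs.space c n x /\ x \in V].
Proof.
apply: measurableI; first exact: measurable_space.
pose q (x : 'rV[R]_n.+1) : 'rV[R]_n.+1 := (height x / height p) *: p + x *m E^T *m E.
have mq : measurable_fun setT (fun x : 'rV[R]_n.+1 => x - q x).
  apply: measurable_fun_rVP => i.
  rewrite (_ : (fun x => _) = (fun x : 'rV[R]_n.+1 => x ord0 i - (height x / height p * p ord0 i +
    \sum_j (x *m E^T) ord0 j * E j i))); last by apply/funext => x; rewrite !mxE.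
  apply: measurable_funB; first exact: measurable_coord.
  apply: measurable_funD.
    apply: measurable_funM => //; apply: measurable_funM => //.
    exact: measurable_height.
  apply: measurable_sum => j; apply: measurable_funM => //.
  exact: measurable_plane_coordinate.
rewrite [X in measurable X](_ : _ = (fun x : 'rV[R]_n.+1 => x - q x) @^-1` [set 0]).
  apply: measurable_preimage_setT => //; exact: measurable_set1_rV.
have h0 := lt0r_neq0 (frame_height fr).
apply/seteqP; split => x /=.
  move=> /(frame_mem fr)[a [s ->]]; rewrite /q (height_frame fr) mulfK//.
  rewrite mulmxDl -scalemxAl (frame_pE fr) scaler0 add0r -(mulmxA s) (frame_EE fr) mulmx1.
  by rewrite subrr.
move/eqP; rewrite subr_eq0 => /eqP ->; apply/(frame_mem fr).
by exists (height x / height p), (x *m E^T).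
Qed.

End plane.

(** In the polar coordinates around [p] the set has a single radius, so its radial integral is over
    one point. *)
Lemma equator_null (R : realType) n m (V : {vspace 'rV[R]_n.+1}) p
    (E : 'M[R]_(m.+1, n.+1)) (mu : {measure set 'rV[R]_n.+1 -> \bar R}) :
  model_frame spherical V p E ->
  is_riemannian_measure (ambient_metric spherical n)
    [set x | Defs.space spherical n x /\ x \in V] m.+1 mu ->
  mu [set x | (Defs.space spherical n x /\ x \in V) /\ height x = 0] = 0%E.
Proof.
move=> fr hmu; have h0 := frame_height fr.
have pi0 := pi_gt0 R.
have := polar_measure (equator_polar_frame fr) hmu (A := [set pi / 2])
  (B := [set x | (Defs.space spherical n x /\ x \in V) /\ height x = 0])
  (l := fun x => (x *m E^T) ord0 ord0).
rewrite integral_set1 mul0e; apply.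
- exact: measurable_set1.
- by move=> t ->; rewrite /= in_itv /=; apply/andP; split; lra.
- apply: measurableI; first exact: measurable_plane fr.
  exact: (measurable_preimage_setT (@measurable_height R n) (measurable_set1 0)).
- exact: measurable_plane_coordinate.
- apply: measurable_funTS; apply: measurable_funM => //.
  exact: (measurable_funX m (continuous_measurable_fun (@continuous_sin R))).
- move=> t s It s1; have hin := polar_in (equator_polar_frame fr) It s1.
  rewrite /= scalemxAl (height_frame fr); split.
    move=> [_ /eqP]; rewrite mulf_eq0 [height _ == 0]gt_eqF// orbF => /eqP ct.
    move: It; rewrite /= in_itv /= => /andP[t0 t1].
    by apply: cos_inj; rewrite ?in_itv/= ?ltW ?cos_pihalf//; lra.
  move=> tE; split; last by rewrite tE cos_pihalf mul0r.
  by rewrite -scalemxAl.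
- move=> t s; rewrite /= in_itv /= => It s1.
  rewrite mulmxDl -!scalemxAl (frame_pE fr) scaler0 add0r -mulmxA (frame_EE fr) mulmx1.
  by rewrite mxE pmulr_rlt0// sin_gt0_pi.
- move=> x [[sx xV] hx]; have [a [s xE]] := (frame_mem fr x).1 xV.
  have a0 : a = 0.
    move: hx; rewrite xE (height_frame fr) => /eqP.
    by rewrite mulf_eq0 [height _ == 0]gt_eqF// orbF => /eqP.
  exists (pi / 2), s; split.
  + by rewrite /= in_itv /=; apply/andP; split; lra.
  + have /spaceE := sx; rewrite hx expr0n subr0 xE (hdot_frame fr) a0 => <-.
    by rewrite expr0n mul0r add0r.
  + by rewrite cos_pihalf sin_pihalf scale1r xE a0.
Qed.

(** * The radius as a measurable function, and its law on a plane *)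

Section radius.
Context {R : realType} {n : nat}.
Implicit Types (c : model) (x : 'rV[R]_n.+1) (t : R).

(* The distance to the origin (to its closest copy on the sphere), written with
   total measurable functions: [x `^ 2^-1] is the square root. *)
Definition radius c x : R :=
  match c with
  | hyperbolic => ln (hdot x x `^ 2^-1 + (hdot x x + 1) `^ 2^-1)
  | euclidean => hdot x x `^ 2^-1
  | spherical => atan (hdot x x `^ 2^-1 * (height x ^+ 2) `^ (- 2^-1))
  end.

Lemma measurable_radius c : measurable_fun setT (radius c).
Proof.
have mh := @measurable_height R n; have md := @measurable_hdot R n.
have mr := measurableT_comp (measurable_powR 2^-1) md.
case: c => //=.
- apply: measurableT_comp (@measurable_ln R) _; apply: measurable_funD => //.
  apply: measurableT_comp (measurable_powR 2^-1) _; exact: measurable_funD.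
- apply: measurableT_comp (continuous_measurable_fun (@continuous_atan R)) _.
  apply: measurable_funM => //; apply: measurableT_comp (measurable_powR (- 2^-1)) _.
  exact: measurable_funX.
Qed.

Lemma radiusE c x t : 0 <= t -> in_half c t -> hdot x x = s_ c t ^+ 2 ->
  (c = spherical -> c_ c t = `|height x|) -> radius c x = t.
Proof.
move=> t0 th sE cE; have s0 := s_ge0 t0 (in_halfW th).
have root (a : R) : 0 <= a -> (a ^+ 2) `^ 2^-1 = a.
  by move=> a0; rewrite powR12_sqrt ?sqr_ge0// sqrtr_sqr ger0_norm.
case: c th sE cE s0 => th sE cE s0; rewrite /radius sE root//.
- have -> : s_ hyperbolic t ^+ 2 + 1 = c_ hyperbolic t ^+ 2 :> R.
    have : c_ hyperbolic t ^+ 2 + -1 * s_ hyperbolic t ^+ 2 = 1 := c2s2 hyperbolic t.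
    by move: (c_ _ _) (s_ _ _) => x' y'; lra.
  rewrite root; last by rewrite ltW// c_gt0.
  rewrite (_ : _ + _ = expR t) ?expRK//=; by field.
- have c0 : 0 < cos t by exact: (c_gt0 t0 th).
  have -> : height x ^+ 2 = cos t ^+ 2.
    by rewrite -[LHS]real_normK ?num_real// -cE.
  rewrite powRN root ?ltW//= tanK// in_itv /=.
  by have := th erefl; have := pi_gt0 R => p0 tp; apply/andP; split; lra.
Qed.

Lemma radius_spec c x : Defs.space c n x -> height x != 0 ->
  exists t, [/\ 0 <= t, in_half c t, hdot x x = s_ c t ^+ 2,
    c_ c t = `|height x| & radius c x = t].
Proof.
move=> sx hx0.
(* On the sphere a point of negative height is replaced by its antipode, which has the same
   [radius]; in the other models heights are positive. *)
pose y := if 0 < height x then x else - x.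
have hN : height (- x) = - height x by rewrite /height mxE.
have dN : hdot (- x) (- x) = hdot x x.
  by rewrite /hdot hN -scaleN1r dotZ; ring.
have [sy [hy dy]] : Defs.space c n y /\ height y = `|height x| /\ hdot y y = hdot x x.
  rewrite /y; case: ltP => h; first by rewrite gtr0_norm.
  rewrite hN dN ler0_norm//; split=> //.
  case: c sx => sx; have := sx => /spaceE.
  - by move=> [_ h']; have := lt_le_trans h' h; rewrite ltxx.
  - by move=> h1; move: h; rewrite h1 ler10.
  - by move=> h1; apply/spaceE; rewrite hN dN sqrrN.
have [t [t0 tpi cE sE]] := space_polar_coordinate sy.
have th : in_half c t.
  move=> cs; rewrite ltNge; apply/negP => tp.
  have : c_ c t <= 0.
    rewrite cs /= -(subrK (pi / 2) t) cosDpihalf oppr_le0; apply: sin_ge0_pi.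
    by have := tpi cs; have := pi_gt0 R => p0 tp'; apply/andP; split; lra.
  by rewrite cE hy normr_le0 (negbTE hx0).
exists t; rewrite -dy -hy; split=> //.
by apply: radiusE => //; [rewrite -dy|move=> _; rewrite -hy].
Qed.

End radius.

Section radius_law.
Context {R : realType} {n m : nat}.
Variables (c : model) (V : {vspace 'rV[R]_n.+1}).
Variables (p : 'rV[R]_n.+1) (E : 'M[R]_(m.+1, n.+1)).
Hypothesis fr : model_frame c V p E.
Variable d : R.
Hypotheses (d0 : 0 <= d) (dh : in_half c d).
Hypotheses (cd : c_ c d = height p) (sd : hdot p p = s_ c d ^+ 2).
Variable e : R.
Hypothesis he : e = 1 \/ c = spherical /\ e = -1.
Variable mu : {measure set 'rV[R]_n.+1 -> \bar R}.
Local Notation xi := [set x | Defs.space c n x /\ x \in V].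
Hypothesis hmu : is_riemannian_measure (ambient_metric c n) xi m.+1 mu.

(** The part of [xi] that the polar parametrization of sign [e] covers. *)
Definition sheet : set 'rV[R]_n.+1 :=
  [set x | xi x /\ 0 < e * height x] `\` [set e *: p].

Definition radial_weight t : R := plane_rho c d t * planeY c d t ^+ m.

Let e2 : e ^+ 2 = 1.
Proof. by case: he => [->|[_ ->]]; rewrite ?sqrrN expr1n. Qed.

Let cd0 : 0 < c_ c d. Proof. exact: c_gt0. Qed.

Lemma measurable_sheet : measurable sheet.
Proof.
apply: measurableD; last exact: measurable_set1_rV.
apply: measurableI; first exact: measurable_plane fr.
have mh : measurable_fun setT (fun x : 'rV[R]_n.+1 => 0 < e * height x).
  apply: measurable_fun_ltr => //; apply: measurable_funM => //.
  exact: measurable_height.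
exact: (measurable_preimage_setT mh (B := [set true])).
Qed.

Lemma measurable_plane_radii : measurable (plane_radii c d).
Proof. exact: open_measurable (polar_openI (plane_polar_frame fr d0 dh cd sd he)). Qed.

Lemma radial_weight_ge0 t : plane_radii c d t -> 0 <= radial_weight t.
Proof.
move=> It; rewrite mulr_ge0 ?exprn_ge0// divr_ge0 ?ltW//.
- exact: plane_s_gt0 It.
- exact: planeW_gt0 It.
- exact: planeW_gt0 It.
Qed.

Lemma measurable_radial_weight : measurable_fun (plane_radii c d) radial_weight.
Proof.
have ms := continuous_measurable_fun (@continuous_s R c).
have mW : measurable_fun setT (planeW c d).
  apply: measurableT_comp (continuous_measurable_fun (@sqrt_continuous R)) _.
  by apply: measurable_funB => //; exact: measurable_funX.
have mg : measurable_fun (plane_radii c d)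
    (fun t => s_ c t * planeW c d t `^ (-1) * (planeW c d t * (c_ c d)^-1) ^+ m).
  apply: measurable_funTS; apply: measurable_funM.
    by apply: measurable_funM => //; exact: measurableT_comp (measurable_powR (-1)) _.
  by apply: measurable_funX; exact: measurable_funM.
apply: eq_measurable_fun mg => t /set_mem It.
by rewrite /radial_weight /plane_rho powR_inv1// ltW// planeW_gt0.
Qed.

Lemma sheet_coordinate x : sheet x ->
  [/\ plane_radii c d (radius c x), c_ c (radius c x) = e * height x,
    hdot x x = s_ c (radius c x) ^+ 2 &
  exists2 s, dot s s = 1 & x = planeX c d e (radius c x) *: p +
     planeY c d (radius c x) *: (s *m E)].
Proof.
move=> [[[sx xV] hx] xp].
have hx0 : height x != 0 by apply: contraTneq hx => ->; rewrite mulr0 ltxx.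
have [t [t0 th sE cE rE]] := radius_spec sx hx0.
have ce : c_ c t = e * height x.
  rewrite cE; case: he hx => [->|[_ ->]]; rewrite ?mul1r ?mulN1r => h.
    by rewrite gtr0_norm.
  by rewrite ltr0_norm// -oppr_gt0.
have [a [s xE]] := (frame_mem fr x).1 xV.
have aE : a = planeX c d e t.
  rewrite /planeX ce xE (height_frame fr) -cd.
  transitivity (e ^+ 2 * a); first by rewrite e2 mul1r.
  by field; rewrite gt_eqF.
(* The coefficient [a] is fixed by the height, so [hdot x x] forces [|s|] to be [planeY], up to the
   positivity shown next. *)
have ss : dot s s = (s_ c t ^+ 2 - s_ c d ^+ 2) / c_ c d ^+ 2.
  have : a ^+ 2 * hdot p p + dot s s = s_ c t ^+ 2 by rewrite -sE xE (hdot_frame fr).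
  rewrite aE /planeX exprMn e2 mul1r exprMn exprVn sd => h.
  have -> : dot s s = s_ c t ^+ 2 - c_ c t ^+ 2 / c_ c d ^+ 2 * s_ c d ^+ 2 by lra.
  have := c2s2 c t; have := c2s2 c d; have := lt0r_neq0 cd0.
  move: (c_ c t) (c_ c d) (s_ c t) (s_ c d) (curvature c) => x' y' u v k y0 h1 h2.
  apply/eqP; rewrite -subr_eq0; apply/eqP.
  transitivity (((y' ^+ 2 + k * v ^+ 2 - 1) * u ^+ 2 - (x' ^+ 2 + k * u ^+ 2 - 1) * v ^+ 2)
    / y' ^+ 2); first by field.
  by rewrite h1 h2 subrr !mul0r subrr mul0r.
have st0 := s_ge0 t0 (in_halfW th); have sd0 := s_ge0 d0 (in_halfW dh).
(* [s = 0] would give [t = d] and [x = e p], the point removed from the sheet. Positivity of [|s|^2]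
   then yields [d < t]. *)
have sN0 : dot s s != 0.
  apply/eqP => /dot_eq0 s0; apply: xp; rewrite /= xE s0 mul0mx addr0 aE /planeX.
  have : dot s s = 0 by rewrite s0 dotE big1// => i _; rewrite mxE mul0r.
  rewrite ss => /eqP; rewrite mulf_eq0 invr_eq0 sqrf_eq0 (negbTE (lt0r_neq0 cd0)) orbF.
  rewrite subr_eq0 eqrXn2// => /eqP st.
  by rewrite (s_inj t0 d0 th dh st) divff ?mulr1// lt0r_neq0.
have sp : 0 < dot s s by rewrite lt_neqAle eq_sym sN0 dot_ge0.
have It : plane_radii c d t.
  split=> //; rewrite ltNge le_eqVlt; apply/negP => /predU1P[td|td].
    by move: sp; rewrite ss td subrr mul0r ltxx.
  have := s_lt t0 td dh => st; move: sp; rewrite ss pmulr_lgt0 ?invr_gt0 ?exprn_gt0//.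
  by rewrite subr_gt0 ltNge => /negP; apply; apply: lerXn2r; rewrite ?nnegrE// ltW.
rewrite rE; split=> //; exists ((planeY c d t)^-1 *: s).
  rewrite dotZ ss exprVn /planeY expr_div_n (planeW_sqr d0 dh It) mulVf//.
  by rewrite -ss.
have YN0 : planeY c d t != 0.
  by rewrite /planeY mulf_neq0 ?invr_neq0 ?lt0r_neq0// (planeW_gt0 d0 dh It).
by rewrite -scalemxAl scalerA divff// scale1r -aE.
Qed.

Lemma sheet_polar t s : plane_radii c d t -> dot s s = 1 ->
  let x := planeX c d e t *: p + planeY c d t *: (s *m E) in
  sheet x /\ radius c x = t.
Proof.
move=> It s1 x; have fm := plane_polar_frame fr d0 dh cd sd he.
have xin := polar_in fm It s1.
have hx : height x = e * c_ c t by exact: (height_plane fr d0 dh cd e t s).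
have t0 : 0 <= t by case: It => dt _; apply: le_trans d0 (ltW dt).
have th : in_half c t by case: It.
have ct := c_gt0 t0 th.
split; last first.
  apply: radiusE => //; first exact: (hdot_plane fr d0 dh sd he It s1).
  move=> _; rewrite hx; case: he => [->|[_ ->]]; rewrite ?mul1r ?mulN1r ?normrN;
    by rewrite gtr0_norm.
split; first by split=> //; rewrite hx mulrA -expr2 e2 mul1r.
move=> /= xp.
have : (planeX c d e t - e) *: p + (planeY c d t *: s) *m E = 0.
  by rewrite scalerBl -scalemxAl addrAC -/x xp subrr.
move=> /(frame_free fr)[_ /eqP]; rewrite scaler_eq0 => /orP[|/eqP s0].
  by rewrite gt_eqF// (polar_Y_gt0 fm It).
by move: s1; rewrite s0 dotE big1 => [/esym/eqP|i _]; rewrite ?oner_eq0// mxE mul0r.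
Qed.

Lemma radius_law A : measurable A -> A `<=` plane_radii c d ->
  mu (sheet `&` radius c @^-1` A) =
  ((\int[lebesgue_measure]_(t in A) (radial_weight t)%:E) *
   (@cap_area R m false + @cap_area R m true))%E.
Proof.
move=> mA AI; have fm := plane_polar_frame fr d0 dh cd sd he.
apply: (polar_measure fm hmu (l := fun x => (x *m E^T) ord0 ord0)) => //.
- apply: measurableI; first exact: measurable_sheet.
  exact: measurable_preimage_setT (@measurable_radius R n c) mA.
- exact: measurable_plane_coordinate.
- exact: measurable_funS measurable_plane_radii AI measurable_radial_weight.
- move=> t s It s1; have [sh rE] := sheet_polar It s1.
  by split=> [[_]|At]; rewrite /= ?rE//; split=> //=; rewrite rE.
- move=> t s It s1.
  rewrite mulmxDl -!scalemxAl (frame_pE fr) scaler0 add0r -mulmxA (frame_EE fr) mulmx1.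
  by rewrite mxE pmulr_rlt0// (polar_Y_gt0 fm It).
- move=> x [sx _]; have [It _ _ [s s1 xE]] := sheet_coordinate sx.
  by exists (radius c x), s.
Qed.

End radius_law.

(** * The integral formula *)

Section weight.
Context {R : realType} {n m : nat}.
Variables (c : model) (d : R).
Hypotheses (d0 : 0 <= d) (dh : in_half c d).

Lemma dln_s_ratio_planeW t : plane_radii c d t ->
  1 - dln_s_ratio c t d ^+ 2 = (planeW c d t / (s_ c t * c_ c d)) ^+ 2.
Proof.
move=> It; have cd0 := lt0r_neq0 (c_gt0 d0 dh); have st := lt0r_neq0 (plane_s_gt0 d0 It).
rewrite exprMn (planeW_sqr d0 dh It) /dln_s_ratio.
(* The convention that the ratio is [0] at [d = 0] agrees with the formula: there [W(t) = S(t)] and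
   [C(d) = 1]. *)
have [d00|dN0] := eqVneq d 0.
  rewrite d00 s_at0 c_at0 !expr0n /= mulr1 !subr0 exprVn divff// sqrf_eq0.
  by [].
have sd : s_ c d != 0.
  by rewrite gt_eqF// s_gt0// ?(in_halfW dh)// ?lt_neqAle ?d0 ?andbT 1?eq_sym//; exact: in_halfW.
rewrite /dln_s derive1_s.
have := c2s2 c t; have := c2s2 c d; move: cd0 sd st.
move: (c_ c t) (c_ c d) (s_ c t) (s_ c d) (curvature c) => x y u v k y0 v0 u0 h1 h2.
apply/eqP; rewrite -subr_eq0; apply/eqP.
transitivity (((x ^+ 2 + k * u ^+ 2 - 1) * (- v ^+ 2) + (y ^+ 2 + k * v ^+ 2 - 1) * u ^+ 2)
    / (u * y) ^+ 2).
  by field; rewrite y0 v0 u0.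
by rewrite h1 h2 !subrr !mul0r addr0 mul0r.
Qed.

Lemma radial_weightE t : plane_radii c d t ->
  (1 - dln_s_ratio c t d ^+ 2) `^ (m.+1%:R / 2 - 1) * s_ c t ^+ m =
  c_ c d * (plane_rho c d t * planeY c d t ^+ m).
Proof.
move=> It; have cd0 := c_gt0 d0 dh; have st := plane_s_gt0 d0 It.
have Wt := planeW_gt0 d0 dh It.
rewrite dln_s_ratio_planeW//; set b := planeW _ _ _ / _.
have b0 : 0 < b by rewrite divr_gt0// mulr_gt0.
rewrite -[b ^+ 2]powR_mulrn; last exact: ltW.
(* With [k = m.+1] the exponent of [b] is [m - 1], equal to [-1] for [k = 1]; hence the split into
   [b ^+ m] and the inverse of [b], valid as [b > 0]. *)
rewrite -powRrM (_ : 2 * (m.+1%:R / 2 - 1) = m%:R - 1); last first.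
  by rewrite -natr1; field.
rewrite powRD; last by apply/implyP=> _; exact: lt0r_neq0.
rewrite powR_mulrn ?ltW// powR_inv1 ?ltW// mulrAC -exprMn.
rewrite /plane_rho /planeY /b.
have -> : planeW c d t / (s_ c t * c_ c d) * s_ c t = planeW c d t / c_ c d.
  by field; rewrite !gt_eqF.
by field; rewrite ?expf_neq0 ?gt_eqF.
Qed.

End weight.

Section plane_integral.
Context {R : realType} {n m : nat}.
Variables (c : model) (V : {vspace 'rV[R]_n.+1}).
Variables (p : 'rV[R]_n.+1) (E : 'M[R]_(m.+1, n.+1)).
Hypothesis fr : model_frame c V p E.
Variable d : R.
Hypotheses (d0 : 0 <= d) (dh : in_half c d).
Hypotheses (cd : c_ c d = height p) (sd : hdot p p = s_ c d ^+ 2).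
Variable mu : {measure set 'rV[R]_n.+1 -> \bar R}.
Local Notation xi := [set x | Defs.space c n x /\ x \in V].
Hypothesis hmu : is_riemannian_measure (ambient_metric c n) xi m.+1 mu.

Local Notation capT := (@cap_area R m false + @cap_area R m true)%E.
Let area : R := fine capT.

Let capT_lty : (capT < +oo)%E.
Proof. by apply: lte_add_pinfty; exact: cap_area_fin. Qed.

Let capT_ge0 : (0 <= capT)%E.
Proof. by apply: adde_ge0; exact: cap_area_ge0. Qed.

Let capT_fin : capT \is a fin_num.
Proof. by rewrite (ge0_fin_numE capT_ge0). Qed.

Let area_gt0 : 0 < area.
Proof.
apply: fine_gt0; apply/andP; split; last exact: capT_lty.
by apply: lt_le_trans (@cap_area_gt0 R m) _; apply: leeDl; exact: cap_area_ge0.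
Qed.

Variables (F : 'rV[R]_n.+1 -> R) (G : R -> R).
Hypothesis iF : mu.-integrable xi (EFin \o F).
Hypothesis mG : measurable_fun (plane_radii c d) G.

Let mxi := measurable_plane fr.

Section one_sheet.
Variable e : R.
Hypothesis he : e = 1 \/ c = spherical /\ e = -1.
Hypothesis FG : forall x, sheet c V p e x -> F x = G (radius c x).

Let w2 t : R := radial_weight c d (m := m) t * area.

Let law A : measurable A -> A `<=` plane_radii c d ->
  mu (sheet c V p e `&` radius c @^-1` A) =
  (\int[lebesgue_measure]_(t in A) (w2 t)%:E)%E.
Proof.
move=> mA AI; rewrite (radius_law fr d0 dh cd sd he hmu mA AI).
rewrite -(fineK capT_fin) -/area -ge0_integralZr//.
- apply/measurable_EFinP; apply: measurable_funS AI _ => //.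
    exact: (measurable_plane_radii fr d0 dh cd sd he).
  exact: (measurable_radial_weight d0 dh).
- by move=> t /AI It; rewrite lee_fin (radial_weight_ge0 d0 dh It).
- by rewrite lee_fin ltW.
Qed.

Let sub_sheet : sheet c V p e `<=` xi. Proof. by move=> x [[]]. Qed.

Let msheet : measurable (sheet c V p e).
Proof. exact: measurable_sheet fr e. Qed.

Let w2_ge0 t : plane_radii c d t -> 0 <= w2 t.
Proof. by move=> It; rewrite mulr_ge0 ?(radial_weight_ge0 d0 dh It)// ltW. Qed.

Let mw2 : measurable_fun (plane_radii c d) w2.
Proof. by apply: measurable_funM => //; exact: (measurable_radial_weight d0 dh). Qed.

Let sheet_in x : sheet c V p e x -> plane_radii c d (radius c x).
Proof. by move=> sx; have [] := sheet_coordinate fr d0 dh cd sd he sx. Qed.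

Let iFG : mu.-integrable (sheet c V p e) (fun x => (G (radius c x))%:E).
Proof.
apply: (eq_integrable msheet (EFin \o F)).
  by move=> x /set_mem sx; rewrite /= FG.
exact: integrableS iF.
Qed.

Let mI := measurable_plane_radii fr d0 dh cd sd he.

Lemma sheet_integrable :
  lebesgue_measure.-integrable (plane_radii c d) (fun t => (G t * radial_weight c d (m := m) t)%:E).
Proof.
have H := @integrable_law _ _ _ _ R mu lebesgue_measure _ _ _ w2 msheet
  (measurable_radius c) mI mw2 w2_ge0 sheet_in law G mG iFG.
(* The density of the law contains the area of the sphere, which is divided out; this is where its
   positivity is used. *)
apply: (@eq_integrable _ _ _ lebesgue_measure _ mI (fun t => (area^-1)%:E * (G t * w2 t)%:E)%E).
  move=> t _; rewrite -EFinM; congr _%:E; rewrite /w2; field.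
  by rewrite gt_eqF.
exact: integrableZl.
Qed.

Lemma sheet_Rintegral :
  (\int[mu]_(x in sheet c V p e) F x)%R =
  area * (\int[lebesgue_measure]_(t in plane_radii c d) (G t * radial_weight c d (m := m) t))%R.
Proof.
rewrite (@eq_Rintegral _ _ _ _ _ (fun x => G (radius c x))) => [|x /set_mem sx]; last exact: FG.
rewrite (@Rintegral_law _ _ _ _ R mu lebesgue_measure _ _ _ w2 msheet
  (measurable_radius c) mI mw2 w2_ge0 sheet_in law G mG iFG).
rewrite -RintegralZl//; last exact: sheet_integrable.
by apply: eq_Rintegral => t _; rewrite /w2; ring.
Qed.

End one_sheet.

Hypothesis FG : forall e, e = 1 \/ c = spherical /\ e = -1 ->
  forall x, sheet c V p e x -> F x = G (radius c x).

Let Rintegral_negligible (A N : set 'rV[R]_n.+1) : measurable A -> measurable N ->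
  A `<=` xi -> mu N = 0%E ->
  (\int[mu]_(x in A) F x = \int[mu]_(x in A `\` N) F x)%R.
Proof.
move=> mA mN Axi N0; rewrite /Rintegral (negligible_integral mN mA _ N0)//.
exact: integrableS iF.
Qed.

(** Up to null sets [xi] is one sheet, or on the sphere two sheets separated by the equator. The two
    contribute equally, whence the factor [2]. *)
Lemma plane_Rintegral :
  (\int[mu]_(x in xi) F x)%R =
  (if c is spherical then 2 * area else area) *
  (\int[lebesgue_measure]_(t in plane_radii c d) (G t * radial_weight c d (m := m) t))%R.
Proof.
have he1 : (1 : R) = 1 \/ c = spherical /\ (1 : R) = -1 by left.
have S1 := sheet_Rintegral he1 (FG he1).
have N1 := frame_point_null fr he1 hmu.
have m1 := measurable_set1_rV ((1 : R) *: p).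
have nsph : c <> spherical -> xi `\` [set 1 *: p] = sheet c V p 1.
  move=> cN; apply/seteqP; split=> x; last by move=> [[]].
  move=> [[sx xV] xp]; split=> //; split=> //; rewrite mul1r.
  case: (c) cN sx => cN /spaceE => [[_ //]|->|]; first by rewrite ltr01.
  by [].
have [cs|cN] := pselect (c = spherical); last first.
  rewrite (Rintegral_negligible mxi m1 _ N1)// nsph// S1.
  by case: (c) cN.
have he2 : (-1 : R) = 1 \/ c = spherical /\ (-1 : R) = -1 by right.
have S2 := sheet_Rintegral he2 (FG he2).
have N2 := frame_point_null fr he2 hmu.
have m2 := measurable_set1_rV ((-1 : R) *: p).
pose N0 : set 'rV[R]_n.+1 := [set x | xi x /\ height x = 0].
have mN0 : measurable N0.
  apply: measurableI; first exact: mxi.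
  exact: (measurable_preimage_setT (@measurable_height R n) (measurable_set1 0)).
have N00 : mu N0 = 0%E.
  rewrite /N0; move: fr hmu; rewrite cs => fr' hmu'.
  exact: equator_null fr' hmu'.
have mxi0 : measurable (xi `\` N0) by exact: measurableD.
have mxi1 : measurable (xi `\` N0 `\` [set 1 *: p]) by exact: measurableD.
rewrite (Rintegral_negligible mxi mN0 _ N00)//.
rewrite (Rintegral_negligible mxi0 m1 _ N1); last by move=> x [].
rewrite (Rintegral_negligible mxi1 m2 _ N2); last by move=> x [[]].
have ph := frame_height fr.
have hZ a (x : 'rV[R]_n.+1) : height (a *: x) = a * height x by rewrite [LHS]mxE.
have -> : xi `\` N0 `\` [set 1 *: p] `\` [set -1 *: p] =
    sheet c V p 1 `|` sheet c V p (-1).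
  apply/seteqP; split => x.
    move=> [[[xix x0] xp1] xp2].
    have [h0|h0|h0] := ltgtP (height x) 0.
    - by right; split=> //; split=> //; rewrite mulN1r oppr_gt0.
    - by left; split=> //; split=> //; rewrite mul1r.
    - by exfalso; apply: x0.
  move=> [|] [[xix hx] xp].
    rewrite mul1r in hx; split; [split; [split=> //|exact: xp]|].
      by move=> [_ h0]; rewrite h0 ltxx in hx.
    by move=> /= xE; move: hx; rewrite xE hZ mulN1r oppr_gt0 ltNge ltW.
  rewrite mulN1r oppr_gt0 in hx; split; [split; [split=> //|]|exact: xp].
    by move=> [_ h0]; rewrite h0 ltxx in hx.
  by move=> /= xE; move: hx; rewrite xE hZ mul1r ltNge ltW.
rewrite Rintegral_setU//.
- by rewrite S1 S2 cs; ring.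
- exact: measurable_sheet fr 1.
- exact: measurable_sheet fr (-1).
- apply: integrableS iF => //.
    exact: measurableU (measurable_sheet fr 1) (measurable_sheet fr (-1)).
  by move=> x [] [[]].
- rewrite disj_set2E; apply/eqP/seteqP; split=> // x [[[_ h1] _] [[_ h2] _]].
  by move: h1 h2; rewrite mul1r mulN1r /=; lra.
Qed.

End plane_integral.

Lemma half_diameterP (R : realType) (c : model) (t : R) :
  (t%:E < diameter c * (2^-1)%:E)%E <-> in_half c t.
Proof.
rewrite /diameter /in_half; case: c => /=.
- by rewrite gt0_mulye ?lte_fin ?invr_gt0// ltry.
- by rewrite gt0_mulye ?lte_fin ?invr_gt0// ltry.
- by rewrite -EFinM lte_fin; split=> [th _|]; [exact: th|exact].
Qed.

Section plane_formula.
Context {R : realType} {n m : nat}.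
Variables (c : model) (V : {vspace 'rV[R]_n.+1}).
Variables (p : 'rV[R]_n.+1) (E : 'M[R]_(m.+1, n.+1)).
Hypothesis fr : model_frame c V p E.
Hypothesis n_gt0 : (1 <= n)%N.
Variable d : R.
Hypotheses (d0 : 0 <= d) (dh : in_half c d).
Hypotheses (cd : c_ c d = height p) (sd : hdot p p = s_ c d ^+ 2).
Local Notation xi := [set x | Defs.space c n x /\ x \in V].

Lemma dist_set_plane : dist_set c (origin n) xi = d.
Proof.
have dpi : c = spherical -> d <= pi / 2 by move=> cs; rewrite ltW// dh.
have dp : dist c (origin n) p = d by exact: dist_polar.
have pV : p \in V.
  by apply/(frame_mem fr); exists 1, 0; rewrite mul0mx addr0 scale1r.
have lb : lbound [set dist c (origin n) y | y in xi] d.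
  move=> _ [y [sy yV] <-]; apply: dist_ge => //.
  have [a [s yE]] := (frame_mem fr y).1 yV.
  have hy : height y = a * height p by rewrite yE (height_frame fr).
  have dy : hdot y y = a ^+ 2 * hdot p p + dot s s by rewrite yE (hdot_frame fr).
  have ss := dot_ge0 s; have p0 := frame_height fr; have := frame_space fr.
  (* For [y = a p + s E], comparing the equations of the space at [y] and [p] forces [a >= 1]
     (hyperbolic), [a = 1] (flat) or [a <= 1] (spherical), so [y] is at least as far as [p]. *)
  clear yE; case: (c) sy cd sd => /spaceE sy cd' sd' /spaceE sp /=.
  - case: sp sy => [pE _] [yE y0]; have a0 : 0 < a by move: y0; rewrite hy pmulr_lgt0.
    rewrite [leLHS]cd' hy ler_pMl// leNgt; apply/negP => a1.
    have : a ^+ 2 < 1 by rewrite expr_lt1// ltW.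
    by move: yE; rewrite dy hy pE exprMn; lra.
  - move: sy; rewrite hy sp mulr1 => a1.
    by move: dy; rewrite a1 expr1n mul1r sd' /= => ->; lra.
  - rewrite [leRHS]cd' hy ger_pMl// leNgt; apply/negP => a1.
    have : 1 < a ^+ 2 by rewrite exprn_egt1.
    by move: sy; rewrite dy hy sp exprMn; lra.
have ne : [set dist c (origin n) y | y in xi] !=set0.
  by exists (dist c (origin n) p), p => //; split => //; exact: frame_space fr.
apply/eqP; rewrite eq_le; apply/andP; split; last exact: lb_le_inf.
rewrite -[leRHS]dp; apply: ge_inf; first by exists d.
by exists p => //; split => //; exact: frame_space fr.
Qed.

Variable mu : {measure set 'rV[R]_n.+1 -> \bar R}.
Hypothesis hmu : is_riemannian_measure (ambient_metric c n) xi m.+1 mu.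
Variable sigma : {measure set 'rV[R]_m.+1 -> \bar R}.
Hypothesis hsigma : is_riemannian_measure 1%:M (unit_sphere m.+1) m sigma.

Variables (F : 'rV[R]_n.+1 -> R) (Ft : R -> R).
Hypothesis mF : measurable_fun (Defs.space c n) F.
Hypothesis FN : c = spherical -> forall x, Defs.space c n x -> F (- x) = F x.
Hypothesis FE : forall x, Defs.space c n x ->
  in_half c (dist c (origin n) x) -> F x = Ft (s_ c (dist c (origin n) x / 2)).
Hypothesis iF : mu.-integrable xi (EFin \o F).

Let G t := Ft (s_ c (t / 2)).

Let F_polar x t : 0 <= t -> in_half c t -> c_ c t = height x ->
  hdot x x = s_ c t ^+ 2 -> F x = G t.
Proof.
move=> t0 th ct st; have tpi : c = spherical -> t <= pi / 2 by move=> cs; rewrite ltW// th.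
have dE := dist_polar n_gt0 t0 tpi ct st.
by rewrite FE ?dE//; exact: space_of_hdot st.
Qed.

Let I_ge0 t : plane_radii c d t -> 0 <= t.
Proof. by move=> [dt _]; exact: le_trans d0 (ltW dt). Qed.

(** Only [F] is assumed measurable. The profile is recovered as the restriction of [F] to a geodesic
    from the origin. *)
Let measurable_profile : measurable_fun (plane_radii c d) G.
Proof.
have o0 : hdot (origin n) (origin n) = s_ c 0 ^+ 2 :> R.
  by rewrite s_at0 /hdot dot_origin height_origin mulr1 subrr expr0n.
(* Applied at the origin, where this merely supplies some horizontal unit vector [u]. *)
have [u [hu u1 _]] := polar_unit n_gt0 (etrans (c_at0 c) (esym height_origin)) o0.
pose x t : 'rV[R]_n.+1 := c_ c t *: origin n + s_ c t *: u.
have hx t : height (x t) = c_ c t by rewrite height_lincomb hu height_origin mulr1 mulr0 addr0.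
have dx t : hdot (x t) (x t) = s_ c t ^+ 2 by rewrite hdot_polar// u1 mulr1.
have mx : measurable_fun setT x.
  apply: measurable_fun_rVP => i.
  rewrite (_ : (fun t => _) = (fun t => c_ c t * origin n ord0 i + s_ c t * u ord0 i)); last first.
    by apply/funext => t; rewrite !mxE.
  apply: measurable_funD; apply: measurable_funM => //.
    exact: continuous_measurable_fun (@continuous_c R c).
  exact: continuous_measurable_fun (@continuous_s R c).
have H : measurable_fun (plane_radii c d) (F \o x).
  apply: (measurable_comp (measurable_space c) _ mF); last exact: measurable_funTS.
  by move=> _ [t It <-]; exact: space_of_hdot (dx t).
apply: eq_measurable_fun H => t /set_mem It; have [_ th] := It.
exact: F_polar (I_ge0 It) th (esym (hx t)) (dx t).
Qed.

(** On the sheet [e = -1] the antipode [- x] lies in the upper hemisphere, and evenness of [F]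
    carries the value over. *)
Let F_sheet e : e = 1 \/ c = spherical /\ e = -1 ->
  forall x, sheet c V p e x -> F x = G (radius c x).
Proof.
move=> he x sx; have [[xx _] _] := sx.
have [It ct st _] := sheet_coordinate fr d0 dh cd sd he sx.
have t0 := I_ge0 It; have [_ th] := It; have [sx' _] := xx.
case: he ct => [->|[cs ->]].
  by rewrite mul1r => ct; exact: F_polar t0 th ct st.
have hN : height (- x) = - height x by rewrite /height mxE.
rewrite mulN1r -hN => ct; rewrite -FN//; apply: (F_polar t0 th ct).
by rewrite -st /hdot hN -scaleN1r dotZ; ring.
Qed.

Local Notation area := (fine (sigma (unit_sphere m.+1))).
Local Notation D := [set t : R | d <= t /\ (t%:E < diameter c * (2^-1)%:E)%E].
Local Notation integrand :=
  (fun t => G t * ((1 - dln_s_ratio c t d ^+ 2) `^ (m.+1%:R / 2 - 1) * s_ c t ^+ m)).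

Let D_split : D = [set d] `|` plane_radii c d.
Proof.
apply/seteqP; split=> t.
  move=> [dt /half_diameterP th]; have [->|dN] := eqVneq t d; first by left.
  by right; split=> //; rewrite lt_neqAle eq_sym dN.
by move=> [->|[dt th]]; (split; [|exact/half_diameterP]) => //; exact: ltW.
Qed.

Let D_radii : D `\` [set d] = plane_radii c d.
Proof.
rewrite D_split; apply/seteqP; split=> t; first by move=> [[]].
by move=> It; split; [right|move=> td; case: It; rewrite td ltxx].
Qed.

Let mI : measurable (plane_radii c d).
Proof. exact: (measurable_plane_radii fr d0 dh cd sd (or_introl erefl)). Qed.

Let integrand_radial t : plane_radii c d t ->
  integrand t = c_ c d * (G t * radial_weight c d (m := m) t).
Proof. by move=> It; rewrite /= radial_weightE//; rewrite /radial_weight; ring. Qed.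

Let integrable_radial : lebesgue_measure.-integrable (plane_radii c d) (EFin \o integrand).
Proof.
have H := sheet_integrable fr d0 dh cd sd hmu iF measurable_profile (or_introl erefl)
  (F_sheet (or_introl erefl)).
apply: (@eq_integrable _ _ _ lebesgue_measure _ mI
  (fun t => (c_ c d)%:E * (G t * radial_weight c d (m := m) t)%:E)%E); last exact: integrableZl.
by move=> t /set_mem It; rewrite -EFinM /= integrand_radial.
Qed.

Lemma integrable_plane : lebesgue_measure.-integrable D (EFin \o integrand).
Proof.
have mD : measurable D by rewrite D_split; exact: measurableU.
(* [D] contains its endpoint [d], where for [d > 0] the base of the power is [0] while the exponent
   may be negative; a single point is null. *)
apply/(@negligible_integrable _ _ _ lebesgue_measure D [set d]) => //.
- rewrite D_split; apply/measurable_funU => //.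
  split; first exact: measurable_fun_set1.
  exact: measurable_int integrable_radial.
- exact: lebesgue_measure_set1.
- by rewrite D_radii.
Qed.

Lemma plane_formula :
  c_ c d * (\int[mu]_(x in xi) F x)%R =
  (if c is spherical then 2 * area else area) *
  (\int[lebesgue_measure]_(t in D) integrand t)%R.
Proof.
have mD : measurable D by rewrite D_split; exact: measurableU.
have H := sheet_integrable fr d0 dh cd sd hmu iF measurable_profile (or_introl erefl)
  (F_sheet (or_introl erefl)).
have -> : (\int[lebesgue_measure]_(t in D) integrand t)%R = c_ c d *
    (\int[lebesgue_measure]_(t in plane_radii c d) (G t * radial_weight c d (m := m) t))%R.
  rewrite -RintegralZl// /Rintegral.
  rewrite (@negligible_integral _ _ _ lebesgue_measure D [set d])//.
  - rewrite D_radii; congr fine; apply: eq_integral => t /set_mem It.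
    by rewrite integrand_radial.
  - exact: integrable_plane.
  - exact: lebesgue_measure_set1.
rewrite (sphere_area hsigma).
rewrite (plane_Rintegral fr d0 dh cd sd hmu iF measurable_profile F_sheet).
by rewrite mulrCA.
Qed.

End plane_formula.

(** * Planes inside the equator, and the conclusion *)

Section degenerate.
Context {R : realType} {n : nat}.

Lemma dist_set_equator (A : set 'rV[R]_n.+1) : (1 <= n)%N -> A !=set0 ->
  (forall x, A x -> Defs.space spherical n x /\ height x = 0) ->
  dist_set spherical (origin n) A = pi / 2.
Proof.
move=> n0 [x0 Ax0] A0.
have dA x : A x -> dist spherical (origin n) x = pi / 2.
  move=> /A0[/spaceE sx hx]; have p0 := pi_ge0 R; apply: dist_polar => //.
  - by rewrite divr_ge0.
  - by rewrite hx /= cos_pihalf.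
  - by rewrite sx hx /= sin_pihalf expr0n expr1n subr0.
rewrite /dist_set (_ : [set _ | _ in _] = [set pi / 2]) ?inf1//.
apply/seteqP; split=> [_ [y /dA <- <-]//|_ ->].
by exists x0 => //; exact: dA.
Qed.

(** Without a point of positive height the model is the sphere, and since the plane is symmetric
    under [x |-> - x] it has no point of negative height either. *)
Lemma plane_frame_or_equator (c : model) m (V : {vspace 'rV[R]_n.+1}) :
  \dim V = m.+2 -> [set x | Defs.space c n x /\ x \in V] !=set0 ->
  (exists p (E : 'M[R]_(m.+1, n.+1)), model_frame c V p E) \/
  c = spherical /\ forall x, Defs.space c n x -> x \in V -> height x = 0.
Proof.
move=> dV [x0 [sx0 x0V]].
have [[x [sx xV hx]]|no] :=
    pselect (exists x, [/\ Defs.space c n x, x \in V & 0 < height x]).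
  by left; apply: model_frame_exists dV _; exists x.
right; have cs : c = spherical.
  case: c no sx0 => // no sx0; exfalso; apply: no; exists x0; split=> //.
    by have /spaceE[] := sx0.
  by have /spaceE -> := sx0; exact: ltr01.
split=> // x sx xV; have [hx|hx|//] := ltgtP (height x) 0; last first.
  by exfalso; apply: no; exists x.
exfalso; apply: no; exists (- x).
have hN : height (- x) = - height x by rewrite /height mxE.
split; [|by rewrite memvN|by rewrite hN oppr_gt0].
move: sx; rewrite cs => /spaceE sx; apply/spaceE.
by rewrite hN sqrrN -sx /hdot hN -scaleN1r dotZ; ring.
Qed.

End degenerate.

Unset Implicit Arguments.

Theorem theorem3p3 (R : realType) (c : model) (n k : nat)
  (hn : (2 <= n)%N) (hk : (1 <= k <= n - 1)%N)
  (f : 'rV[R]_n.+1 -> R[i]) (ft : R -> R[i]) (hf : radial c f ft)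
  (xi : set 'rV[R]_n.+1) (hxi : Xi c n k xi)
  (mu : {measure set 'rV[R]_n.+1 -> \bar R})
  (hmu : is_riemannian_measure (ambient_metric c n) xi k mu)
  (sigma : {measure set 'rV[R]_k -> \bar R})
  (hsigma : is_riemannian_measure 1%:M (unit_sphere k) (k - 1) sigma)
  (hint : cintegrable mu xi f) :
  let d := dist_set c (origin n) xi in
  let area := fine (sigma (unit_sphere k)) in
  let K := if c is spherical then 2 * area else area in
  let D := [set t : R | d <= t /\ (t%:E < diameter c * (2^-1)%:E)%E] in
  let integrand (t : R) : R[i] :=
    ft (s_ c (t / 2)) *
    ((1 - dln_s_ratio c t d ^+ 2) `^ (k%:R / 2 - 1))%:C *
    (s_ c t ^+ (k - 1))%:C in
  cintegrable lebesgue_measure D integrand /\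
  (derive1 (s_ c) d)%:C * kplane_transform mu f xi =
  K%:C * cintegral lebesgue_measure D integrand.
Proof.
case: k hk hxi hmu sigma hsigma => [//|m] _ [xi0 [V [dV xiE]]] hmu sigma hsigma.
subst xi.
rewrite subSS subn0 in hsigma *.
move=> d area K D integrand.
have n0 : (1 <= n)%N by exact: ltnW.
have [[mfr mfi] fN fE] := hf; have [ifr ifi] := hint.
(* [P] stands for the real or the imaginary part, both of which commute with multiplication by real
   factors. *)
have component (P : R[i] -> R) :
    (forall (z : R[i]) (a b : R), P (z * a%:C * b%:C) = P z * (a * b)) ->
    measurable_fun (Defs.space c n) (P \o f) ->
    mu.-integrable [set x | Defs.space c n x /\ x \in V] (fun x => (P (f x))%:E) ->
    lebesgue_measure.-integrable D (EFin \o (fun t => P (integrand t))) /\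
    derive1 (s_ c) d * (\int[mu]_(x in [set x | Defs.space c n x /\ x \in V]) P (f x))%R =
      K * (\int[lebesgue_measure]_(t in D) P (integrand t))%R.
  move=> PM mP iP.
  have -> : (fun t => P (integrand t)) = (fun t => P (ft (s_ c (t / 2))) *
      ((1 - dln_s_ratio c t d ^+ 2) `^ (m.+1%:R / 2 - 1) * s_ c t ^+ m)).
    by apply/funext => t; rewrite PM.
  rewrite derive1_s.
  have [[p [E fr]]|[cs xih]] := plane_frame_or_equator dV xi0.
    (* The polar coordinate of [p] is the distance from the origin to the plane. *)
    have [t [t0 th sE cE _]] := radius_spec (frame_space fr) (lt0r_neq0 (frame_height fr)).
    rewrite (gtr0_norm (frame_height fr)) in cE.
    have dE : d = t by exact: (dist_set_plane fr).
    rewrite /K /D dE.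
    have PN : c = spherical -> forall x, Defs.space c n x -> P (f (- x)) = P (f x).
      by move=> cs x sx; rewrite fN.
    have PE x : Defs.space c n x -> in_half c (dist c (origin n) x) ->
        P (f x) = P (ft (s_ c (dist c (origin n) x / 2))).
      by move=> sx dx; rewrite fE//; apply/half_diameterP.
    split; first exact: (integrable_plane fr n0 t0 th cE sE hmu (Ft := P \o ft) mP PN PE iP).
    exact: (plane_formula fr n0 t0 th cE sE hmu hsigma (Ft := P \o ft) mP PN PE iP).
  have dE : d = pi / 2.
    rewrite /d; move: (xi0) xih; rewrite cs => xi0' xih.
    by apply: dist_set_equator => // x [sx xV]; split=> //; exact: xih.
  (* Here [d] is half the diameter: the range of integration is empty, and the left side vanishes
     because [cos (pi / 2) = 0]. *)
  have -> : D = set0.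
    apply/seteqP; split=> // t [dt /half_diameterP] /(_ cs).
    by rewrite -dE ltNge dt.
  split; first exact: integrable_set0.
  by rewrite Rintegral_set0 dE cs /= cos_pihalf mul0r mulr0.
have ReM (z : R[i]) (a b : R) : complex.Re (z * a%:C * b%:C) = complex.Re z * (a * b).
  by case: z => x y /=; ring.
have ImM (z : R[i]) (a b : R) : complex.Im (z * a%:C * b%:C) = complex.Im z * (a * b).
  by case: z => x y /=; ring.
have [ir er] := component _ ReM mfr ifr.
have [ii ei] := component _ ImM mfi ifi.
split=> //; apply/eqP; rewrite eq_complex /=.
by rewrite !mul0r !subr0 !addr0 er ei !eqxx.
Qed.
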